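(* Let $C$ be a plane branch at $0$ with $g\ge 2$ Puiseux exponents and multiplicity $\beta_0>1$, and let $m\in\mathbb{N}$. For $1\le m<n_1\beta_1+e_1$, $C_m^0=Cont^{>0}(x_0)_m$ is irreducible. For $qn_1\beta_1+e_1\le m<(q+1)n_1\beta_1+e_1$ with $q\ge 1$ in $\mathbb{N}$, the irreducible components of $C_m^0$ are: (a) $C_{m\kappa I}=\overline{Cont^{\kappa\bar\beta_0}(x_0)_m}$, for the integers $\kappa\ge 1$ such that $\kappa\bar\beta_0\bar\beta_1+e_1\le m$; (b) $C^j_{m\kappa v}=\overline{Cont^{\frac{\kappa\bar\beta_0}{n_j\cdots n_g}}(x_0)_m}$, for $j=2,\dots,g$ and integers $\kappa\ge 1$ with $\kappa\not\equiv 0 \bmod n_j$ and $\kappa n_1\cdots n_{j-1}\bar\beta_1+e_1\le m<\kappa\bar\beta_j$; (c) $B_m=Cont^{>n_1q}(x_0)_m$.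
   Context: $\mathbb{N}$ is the set of nonnegative integers. $C\subset\mathbb{C}^2$ is a curve which is analytically irreducible at $0$ (a branch), defined near $0$ by $f\in\mathbb{C}[[x_0,x_1]]$ irreducible, of multiplicity $\beta_0>1$. The curve has a parametrization $x_0=t^{\beta_0}$, $x_1=\sum_{i\ge\beta_0}a_it^i$. Put $\beta_i=\min\{l: a_l\ne 0,\ \gcd(\beta_0,\dots,\beta_{i-1})\nmid l\}$, $e_0=\beta_0$, $e_i=\gcd(e_{i-1},\beta_i)$; $g$ is the integer with $e_g=1$, and $\beta_1,\dots,\beta_g$ are the Puiseux exponents. Put $n_i=e_{i-1}/e_i$, $m_i=\beta_i/e_i$ for $1\le i\le g$. The semigroup $\Gamma(C)=\{\dim_{\mathbb C}\mathbb{C}[[x_0,x_1]]/(f,h): f\nmid h\}$ has unique generators $\bar\beta_0,\dots,\bar\beta_g$ with $\bar\beta_0=\beta_0$, $\bar\beta_i=\min(\Gamma(C)\setminus\langle\bar\beta_0,\dots,\bar\beta_{i-1}\rangle)$; one has $\bar\beta_1=\beta_1$, $e_i=\gcd(\bar\beta_0,\dots,\bar\beta_i)$ and $n_i\bar\beta_i<\bar\beta_{i+1}$. Coordinates are chosen so that $f=(x_1^{n_1}-cx_0^{m_1})^{e_1}+\sum_{a\beta_0+b\beta_1>\beta_0\beta_1}c_{ab}x_0^ax_1^b$ with $c\in\mathbb{C}^*$, $c_{ab}\in\mathbb{C}$; in particular $x_0=0$ is transversal to $C$. $C_m$ is the $m$-th jet scheme of $C$, and $C_m^0=\pi_m^{-1}(0)$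 with $\pi_m:C_m\to C$ the canonical projection; it is the space of pairs $x_i(t)=\sum_{j=0}^m x_i^{(j)}t^j$ ($i=0,1$), with $x_i^{(0)}=0$, such that $f(x_0(t),x_1(t))\equiv 0 \bmod t^{m+1}$, considered inside $\mathbb{C}^2_m=\mathbb{A}^{2(m+1)}$ with coordinates $x_i^{(j)}$. Spaces are considered with reduced structure. For $e\in\mathbb{N}$, $Cont^e(x_0)_m$ (resp. $Cont^{>e}(x_0)_m$) is the set of $m$-jets $\gamma$ of $C$ centred at $0$ with $ord_t\,x_0\circ\gamma=e$ (resp. $>e$). The bar denotes Zariski closure in $C_m^0$. *)

(* Defs.v *)
From HB Require Import structures.
From mathcomp Require Import all_boot all_order all_algebra.
From mathcomp Require Import boolp classical_sets.
From mathcomp.multinomials Require mpoly.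

Set Implicit Arguments.
Unset Strict Implicit.
Unset Printing Implicit Defensive.

Import GRing.Theory.
Local Open Scope classical_set_scope.
Local Open Scope ring_scope.

Record fps (K : Type) := FPS { fcoef : nat -> K }.

HB.instance Definition _ (K : Type) := gen_eqMixin (fps K).
HB.instance Definition _ (K : Type) := gen_choiceMixin (fps K).

Lemma fpsP (K : Type) (u v : fps K) :
  (forall n, fcoef u n = fcoef v n) -> u = v.
Proof. by case: u v => [p] [q] /= pq; congr FPS; apply/funext. Qed.

Section FpsRing.
Variable K : comNzRingType.
Implicit Types u v w : fps K.

Definition fps_zero : fps K := FPS (fun=> 0).
Definition fps_add u v := FPS (fun n => fcoef u n + fcoef v n).
Definition fps_opp u := FPS (fun n => - fcoef u n).
Definition fpsC (c : K) : fps K := FPS (fun n => if n == 0%N then c else 0).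
Definition fps_one : fps K := fpsC 1.
Definition fps_mul u v :=
  FPS (fun n => \sum_(i < n.+1) fcoef u i * fcoef v (n - i)).
Definition fpsX : fps K := FPS (fun n => (n == 1%N)%:R).

Lemma fps_addA : associative fps_add.
Proof. by move=> u v w; apply: fpsP => n /=; rewrite addrA. Qed.

Lemma fps_addC : commutative fps_add.
Proof. by move=> u v; apply: fpsP => n /=; rewrite addrC. Qed.

Lemma fps_add0 : left_id fps_zero fps_add.
Proof. by move=> u; apply: fpsP => n /=; rewrite add0r. Qed.

Lemma fps_addN : left_inverse fps_zero fps_opp fps_add.
Proof. by move=> u; apply: fpsP => n /=; rewrite addNr. Qed.

HB.instance Definition _ :=
  GRing.isZmodule.Build (fps K) fps_addA fps_addC fps_add0 fps_addN.

Let trunc (n : nat) u : {poly K} := \poly_(i < n.+1) fcoef u i.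

Let mul_trunc (n k : nat) u v : (k <= n)%N ->
  fcoef (fps_mul u v) k = (trunc n u * trunc n v)`_k.
Proof.
move=> kn; rewrite coefM /=; apply: eq_bigr => i _.
rewrite !coef_poly !ltnS (leq_trans (leq_subr _ _) kn).
by rewrite (leq_trans _ kn) // -ltnS.
Qed.

Lemma fps_mulC : commutative fps_mul.
Proof.
by move=> u v; apply: fpsP => n; rewrite !(mul_trunc _ _ (leqnn n)) mulrC.
Qed.

Lemma fps_mulA : associative fps_mul.
Proof.
move=> u v w; apply: fpsP => n.
have tE x y k : (k < n.+1)%N ->
    (trunc n (fps_mul x y))`_k = (trunc n x * trunc n y)`_k.
  by move=> kn; rewrite coef_poly kn (@mul_trunc n).
rewrite !(mul_trunc _ _ (leqnn n)) [LHS]coefM [RHS]coefM.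
transitivity ((trunc n u * (trunc n v * trunc n w))`_n).
  by rewrite coefM; apply: eq_bigr => i _; rewrite tE // ltnS leq_subr.
by rewrite mulrA coefM; apply: eq_bigr => i _; rewrite tE.
Qed.

Lemma fps_mul1 : left_id fps_one fps_mul.
Proof.
move=> u; apply: fpsP => n /=.
rewrite big_ord_recl /= mul1r subn0 big1 ?addr0 // => i _.
by rewrite /= mul0r.
Qed.

Lemma fps_mulD : left_distributive fps_mul fps_add.
Proof.
move=> u v w; apply: fpsP => n /=.
by rewrite -big_split; apply: eq_bigr => i _; rewrite mulrDl.
Qed.

Lemma fps_one_neq0 : fps_one != fps_zero.
Proof.
by apply/eqP => /(congr1 (fun u => fcoef u 0)) /eqP /=; rewrite oner_eq0.
Qed.

HB.instance Definition _ := GRing.Zmodule_isComNzRing.Build (fps K)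
  fps_mulA fps_mulC fps_mul1 fps_mulD fps_one_neq0.

End FpsRing.

Section RingNotions.
Variable A : comNzRingType.

Definition ring_unit (u : A) : Prop := exists v, u * v = 1.

Definition ring_dvd (p h : A) : Prop := exists k, h = p * k.

Definition ring_irreducible (p : A) : Prop :=
  [/\ p <> 0, ~ ring_unit p &
      forall u v, p = u * v -> ring_unit u \/ ring_unit v].

Definition ideal2 (p h : A) : set A :=
  [set u | exists k l, u = p * k + h * l].

End RingNotions.

Definition is_min (S : set nat) (n : nat) : Prop :=
  S n /\ forall k, S k -> (n <= k)%N.

(* K[[x0, x1]] is encoded as K[[x0]][[x1]]. *)
Notation bps K := (fps (fps K)).

Section Branch.
Variable K : fieldType.
Implicit Types (f h : bps K) (u v : fps K) (a : nat -> K).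

(* coefficient of x0 ^ i * x1 ^ j *)
Definition bcoef f (i j : nat) : K := fcoef (fcoef f j) i.

Definition bpsC (c : K) : bps K := fpsC (fpsC c).
Definition bps_x0 : bps K := fpsC (fpsX K).
Definition bps_x1 : bps K := fpsX (fps K).

Definition is_multiplicity f (b : nat) : Prop :=
  is_min [set k | exists i j, (i + j)%N = k /\ bcoef f i j <> 0] b.

(* f (u, v); only meaningful when u and v have no constant term, in which case
   u ^+ i * v ^+ j does not contribute to degree n as soon as n < i + j. *)
Definition bps_subst f u v : fps K :=
  FPS (fun n => \sum_(i < n.+1) \sum_(j < n.+1)
                  bcoef f i j * fcoef (u ^+ i * v ^+ j) n).

(* x0 = t ^ b, x1 = \sum_(i >= b) a_i t ^ i *)
Definition is_parametrization f (b : nat) a : Prop :=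
  (forall i, (i < b)%N -> a i = 0) /\
  bps_subst f (fpsX K ^+ b) (FPS a) = 0.

(* d is the dimension of K[[x0, x1]] / (f, h): the classes of the family b
   form a basis of the quotient. *)
Definition quotient_dim f h (d : nat) : Prop :=
  exists b : 'I_d -> bps K, forall w : bps K,
    exists! c : {ffun 'I_d -> K},
      ideal2 f h (w - \sum_(i < d) bpsC (c i) * b i).

Definition semigroup f : set nat :=
  [set s | exists h, ~ ring_dvd f h /\ quotient_dim f h s].

End Branch.

Fixpoint gcd_seq (beta : nat -> nat) (i : nat) : nat :=
  if i is i'.+1 then gcdn (gcd_seq beta i') (beta i) else beta 0%N.

Definition ratio_n (beta : nat -> nat) (i : nat) : nat :=
  gcd_seq beta i.-1 %/ gcd_seq beta i.

Definition ratio_m (beta : nat -> nat) (i : nat) : nat :=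
  beta i %/ gcd_seq beta i.

(* The last condition forces g to be the number of Puiseux exponents. *)
Definition puiseux_exponents (K : fieldType) (a : nat -> K) (g : nat)
    (beta : nat -> nat) : Prop :=
  (forall i, (1 <= i <= g)%N ->
     is_min [set l | a l <> 0 /\ ~~ (gcd_seq beta i.-1 %| l)%N] (beta i)) /\
  gcd_seq beta g = 1%N.

(* the numerical semigroup generated by betab 0, ..., betab k.-1 *)
Definition generated (betab : nat -> nat) (k : nat) : set nat :=
  [set s | exists c : nat -> nat, s = (\sum_(i < k) c i * betab i)%N].

Definition semigroup_generators (G : set nat) (b g : nat)
    (betab : nat -> nat) : Prop :=
  [/\ betab 0%N = b,
      forall i, (1 <= i <= g)%N -> is_min (G `\` generated betab i) (betab i)
    & G = generated betab g.+1].

Definition adapted_coordinates (K : fieldType) (f : bps K)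
    (beta : nat -> nat) : Prop :=
  exists (c : K) (r : bps K),
    [/\ c <> 0,
        forall i j, bcoef r i j <> 0 ->
          (beta 0 * beta 1 < i * beta 0 + j * beta 1)%N
      & f = (bps_x1 K ^+ ratio_n beta 1 - bpsC c * bps_x0 K ^+ ratio_m beta 1)
              ^+ gcd_seq beta 1 + r].

(* Zariski topology on the K-points of the affine space of r x s matrices *)
Section Zariski.
Variables (K : fieldType) (r s : nat).
Implicit Types X Y Z : set 'M[K]_(r, s).

Definition zeros (P : set (mpoly.mpoly (r * s) K)) : set 'M[K]_(r, s) :=
  [set x | forall p, P p -> mpoly.meval (mxvec x ord0) p = 0].

Definition zclosed Z : Prop := exists P, Z = zeros P.

(* closure of Z in the subspace X *)
Definition zclosure_in X Z : set 'M[K]_(r, s) :=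
  [set x | X x /\ forall Y, zclosed Y -> Z `<=` Y -> Y x].

Definition zirreducible Z : Prop :=
  Z !=set0 /\ forall Y1 Y2, zclosed Y1 -> zclosed Y2 ->
    Z `<=` Y1 `|` Y2 -> Z `<=` Y1 \/ Z `<=` Y2.

Definition irreducible_component X Z : Prop :=
  [/\ Z `<=` X, zirreducible Z &
      forall Y, Y `<=` X -> zirreducible Y -> Z `<=` Y -> Y = Z].

End Zariski.

(* The entry (i, j) of a jet x is the coordinate x_i ^ (j). *)
Notation jet_space K m := 'M[K]_(2, m.+1).

Section Jets.
Variables (K : fieldType) (m : nat).
Implicit Types (f : bps K) (x : jet_space K m).

Definition arc x (i : 'I_2) : fps K :=
  FPS (fun j => if (j <= m)%N then x i (inord j) else 0).

Definition jets0 f : set (jet_space K m) :=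
  [set x : jet_space K m | (forall i, x i ord0 = 0) /\
     forall k, (k <= m)%N ->
       fcoef (bps_subst f (arc x ord0) (arc x ord_max)) k = 0].

Definition cont_eq f (e : nat) : set (jet_space K m) :=
  [set x : jet_space K m | jets0 f x /\
     is_min [set k | fcoef (arc x ord0) k <> 0] e].

(* includes the jets along which x0 vanishes identically (infinite order) *)
Definition cont_gt f (e : nat) : set (jet_space K m) :=
  [set x : jet_space K m | jets0 f x /\
     forall k, (k <= e)%N -> fcoef (arc x ord0) k = 0].

Definition cont_closure f (e : nat) : set (jet_space K m) :=
  zclosure_in (jets0 f) (cont_eq f e).

End Jets.

Arguments jets0 {K} m f _.
Arguments cont_eq {K} m f e _.
Arguments cont_gt {K} m f e _.
Arguments cont_closure {K} m f e _.

(* Main.v *)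
(* Write y for the series x1(t) of the parametrization, b = beta 0 and w for a primitive b-th
   root of unity.  The factorization f(t^b, x1) = U * prod_i (x1 - y(w^i t)) with U invertible
   expresses the order of f along an arc as the sum of the contacts of x1 with the conjugates
   of y, and this sum is an increasing function of the largest of them.  Hence an m-jet with
   ord x0 = N lies on C exactly when its x1 agrees up to a computable order with one of the
   conjugates, truncated before the exponent beta_(i+1), where N = kappa n_1 ... n_i and
   n_(i+1) does not divide kappa: Cont^N is either empty, when kappa betab_(i+1) <= m, or the
   image of an affine parameter space minus a hyperplane, hence irreducible.  The sets Cont^N
   with N <= n_1 q are empty unless n_1 | N, and together with B_m they cover C_m^0.
   A closure of Cont^N contains no jet with ord x0 < N.  Conversely, on Cont^(n_1 k) the
   leading coefficient of x0 and the coefficients of the larger stratum satisfy a polynomial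
   relation, because the parameters are too few; it survives in a non-trivial form where the
   leading coefficient vanishes, so that the larger strata are not contained in the closure.
   Finally the generators of the semigroup are computed from the exponents: the dimension of
   the quotient by (f, h) is the order of h(t^b, y(t)), and expanding h in powers of the minimal
   polynomials of the truncations of y determines the possible orders. *)

From HB Require Import structures.
Require Import Defs.
From mathcomp Require Import all_boot all_order all_algebra cyclic all_field.
From mathcomp Require Import boolp classical_sets reals complex.
From mathcomp.multinomials Require mpoly.
From mathcomp Require Import zify ring.

Set Implicit Arguments.
Unset Strict Implicit.
Unset Printing Implicit Defensive.

Import -(notations) mpoly.
Import GRing.Theory Num.Theory.
Local Open Scope classical_set_scope.
Local Open Scope ring_scope.

(** * Power series: orders, evaluation and substitution *)

(** An [x0] of order [kappa * M i], with [M i = n_1 ... n_i], has an [M i]-th root but in general no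
    b-th root, so the factorization does not apply to it directly. The ramification t -> t^(e_i)
    repairs this, since [b = M i * e_i], at the price of multiplying all orders by [e_i]. If n_(i+1)
    does not divide kappa, the tail of y contributes at the order kappa beta_(i+1), which is not a
    multiple of [e_i]; a ramified x1 cannot cancel it, and this caps the order of f. On Cont^N the
    series x0 determines a number L of coefficients of x1, so N + L plays the role of a codimension.
    No dimension theory enters: non-inclusions come from comparing these sums and from an algebraic
    dependence obtained by counting monomials. The constant e_1 is the exact slack on both sides.
    From q n_1 beta_1 + e_1 on, the linear space ord x0 > m / beta_1, ord x1 > m / b has N + L small
    enough to escape the closures of the smaller strata. Below (q+1) n_1 beta_1 + e_1, the stratum
    Cont^(n_1 (q+1)) imposes a single equation beyond order conditions, so its closure contains this
    linear space and B_m stays irreducible. *)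

Section FpsOrder.
Variable R : comNzRingType.
Implicit Types u v w : fps R.

Lemma fcoefF (p : nat -> R) n : fcoef (FPS p) n = p n. Proof. by []. Qed.
Lemma fcoefD u v n : fcoef (u + v) n = fcoef u n + fcoef v n. Proof. by []. Qed.
Lemma fcoefN u n : fcoef (- u) n = - fcoef u n. Proof. by []. Qed.
Lemma fcoefB u v n : fcoef (u - v) n = fcoef u n - fcoef v n. Proof. by []. Qed.
Lemma fcoef0 n : fcoef (0 : fps R) n = 0. Proof. by []. Qed.
Lemma fcoefC (c : R) n : fcoef (fpsC c) n = if n == 0%N then c else 0.
Proof. by []. Qed.
Lemma fcoef1 n : fcoef (1 : fps R) n = (n == 0%N)%:R.
Proof. by rewrite [LHS]/=; case: eqP. Qed.
Lemma fcoefX n : fcoef (fpsX R) n = (n == 1%N)%:R. Proof. by []. Qed.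
Lemma fcoefM u v n :
  fcoef (u * v) n = \sum_(i < n.+1) fcoef u i * fcoef v (n - i).
Proof. by []. Qed.
Lemma fcoef_sum (I : Type) (r : seq I) (P : pred I) (F : I -> fps R) n :
  fcoef (\sum_(i <- r | P i) F i) n = \sum_(i <- r | P i) fcoef (F i) n.
Proof. by elim/big_rec2: _ => // i y x _ <-. Qed.

Lemma fpsC_additive : zmod_morphism (@fpsC R).
Proof.
by move=> c d; apply: fpsP => n; rewrite fcoefB !fcoefC; case: ifP; rewrite ?subr0.
Qed.

Lemma fcoefCM (c : R) u n : fcoef (fpsC c * u) n = c * fcoef u n.
Proof.
rewrite fcoefM big_ord_recl big1 ?addr0 ?subn0 // => i _.
by rewrite fcoefC mul0r.
Qed.

Lemma fpsC_multiplicative : monoid_morphism (@fpsC R).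
Proof.
split=> [//|c d]; apply: fpsP => n.
by rewrite fcoefCM !fcoefC; case: ifP; rewrite ?mulr0.
Qed.

HB.instance Definition _ := GRing.isZmodMorphism.Build R (fps R) (@fpsC R)
  fpsC_additive.
HB.instance Definition _ := GRing.isMonoidMorphism.Build R (fps R) (@fpsC R)
  fpsC_multiplicative.

Lemma fpsC_exp (c : R) k : fpsC c ^+ k = fpsC (c ^+ k).
Proof. by rewrite -rmorphXn. Qed.

Lemma fcoefXM u n :
  fcoef (fpsX R * u) n = if n is n'.+1 then fcoef u n' else 0.
Proof.
case: n => [|n]; first by rewrite fcoefM big_ord1 mul0r.
rewrite fcoefM !big_ord_recl big1 => [|i _]; last by rewrite fcoefX mul0r.
by rewrite !fcoefX /= mul0r mul1r add0r addr0 /bump /= subSS subn0.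
Qed.

Lemma fcoefXnM u k n :
  fcoef (fpsX R ^+ k * u) n = if (n < k)%N then 0 else fcoef u (n - k).
Proof.
elim: k n => [|k IH] [|n]; rewrite ?expr0 ?mul1r ?subn0 // exprS -mulrA fcoefXM //.
Qed.

Lemma fcoefXn k n : fcoef (fpsX R ^+ k) n = (n == k)%:R.
Proof.
rewrite -[_ ^+ k]mulr1 fcoefXnM fcoef1; case: ltngtP => [//|h|->].
  by rewrite subn_eq0 leqNgt h.
by rewrite subnn.
Qed.

(** The zero series has every order in this sense, so [vge n (u - v)] serves as congruence modulo
    t^n throughout. *)
Definition vge (n : nat) u := forall k, (k < n)%N -> fcoef u k = 0.

Lemma vgez n : vge n 0. Proof. by []. Qed.
Lemma vgeW a b u : (a <= b)%N -> vge b u -> vge a u.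
Proof. by move=> ab h k ka; apply: h; apply: leq_trans ab. Qed.
Lemma vgeD n u v : vge n u -> vge n v -> vge n (u + v).
Proof. by move=> hu hv k kn; rewrite fcoefD hu ?hv ?addr0. Qed.
Lemma vgeN n u : vge n u -> vge n (- u).
Proof. by move=> hu k kn; rewrite fcoefN hu ?oppr0. Qed.
Lemma vgeB n u v : vge n u -> vge n v -> vge n (u - v).
Proof. by move=> hu hv; apply: vgeD => //; apply: vgeN. Qed.
Lemma vge_sum n (I : Type) (r : seq I) (P : pred I) (F : I -> fps R) :
  (forall i, P i -> vge n (F i)) -> vge n (\sum_(i <- r | P i) F i).
Proof. by move=> h; elim/big_rec: _ => // i x Pi; apply: vgeD; apply: h. Qed.

Lemma vgeM a b u v : vge a u -> vge b v -> vge (a + b) (u * v).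
Proof.
move=> hu hv k kn; rewrite fcoefM big1 // => i _.
have [ia|ai] := ltnP i a; first by rewrite hu ?mul0r.
by rewrite hv ?mulr0 //; have := ltn_ord i; lia.
Qed.

Lemma vgeMl a u v : vge a u -> vge a (u * v).
Proof. by move=> hu; rewrite -[a]addn0; apply: vgeM. Qed.
Lemma vgeMr a u v : vge a v -> vge a (u * v).
Proof. by rewrite mulrC; apply: vgeMl. Qed.

Lemma vgeX a u k : vge a u -> vge (a * k) (u ^+ k).
Proof.
move=> hu; elim: k => [|k IH]; first by rewrite muln0.
by rewrite exprS mulnS; apply: vgeM.
Qed.

Lemma vge_fpsX k : vge k (fpsX R ^+ k).
Proof. by move=> i ik; rewrite fcoefXn ltn_eqF. Qed.

Lemma vge_eq0 u : (forall n, vge n u) -> u = 0.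
Proof. by move=> h; apply: fpsP => n; rewrite (h n.+1). Qed.

Lemma vgeBP n u v : vge n (u - v) <-> (forall k, (k < n)%N -> fcoef u k = fcoef v k).
Proof.
split=> h k kn; last by rewrite fcoefB h ?subrr.
by apply/eqP; rewrite -subr_eq0 -fcoefB h.
Qed.

Lemma vgeBM n u u' v v' : vge n (u - u') -> vge n (v - v') ->
  vge n (u * v - u' * v').
Proof.
move=> hu hv; have -> : u * v - u' * v' = (u - u') * v + u' * (v - v') by ring.
by apply: vgeD; [apply: vgeMl | apply: vgeMr].
Qed.

Lemma vgeBX n u v k : vge n (u - v) -> vge n (u ^+ k - v ^+ k).
Proof.
move=> h; elim: k => [|k IH]; first by rewrite subrr.
by rewrite !exprS; apply: vgeBM.
Qed.

Lemma vgeB_trans n u v w : vge n (u - v) -> vge n (v - w) -> vge n (u - w).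
Proof. by move=> h1 h2; rewrite -(subrKA v); apply: vgeD. Qed.

Lemma vgeBC n u v : vge n (u - v) -> vge n (v - u).
Proof. by move=> h; rewrite -opprB; apply: vgeN. Qed.

Lemma fcoefM_lead a b u v : vge a u -> vge b v ->
  fcoef (u * v) (a + b) = fcoef u a * fcoef v b.
Proof.
have ab : (a < (a + b).+1)%N by rewrite ltnS leq_addr.
move=> hu hv; rewrite fcoefM (bigD1 (Ordinal ab)) //= addKn big1 ?addr0 // => i.
rewrite -val_eqE /= => ia.
have [h|h|h] := ltngtP i a; last by rewrite h eqxx in ia.
  by rewrite hu ?mul0r.
by rewrite hv ?mulr0 //; have := ltn_ord i; lia.
Qed.

Lemma fcoefX_lead a u k : vge a u ->
  fcoef (u ^+ k) (a * k) = fcoef u a ^+ k.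
Proof.
move=> hu; elim: k => [|k IH]; first by rewrite muln0 !expr0 fcoef1.
by rewrite !exprS mulnS fcoefM_lead ?IH //; apply: vgeX.
Qed.

Lemma fcoef0M u v : fcoef (u * v) 0 = fcoef u 0 * fcoef v 0.
Proof. by rewrite -(@fcoefM_lead 0 0). Qed.

Lemma fcoef0X u k : fcoef (u ^+ k) 0 = fcoef u 0 ^+ k.
Proof. by rewrite -(@fcoefX_lead 0) ?mul0n. Qed.

Definition fconst u : R := fcoef u 0.

Lemma fconst_additive : zmod_morphism fconst. Proof. by []. Qed.

Lemma fconst_multiplicative : monoid_morphism fconst.
Proof. by split=> [//|u v]; apply: fcoef0M. Qed.

HB.instance Definition _ := GRing.isZmodMorphism.Build (fps R) R fconst
  fconst_additive.
HB.instance Definition _ := GRing.isMonoidMorphism.Build (fps R) R fconst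
  fconst_multiplicative.

Definition fshift (k : nat) u := FPS (fun n => fcoef u (n + k)).

Lemma fcoef_shift k u n : fcoef (fshift k u) n = fcoef u (n + k).
Proof. by []. Qed.

Lemma fshiftK k u : vge k u -> u = fpsX R ^+ k * fshift k u.
Proof.
move=> h; apply: fpsP => n; rewrite fcoefXnM.
by case: ltnP => [/h //|kn]; rewrite /= subnK.
Qed.

Definition ftrunc (n : nat) u := FPS (fun k => if (k < n)%N then fcoef u k else 0).

Lemma fcoef_trunc n u k :
  fcoef (ftrunc n u) k = if (k < n)%N then fcoef u k else 0.
Proof. by []. Qed.

Lemma vge_ftrunc n u : vge n (u - ftrunc n u).
Proof. by apply/vgeBP => k /= ->. Qed.

Lemma ftruncE n u : ftrunc n u = \sum_(k < n) fpsC (fcoef u k) * fpsX R ^+ k.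
Proof.
apply: fpsP => j; rewrite fcoef_sum [LHS]/=; case: ltnP => [jn|nj].
  rewrite (bigD1 (Ordinal jn)) // big1 => [|i].
    by rewrite Monoid.mulm1 mulrC fcoefXnM ltnn subnn.
  rewrite -val_eqE mulrC fcoefXnM => /= ij; case: ltnP => // le_ij.
  by rewrite subn_eq0 leqNgt ltn_neqAle ij le_ij.
rewrite big1 // => i _; rewrite mulrC fcoefXnM fcoefC; case: ltnP => // le_ij.
by rewrite subn_eq0 leqNgt (leq_trans (ltn_ord i)).
Qed.

End FpsOrder.

Arguments fshift {R} k u.
Arguments ftrunc {R} n u.

Section Eval.
Variables (R K : comNzRingType).

Definition ftail (v : fps K) : fps K :=
  FPS (fun n => if n == 0%N then 0 else fcoef v n).

Lemma vge_ftail v : vge 1 (ftail v).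
Proof. by case. Qed.

Lemma ftailE v : fcoef v 0 = 0 -> ftail v = v.
Proof. by move=> v0; apply: fpsP => -[|n] //=; rewrite v0. Qed.

(* Discarding the constant term of v makes this evaluation total, hence a ring
   morphism for every v. *)
Definition feval (phi : R -> fps K) (v : fps K) (f : fps R) : fps K :=
  FPS (fun n => \sum_(j < n.+1) fcoef (phi (fcoef f j) * ftail v ^+ j) n).

Variables (phi : {rmorphism R -> fps K}) (v : fps K).

Lemma fcoef_feval f n : fcoef (feval phi v f) n =
  \sum_(j < n.+1) fcoef (phi (fcoef f j) * ftail v ^+ j) n.
Proof. by []. Qed.

Lemma vge_ftailX j : vge j (ftail v ^+ j).
Proof. by rewrite -[X in vge X]mul1n; apply: vgeX; apply: vge_ftail. Qed.

Lemma feval_sum N (f : fps R) :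
  vge N (feval phi v f - \sum_(j < N) phi (fcoef f j) * ftail v ^+ j).
Proof.
apply/vgeBP => k kN; rewrite fcoef_sum [LHS]/=.
rewrite (big_ord_widen _ (fun j => fcoef (phi (fcoef f j) * ftail v ^+ j) k) kN).
rewrite big_mkcond; apply: eq_bigr => j _; case: ifP => // /negbT.
rewrite -leqNgt => kj.
by rewrite (_ : fcoef _ _ = 0) //; apply: (vgeMr _ (@vge_ftailX j)).
Qed.

Let tpoly N (f : fps R) : {poly R} := \poly_(j < N) fcoef f j.

Lemma feval_horner N (f : fps R) :
  vge N (feval phi v f - (map_poly phi (tpoly N f)).[ftail v]).
Proof.
rewrite (_ : _.[_] = \sum_(j < N) phi (fcoef f j) * ftail v ^+ j).
  exact: feval_sum.
rewrite (@horner_coef_wide _ N); last first.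
  by apply: leq_trans (size_poly _ _) (size_poly _ _).
by apply: eq_bigr => i _; rewrite coef_map coef_poly ltn_ord.
Qed.

Lemma feval_additive : zmod_morphism (feval phi v).
Proof.
move=> f g; apply: fpsP => n; rewrite fcoefB !fcoef_feval -sumrB.
by apply: eq_bigr => i _; rewrite -fcoefB -mulrBl -rmorphB.
Qed.

Lemma feval_multiplicative : monoid_morphism (feval phi v).
Proof.
split.
  apply: fpsP => n; rewrite fcoef_feval big_ord_recl big1 => [|i _].
    by rewrite Monoid.mulm1 expr0 mulr1 rmorph1.
  by rewrite rmorph0 mul0r.
move=> f g; apply: fpsP => n.
have /vgeBP -> // := @feval_horner n.+1 (f * g).
have /vgeBP h := vgeBM (@feval_horner n.+1 f) (@feval_horner n.+1 g).
rewrite h // -hornerM -rmorphM.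
suff [q hq] : exists q : {poly R},
    tpoly n.+1 f * tpoly n.+1 g = tpoly n.+1 (f * g) + q * 'X^(n.+1).
  rewrite hq rmorphD rmorphM /= map_polyXn hornerD hornerM hornerXn fcoefD.
  by rewrite (vgeMr _ (@vge_ftailX n.+1)) ?addr0.
exists (drop_poly n.+1 (tpoly n.+1 f * tpoly n.+1 g)).
rewrite -{1}[LHS](poly_take_drop n.+1); congr (_ + _).
apply/polyP => i; rewrite coef_take_poly coef_poly; case: ifP => // i_n.
rewrite coefM fcoefM; apply: eq_bigr => j _.
have jn : (j < n.+1)%N by case: j => j /=; lia.
by rewrite !coef_poly jn (_ : (i - j < n.+1)%N) //; lia.
Qed.

HB.instance Definition _ := GRing.isZmodMorphism.Build (fps R) (fps K)
  (feval phi v) feval_additive.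
HB.instance Definition _ := GRing.isMonoidMorphism.Build (fps R) (fps K)
  (feval phi v) feval_multiplicative.

Lemma fevalC c : feval phi v (fpsC c) = phi c.
Proof.
apply: fpsP => n; rewrite fcoef_feval big_ord_recl big1 => [|i _].
  by rewrite Monoid.mulm1 expr0 mulr1.
by rewrite rmorph0 mul0r.
Qed.

Lemma fevalX : feval phi v (fpsX R) = ftail v.
Proof.
apply: fpsP => n; have /vgeBP -> // := @feval_sum n.+2 (fpsX R).
rewrite big_ord_recl big_ord_recl big1 => [|i _]; last first.
  rewrite (_ : fcoef (fpsX R) _ = 0) //; by rewrite rmorph0 mul0r.
rewrite (_ : fcoef (fpsX R) ord0 = 0) // (_ : fcoef (fpsX R) _ = 1) //.
by rewrite rmorph0 rmorph1 mul0r mul1r !Monoid.simpm expr1.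
Qed.

Lemma vge_feval n f : vge n f -> vge n (feval phi v f).
Proof.
move=> h k kn; rewrite fcoef_feval big1 // => j _.
by rewrite h ?rmorph0 ?mul0r //; case: j => j /=; lia.
Qed.

(* Continuity for the orders of vanishing makes a morphism out of a power series
   ring determined by its values on constants and on the variable. *)
Lemma eq_fmorph (f g : {rmorphism fps R -> fps K}) :
  (forall n u, vge n u -> vge n (f u)) -> (forall n u, vge n u -> vge n (g u)) ->
  (forall c, f (fpsC c) = g (fpsC c)) -> f (fpsX R) = g (fpsX R) -> f =1 g.
Proof.
move=> hf hg hC hX u; apply: fpsP => n.
have e : f (ftrunc n.+1 u) = g (ftrunc n.+1 u).
  rewrite ftruncE !rmorph_sum; apply: eq_bigr => k _.
  by rewrite !rmorphM !rmorphXn hC hX.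
have /vgeBP h1 : vge n.+1 (f u - f (ftrunc n.+1 u)).
  by rewrite -rmorphB; apply: hf; apply: vge_ftrunc.
have /vgeBP h2 : vge n.+1 (g u - g (ftrunc n.+1 u)).
  by rewrite -rmorphB; apply: hg; apply: vge_ftrunc.
by rewrite h1 // h2 // e.
Qed.

End Eval.

Section EvalCongr.
Variables (R K : comNzRingType).
Lemma vge_fevalB n (phi psi : {rmorphism R -> fps K}) (v w : fps K) f :
  (forall c, vge n (phi c - psi c)) -> vge n (v - w) ->
  vge n (feval phi v f - feval psi w f).
Proof.
move=> hc hv; apply/vgeBP => k kn; rewrite !fcoef_feval; apply: eq_bigr => j _.
have /vgeBP -> // : vge n (phi (fcoef f j) * ftail v ^+ j -
   psi (fcoef f j) * ftail w ^+ j).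
apply: vgeBM => //; apply: vgeBX.
by move/vgeBP: hv => hv; apply/vgeBP => -[//|i] h; rewrite /= hv.
Qed.
End EvalCongr.

Section Substitution.
Variable K : comNzRingType.
Implicit Types u v : fps K.

Definition fcomp u : fps K -> fps K := feval (@fpsC K) u.
HB.instance Definition _ u := GRing.RMorphism.copy (fcomp u) (feval (@fpsC K) u).

Definition bsub u v : bps K -> fps K := feval (fcomp u) v.
HB.instance Definition _ u v := GRing.RMorphism.copy (bsub u v) (feval (fcomp u) v).

Lemma fcompC u (c : K) : fcomp u (fpsC c) = fpsC c. Proof. exact: fevalC. Qed.
Lemma fcompX u : fcomp u (fpsX K) = ftail u. Proof. exact: fevalX. Qed.
Lemma bsubC u v (c : fps K) : bsub u v (fpsC c) = fcomp u c. Proof. exact: fevalC. Qed.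
Lemma bsubX u v : bsub u v (fpsX _) = ftail v. Proof. exact: fevalX. Qed.
Lemma vge_fcomp1 n u c : vge n c -> vge n (fcomp u c). Proof. exact: vge_feval. Qed.
Lemma vge_bsub n u v (f : bps K) : vge n f -> vge n (bsub u v f).
Proof. exact: vge_feval. Qed.

Lemma fcoef_fcomp u c n : fcoef (fcomp u c) n =
  \sum_(j < n.+1) fcoef (fpsC (fcoef c j) * ftail u ^+ j) n.
Proof. by []. Qed.

Lemma fcoef_bsub u v (f : bps K) n : fcoef (bsub u v f) n =
  \sum_(j < n.+1) fcoef (fcomp u (fcoef f j) * ftail v ^+ j) n.
Proof. by []. Qed.

Lemma fcomp0 u c : fcoef (fcomp u c) 0 = fcoef c 0.
Proof. by rewrite fcoef_fcomp big_ord1 expr0 mulr1. Qed.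

End Substitution.

Section MapFps.
Variables (R R' : comNzRingType).
Definition map_fps (phi : R -> R') (f : fps R) : fps R' :=
  FPS (fun n => phi (fcoef f n)).
Variable phi : {rmorphism R -> R'}.

Lemma fcoef_map f n : fcoef (map_fps phi f) n = phi (fcoef f n).
Proof. by []. Qed.

Lemma map_fps_additive : zmod_morphism (map_fps phi).
Proof. by move=> f g; apply: fpsP => n; rewrite fcoefB !fcoef_map rmorphB. Qed.

Lemma map_fps_multiplicative : monoid_morphism (map_fps phi).
Proof.
split=> [|f g]; apply: fpsP => n; rewrite fcoef_map.
  by rewrite !fcoef1; case: eqP; rewrite ?rmorph1 ?rmorph0.
by rewrite !fcoefM rmorph_sum; apply: eq_bigr => i _; rewrite rmorphM.
Qed.

HB.instance Definition _ := GRing.isZmodMorphism.Build (fps R) (fps R')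
  (map_fps phi) map_fps_additive.
HB.instance Definition _ := GRing.isMonoidMorphism.Build (fps R) (fps R')
  (map_fps phi) map_fps_multiplicative.

Lemma vge_map n f : vge n f -> vge n (map_fps phi f).
Proof. by move=> h k kn; rewrite fcoef_map h ?rmorph0. Qed.

Lemma map_fpsC c : map_fps phi (fpsC c) = fpsC (phi c).
Proof.
by apply: fpsP => n; rewrite fcoef_map !fcoefC; case: eqP; rewrite ?rmorph0.
Qed.

Lemma map_fpsX : map_fps phi (fpsX R) = fpsX R'.
Proof.
by apply: fpsP => n; rewrite fcoef_map !fcoefX; case: eqP; rewrite ?rmorph0 ?rmorph1.
Qed.

End MapFps.

Lemma feval_id_map (R K : comNzRingType) (v : fps K) (phi : {rmorphism R -> fps K})
  (c : fps R) : feval idfun v (map_fps phi c) = feval phi v c.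
Proof. by []. Qed.

Section Unit.
Variable R : comNzRingType.

(** Compose the geometric series with [1 - u * r], which has no constant term. Coefficients in a
    ring allow a second use over K[[x0]], for K[[x0]][[x1]]. *)
Lemma fps_inv (u : fps R) r : fcoef u 0 * r = 1 -> exists w, u * w = 1.
Proof.
move=> ur; pose x := 1 - u * fpsC r.
have x0 : fcoef x 0 = 0 by rewrite fcoefB fcoef1 mulrC fcoefCM mulrC ur subrr.
pose g : fps R := FPS (fun=> 1).
have gE : (1 - fpsX R) * g = 1.
  apply: fpsP => n; rewrite mulrBl mul1r fcoefB fcoefXM fcoef1.
  by case: n => [|n] /=; rewrite ?subr0 ?subrr.
exists (fpsC r * fcomp x g).
have := congr1 (fcomp x) gE; rewrite rmorphM rmorphB /= !rmorph1 fcompX ftailE //.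
by rewrite /x subKr mulrA.
Qed.

End Unit.

Section Compose.
Variable K : comNzRingType.
Implicit Types (u v w s : fps K) (f : bps K).

Lemma vge_fcomp k n s c : (0 < k)%N -> vge k s -> vge n c ->
  vge (k * n) (fcomp s c).
Proof.
move=> k0 hs hc; rewrite (fshiftK hc) rmorphM rmorphXn /= fcompX ftailE ?hs //.
by apply: vgeMl; apply: vgeX.
Qed.

Lemma fcomp_fcomp u w c : fcoef w 0 = 0 ->
  fcomp u (fcomp w c) = fcomp (fcomp u w) c.
Proof.
move=> w0; pose g : {rmorphism fps K -> fps K} := fcomp u \o fcomp w.
apply: (@eq_fmorph _ _ g).
- by move=> n d h; apply: vge_fcomp1; apply: vge_fcomp1.
- by move=> n d h; apply: vge_fcomp1.
- by move=> d; rewrite /= !fcompC.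
by rewrite /= !fcompX !ftailE // fcomp0.
Qed.

Lemma fcomp_X u : fcomp (fpsX K) u = u.
Proof.
apply: (@eq_fmorph _ _ (fcomp (fpsX K)) idfun).
- by move=> n d h; apply: vge_fcomp1.
- by [].
- by move=> d; rewrite /= fcompC.
by rewrite /= fcompX ftailE.
Qed.

Lemma bsub_map u v w f : fcoef w 0 = 0 ->
  bsub u v (map_fps (fcomp w) f) = bsub (fcomp u w) v f.
Proof.
move=> w0; pose g : {rmorphism bps K -> fps K} := bsub u v \o map_fps (fcomp w).
apply: (@eq_fmorph _ _ g).
- by move=> n d h; apply: vge_bsub; apply: vge_map.
- by move=> n d h; apply: vge_bsub.
- by move=> d; rewrite /= map_fpsC !bsubC /= fcomp_fcomp.
by rewrite /= map_fpsX !bsubX.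
Qed.

Lemma fcomp_bsub u s v f : fcoef s 0 = 0 -> fcoef v 0 = 0 ->
  fcomp u (bsub s v f) = bsub (fcomp u s) (fcomp u v) f.
Proof.
move=> s0 v0; pose g : {rmorphism bps K -> fps K} := fcomp u \o bsub s v.
apply: (@eq_fmorph _ _ g).
- by move=> n d h; apply: vge_fcomp1; apply: vge_bsub.
- by move=> n d h; apply: vge_bsub.
- by move=> d; rewrite /= !bsubC fcomp_fcomp.
by rewrite /= !bsubX !ftailE // fcomp0.
Qed.

Lemma vge_bsubB n u u' v v' f : vge n (u - u') -> vge n (v - v') ->
  vge n (bsub u v f - bsub u' v' f).
Proof.
move=> hu hv; apply: vge_fevalB => // c; apply: vge_fevalB => // d.
by rewrite subrr.
Qed.

Lemma fcoef_fcomp_monom z e c n : (0 < e)%N ->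
  fcoef (fcomp (fpsC z * fpsX K ^+ e) c) n =
  if (e %| n)%N then fcoef c (n %/ e) * z ^+ (n %/ e) else 0.
Proof.
move=> e0; rewrite fcoef_fcomp ftailE; last first.
  by rewrite mulrC fcoefXnM e0.
have E (j : nat) : fcoef (fpsC (fcoef c j) * (fpsC z * fpsX K ^+ e) ^+ j) n =
   if n == (e * j)%N then fcoef c j * z ^+ j else 0.
  rewrite fcoefCM exprMn fpsC_exp fcoefCM -exprM fcoefXn mulrA.
  by case: eqP; rewrite ?mulr1 ?mulr0.
under eq_bigr do rewrite E.
case: ifP => [/dvdnP[q ->]|h].
  have qn : (q < (q * e).+1)%N by rewrite ltnS leq_pmulr.
  rewrite mulnK // (bigD1 (Ordinal qn)) //= [(e * q)%N]mulnC eqxx big1 ?addr0 // => i.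
  by rewrite -val_eqE => /= ni; rewrite [(e * i)%N]mulnC eqn_pmul2r // eq_sym (negbTE ni).
rewrite big1 // => i _; case: eqP => // ne.
by rewrite ne dvdn_mulr in h.
Qed.

Lemma fcoef_dil e c n : (0 < e)%N ->
  fcoef (fcomp (fpsX K ^+ e) c) n = if (e %| n)%N then fcoef c (n %/ e) else 0.
Proof.
move=> e0; rewrite -[fpsX K ^+ e]mul1r -(rmorph1 (@fpsC K)) fcoef_fcomp_monom //.
by rewrite expr1n mulr1.
Qed.

Lemma fcoef_rot z c n :
  fcoef (fcomp (fpsC z * fpsX K) c) n = fcoef c n * z ^+ n.
Proof. by rewrite -[fpsX K]expr1 fcoef_fcomp_monom // dvd1n divn1. Qed.

Lemma vge_dil e n c : (0 < e)%N ->
  vge n c <-> vge (e * n) (fcomp (fpsX K ^+ e) c).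
Proof.
move=> e0; split=> h.
  by apply: vge_fcomp => //; apply: vge_fpsX.
move=> k kn; have := h (e * k)%N; rewrite fcoef_dil // dvdn_mulr // mulKn //.
by apply; rewrite ltn_pmul2l.
Qed.

End Compose.

Section Order.
Variable K : fieldType.
Implicit Types u v w s : fps K.

Lemma bps_substE (f : bps K) u v : fcoef u 0 = 0 -> fcoef v 0 = 0 ->
  bps_subst f u v = bsub u v f.
Proof.
move=> u0 v0; apply: fpsP => n; rewrite fcoef_bsub ftailE //.
rewrite [LHS](exchange_big _ _ _ _ _ (fun i j : 'I_n.+1 => _)).
apply: eq_bigr => j _; symmetry.
have h := @feval_sum _ _ (@fpsC K) u n.+1 (fcoef f j); rewrite ftailE // in h.
have {h} /vgeBP h : vge n.+1 (fcomp u (fcoef f j) * v ^+ j -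
   (\sum_(i < n.+1) fpsC (bcoef f i j) * u ^+ i) * v ^+ j).
  by apply: vgeBM; last by rewrite subrr.
rewrite h // mulr_suml fcoef_sum; apply: eq_bigr => i _.
by rewrite -mulrA fcoefCM.
Qed.

Definition ordeq u (n : nat) := vge n u /\ fcoef u n != 0.

Lemma ordeq_ex u : u <> 0 -> exists n, ordeq u n.
Proof.
move=> u0; have h : exists n, fcoef u n != 0.
  apply: contrapT => /forallNP h; apply: u0; apply: fpsP => n.
  by have /negP := h n; rewrite negbK => /eqP.
exists (ex_minn h); case: ex_minnP => n un hn; split=> // k kn.
by apply/eqP; apply: contraTT kn => uk; rewrite -leqNgt hn.
Qed.

Lemma ordeq_le u n m : ordeq u n -> vge m u -> (m <= n)%N.
Proof.
by move=> [_ un] h; rewrite leqNgt; apply/negP => nm; rewrite h ?eqxx in un.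
Qed.

Lemma ordeq_uniq u n m : ordeq u n -> ordeq u m -> n = m.
Proof.
move=> hn hm; apply/eqP; rewrite eqn_leq (ordeq_le hn) ?(ordeq_le hm) //.
  by case: hn.
by case: hm.
Qed.

Lemma ordeq_neq0 u n : ordeq u n -> u <> 0.
Proof. by move=> [_ un] u0; rewrite u0 eqxx in un. Qed.

Lemma ordeqM u v a b : ordeq u a -> ordeq v b -> ordeq (u * v) (a + b).
Proof.
move=> [hu ua] [hv vb]; split; first exact: vgeM.
by rewrite fcoefM_lead // mulf_neq0.
Qed.

Lemma ordeq1 : ordeq 1 0.
Proof. by split=> //; rewrite fcoef1 oner_neq0. Qed.

Lemma ordeqX u a k : ordeq u a -> ordeq (u ^+ k) (a * k).
Proof.
move=> hu; elim: k => [|k IH]; first by rewrite muln0; apply: ordeq1.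
by rewrite exprS mulnS; apply: ordeqM.
Qed.

Lemma ordeq_fpsX k : ordeq (fpsX K ^+ k) k.
Proof. by split; [apply: vge_fpsX | rewrite fcoefXn eqxx oner_neq0]. Qed.

Lemma ordeq_prod (I : Type) (r : seq I) (P : pred I) (F : I -> fps K) (o : I -> nat) :
  (forall i, P i -> ordeq (F i) (o i)) ->
  ordeq (\prod_(i <- r | P i) F i) (\sum_(i <- r | P i) o i).
Proof.
move=> h; elim/big_rec2: _ => [|i y x Pi]; first exact: ordeq1.
by apply: ordeqM; apply: h.
Qed.

Lemma vge_prod (I : Type) (r : seq I) (P : pred I) (F : I -> fps K) (o : I -> nat) :
  (forall i, P i -> vge (o i) (F i)) ->
  vge (\sum_(i <- r | P i) o i) (\prod_(i <- r | P i) F i).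
Proof.
by move=> h; elim/big_rec2: _ => [//|i y x Pi]; apply: vgeM; apply: h.
Qed.

Lemma ordeqDl u v n : ordeq u n -> vge n.+1 v -> ordeq (u + v) n.
Proof.
move=> [hu un] hv; split; last by rewrite fcoefD hv // addr0.
by apply: vgeD => //; apply: vgeW hv.
Qed.

Lemma fps_mulf_eq0 u v : u * v = 0 -> u = 0 \/ v = 0.
Proof.
move=> uv; apply: contrapT => /not_orP[/ordeq_ex[a ha] /ordeq_ex[b hb]].
by apply: (ordeq_neq0 (ordeqM ha hb)).
Qed.

Lemma fps_prod_neq0 (I : Type) (r : seq I) (P : pred I) (F : I -> fps K) :
  (forall i, P i -> F i <> 0) -> \prod_(i <- r | P i) F i <> 0.
Proof.
move=> h; elim/big_rec: _ => [|i x Pi x0]; first exact: (ordeq_neq0 ordeq1).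
by move=> /fps_mulf_eq0[]; first exact: h.
Qed.

Lemma ordeq_fcomp k n s c : (0 < k)%N -> ordeq s k -> ordeq c n ->
  ordeq (fcomp s c) (k * n).
Proof.
move=> k0 hs [hc cn].
rewrite (fshiftK hc) rmorphM rmorphXn /= fcompX ftailE; last by case: hs => h _; apply: h.
rewrite -[(k * n)%N]addn0; apply: ordeqM; first exact: ordeqX.
by split=> //; rewrite fcomp0 /= add0n.
Qed.

Lemma fps_root (u : fps K) (e : nat) c0 :
  e%:R != 0 :> K -> c0 != 0 -> c0 ^+ e = fcoef u 0 ->
  exists2 s, fcoef s 0 = c0 & s ^+ e = u.
Proof.
move=> e0 c00 hc0.
(* Newton approximation: [rt n] is correct up to order n, and the next coefficient is the current
   error divided by the derivative e c0^(e-1) of the e-th power. *)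
pose fix rt n := if n is n'.+1 then
    rt n' + fpsC ((fcoef u n - fcoef (rt n' ^+ e) n) / (c0 ^+ e.-1 *+ e)) * fpsX K ^+ n
  else fpsC c0.
have rtS n : rt n.+1 = rt n + fpsC ((fcoef u n.+1 - fcoef (rt n ^+ e) n.+1) /
  (c0 ^+ e.-1 *+ e)) * fpsX K ^+ n.+1 by [].
have dv n z : vge n (fpsC z * fpsX K ^+ n) by apply: vgeMr; apply: vge_fpsX.
have rt0 n : fcoef (rt n) 0 = c0.
  by elim: n => [//|n IH]; rewrite rtS fcoefD IH dv // addr0.
have ep : (0 < e)%N by case: (e) e0; rewrite ?eqxx.
have rtE n : vge n.+1 (rt n ^+ e - u).
  elim: n => [|n IH] k.
    by rewrite ltnS leqn0 => /eqP ->; rewrite fcoefB fcoef0X /= hc0 subrr.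
  rewrite -(subrKA (rt n ^+ e)) subrXX.
  have -> : rt n.+1 - rt n = fpsC ((fcoef u n.+1 - fcoef (rt n ^+ e) n.+1) /
    (c0 ^+ e.-1 *+ e)) * fpsX K ^+ n.+1 by rewrite rtS [LHS]addrAC subrr add0r.
  rewrite ltnS leq_eqVlt => /orP[/eqP ->|kn]; last first.
    by rewrite fcoefD IH // addr0 (vgeMl _ (dv _ _)).
  rewrite fcoefD -mulrA fcoefCM fcoefXnM ltnn subnn fcoef_sum.
  rewrite [X in _ * X](_ : _ = c0 ^+ e.-1 *+ e).
    rewrite divfK; first by rewrite fcoefB; ring.
    by rewrite -mulr_natr mulf_neq0 // expf_neq0.
  rewrite (eq_bigr (fun=> c0 ^+ e.-1)) ?sumr_const ?card_ord // => i _.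
  by rewrite fcoef0M !fcoef0X !rt0 -exprD subnK //; have := ltn_ord i; lia.
pose s := FPS (fun n => fcoef (rt n) n).
have sE n : vge n.+1 (s - rt n).
  apply/vgeBP => k; rewrite ltnS => kn; rewrite [LHS]/= -(subnK kn).
  elim: (n - k)%N => [//|d IH]; rewrite addSn rtS fcoefD IH dv ?addr0 //.
  by rewrite ltnS leq_addl.
exists s => //; apply/eqP; rewrite -subr_eq0; apply/eqP; apply: vge_eq0 => -[//|n].
by apply: vgeB_trans (rtE n); apply: vgeBX.
Qed.

End Order.

Lemma ordeq_root_lead (K : numFieldType) (u : fps K) (k e : nat) (c : K) :
  (0 < e)%N -> ordeq u (k * e) -> c ^+ e = fcoef u (k * e) ->
  exists s, [/\ ordeq s k, s ^+ e = u & fcoef s k = c].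
Proof.
move=> e0 [hu ue] ce.
have c0 : c != 0 by apply: contraNneq ue => c0; rewrite -ce c0 expr0n eqn0Ngt e0.
have [|||s s0 hs] := @fps_root K (fshift (k * e) u) e c.
- by rewrite pnatr_eq0 -lt0n.
- exact: c0.
- by rewrite ce /= add0n.
have E : (fpsX K ^+ k * s) ^+ e = u by rewrite exprMn hs -exprM -(fshiftK hu).
have Ek : fcoef (fpsX K ^+ k * s) k = c by rewrite fcoefXnM ltnn subnn.
exists (fpsX K ^+ k * s); split=> //; split; last by rewrite Ek.
by apply: vgeMl; apply: vge_fpsX.
Qed.

Lemma ordeq_root (K : numClosedFieldType) (u : fps K) (k e : nat) : (0 < e)%N ->
  ordeq u (k * e) -> exists2 s, ordeq s k & s ^+ e = u.
Proof.
move=> e0 hu.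
have [|s [hs E _]] := ordeq_root_lead e0 hu (c := e.-root (fcoef u (k * e))).
  exact: rootCK.
by exists s.
Qed.

Lemma prim_root_ex (K : numClosedFieldType) n : (0 < n)%N ->
  exists z : K, n.-primitive_root z.
Proof.
pose p : {poly K} := 'X^n - 1; have [r Dp] := closed_field_poly_normal p.
move=> n_gt0; rewrite (monicP _) ?monicXnsubC // scale1r in Dp.
have rn1 : all n.-unity_root r by apply/allP=> z; rewrite -root_prod_XsubC -Dp.
have sz_r : (n < (size r).+1)%N.
  by rewrite -(size_prod_XsubC r id) -Dp size_XnsubC.
have [|z] := hasP (has_prim_root n_gt0 rn1 _ sz_r); last by exists z.
by rewrite -separable_prod_XsubC -Dp separable_Xn_sub_1 // pnatr_eq0 -lt0n.
Qed.

(** * Puiseux factorization *)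

Local Arguments fcoef : simpl never.

Local Arguments fcoef : simpl never.

Section Factor.
Variable K : fieldType.

(** Synthetic division carried to infinity: [G j], the value at v of F with its first j terms
    dropped, satisfies G j = F_j + v G (j+1). Hence the [G j.+1] are the coefficients of the
    quotient, and the remainder is G 0 = F(v). *)
Lemma feval_factor (F : bps K) (v : fps K) : fcoef v 0 = 0 ->
  feval idfun v F = 0 -> exists Q, F = (fpsX _ - fpsC v) * Q.
Proof.
move=> v0 Fv; pose G j := feval idfun v (fshift j F).
have GE j : G j = fcoef F j + v * G j.+1.
  rewrite /G [X in feval _ _ X = _](_ : _ = fpsC (fcoef F j) + fpsX _ * fshift j.+1 F).
    by rewrite rmorphD rmorphM /= fevalC fevalX ftailE.
  apply: fpsP => n; rewrite fcoefD fcoefXM fcoefC /=.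
  by case: n => [|n] /=; rewrite !fcoef_shift ?addr0 ?add0r ?addSnnS.
exists (FPS (fun j => G j.+1)); apply: fpsP => n.
rewrite mulrBl fcoefB fcoefXM fcoefCM !fcoefF.
case: n => [|n] /=; last by rewrite fcoefF GE addrK.
have := GE 0%N; rewrite {1}/G (_ : fshift 0 F = F); last first.
  by apply: fpsP => n; rewrite fcoef_shift addn0.
by rewrite Fv => h; apply/eqP; rewrite sub0r -addr_eq0 -h.
Qed.

Lemma feval_factors (F : bps K) (v : nat -> fps K) n :
  (forall i, (i < n)%N -> fcoef (v i) 0 = 0) ->
  (forall i j, (i < j < n)%N -> v j <> v i) ->
  (forall i, (i < n)%N -> feval idfun (v i) F = 0) ->
  exists Q, F = \prod_(i < n) (fpsX _ - fpsC (v i)) * Q.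
Proof.
elim: n => [|n IH] v0 vd Fv; first by exists F; rewrite big_ord0 mul1r.
have [|||Q FE] := IH.
- by move=> i h; apply: v0; apply: ltnW.
- by move=> i j h; apply: vd; lia.
- by move=> i h; apply: Fv; apply: ltnW.
have [|Q' QE] := @feval_factor Q (v n) (v0 _ (leqnn _)).
  have := Fv n (leqnn _); rewrite FE rmorphM rmorph_prod.
  move=> /fps_mulf_eq0[|//] h; exfalso; move: h.
  apply: fps_prod_neq0 => i _; rewrite rmorphB /= fevalX fevalC ftailE ?v0 //=.
  move=> h; apply: (vd i n); first by rewrite ltn_ord leqnn.
  by apply/eqP; rewrite -subr_eq0 h.
by exists Q'; rewrite big_ord_recr /= FE QE mulrA.
Qed.

(** Retraction of K[[t]] onto K[[t^b]] = K[[x0]]. Its linearity over K[[x0]] lets divisibility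
    proved after the substitution x0 = t^b descend to K[[x0]][[x1]]. *)
Definition undil (b : nat) (u : fps K) : fps K := FPS (fun n => fcoef u (b * n)).

Lemma undilM b c q : (0 < b)%N ->
  undil b (fcomp (fpsX K ^+ b) c * q) = c * undil b q.
Proof.
move=> b0; apply/eqP; rewrite -subr_eq0; apply/eqP; apply: vge_eq0 => N.
have uD u v : undil b (u + v) = undil b u + undil b v by apply: fpsP.
have vu u : vge (b * N) u -> vge N (undil b u).
  by move=> h k kN; rewrite fcoefF h // ltn_pmul2l.
have := @vge_ftrunc _ N c; rewrite -{3 4}(subrK (ftrunc N c) c).
move: (c - ftrunc N c) => d ht; rewrite rmorphD !mulrDl uD opprD addrACA.
apply: vgeD.
  by apply: vgeB; [apply/vu/vgeMl; apply: (vge_dil _ _ b0).1 | apply: vgeMl].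
set X := undil b _; suff -> : X = ftrunc N c * undil b q by rewrite subrr.
rewrite /X ftruncE rmorph_sum !mulr_suml (big_morph (undil b) uD (_ : undil b 0 = 0)); last by apply: fpsP.
apply: eq_bigr => k _; rewrite rmorphM rmorphXn /= fcompC fcompX ftailE; last first.
  by rewrite fcoefXn ltn_eqF.
apply: fpsP => n.
transitivity (fcoef (fpsC (fcoef c k) * ((fpsX K ^+ b) ^+ k * q)) (b * n)).
  by rewrite mulrA.
rewrite -exprM -mulrA !fcoefCM !fcoefXnM (ltn_pmul2l b0) -mulnBr.
by [].
Qed.

End Factor.

Definition pconj (K : fieldType) (w : K) (y : fps K) (i : nat) : fps K :=
  fcomp (fpsC (w ^+ i) * fpsX K) y.

Section PuiseuxFactor.
Variables (K : numClosedFieldType) (b : nat) (w : K) (f : bps K) (y : fps K).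
Hypothesis b0 : (0 < b)%N.
Hypothesis wP : b.-primitive_root w.
Hypothesis y0 : fcoef y 0 = 0.
Hypothesis fy : bsub (fpsX K ^+ b) y f = 0.
Hypothesis y_conj : forall k, (0 < k < b)%N ->
  y <> fcomp (fpsC (w ^+ k) * fpsX K) y.
Hypothesis f_reg : forall j, (j <= b)%N -> bcoef f 0 j = (j == b)%:R.

Notation conj := (pconj w y).

Let rot0 (c : K) : fcoef (fpsC c * fpsX K) 0 = 0.
Proof. by rewrite fcoefCM fcoefX mulr0. Qed.

Let Xb0 : fcoef (fpsX K ^+ b) 0 = 0.
Proof. by rewrite fcoefXn ltn_eqF. Qed.

Lemma fcomp_rot (i j : nat) :
  fcomp (fpsC (w ^+ i) * fpsX K) (conj j) = conj (i + j).
Proof.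
rewrite /pconj fcomp_fcomp; last exact: rot0.
rewrite rmorphM /= fcompC fcompX ftailE; last exact: rot0.
by rewrite mulrA -rmorphM /= -exprD addnC.
Qed.

Lemma conj_neq i j : (i < j < b)%N -> conj j <> conj i.
Proof.
move=> ijb e; apply: (@y_conj (j - i)); first lia.
have : conj (b - i + j) = conj (b - i + i).
  exact: etrans (esym (fcomp_rot _ _)) (etrans (congr1 _ e) (fcomp_rot _ _)).
have -> : (b - i + i = b)%N by lia.
have -> : (b - i + j = b + (j - i))%N by lia.
rewrite /pconj exprD (prim_expr_order wP) mul1r => ->.
by rewrite rmorph1 mul1r fcomp_X.
Qed.

Lemma bsub_conj h i : bsub (fpsX K ^+ b) (conj i) h =
  fcomp (fpsC (w ^+ i) * fpsX K) (bsub (fpsX K ^+ b) y h).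
Proof.
rewrite [RHS](fcomp_bsub _ _ Xb0 y0) rmorphXn /= fcompX ftailE; last exact: rot0.
rewrite exprMn fpsC_exp exprAC (prim_expr_order wP) expr1n.
by rewrite (_ : fpsC 1 = 1) ?mul1r.
Qed.

(** The conjugates of y are b distinct roots of f(t^b, x1), so their product divides it; the
    cofactor is a unit because f(0, x1) and the product both begin with x1^b. *)
Lemma puiseux_factor : exists U V : bps K, U * V = 1 /\
  map_fps (fcomp (fpsX K ^+ b)) f = \prod_(i < b) (fpsX _ - fpsC (conj i)) * U.
Proof.
have [|||U FE] := @feval_factors _ (map_fps (fcomp (fpsX K ^+ b)) f) conj b.
- by move=> i _; rewrite fcomp0.
- by move=> i j; apply: conj_neq.
- move=> i _; rewrite feval_id_map -/(bsub _ _ _).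
  by rewrite bsub_conj fy rmorph0.
suff U00 : fcoef (fcoef U 0) 0 = 1.
  have [r hr] : exists r, fcoef U 0 * r = 1.
    by apply: (@fps_inv _ _ 1); rewrite U00 mulr1.
  by have [V UV] := fps_inv hr; exists U, V.
have : fcoef (map_fps (@fconst K) (map_fps (fcomp (fpsX K ^+ b)) f)) b = 1.
  rewrite !fcoef_map /= /fconst fcomp0.
  by have := f_reg (leqnn b); rewrite /bcoef eqxx.
rewrite FE rmorphM rmorph_prod /= (eq_bigr (fun=> fpsX K)) => [|i _]; last first.
  rewrite rmorphB /= map_fpsX map_fpsC /= (_ : fconst _ = 0); last first.
    by rewrite /fconst fcomp0.
  by rewrite rmorph0 subr0.
by rewrite prodr_const card_ord fcoefXnM ltnn subnn.
Qed.

Lemma bsub_pow s v : fcoef s 0 = 0 -> fcoef v 0 = 0 ->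
  exists2 eps, fcoef eps 0 != 0 &
    bsub (s ^+ b) v f = \prod_(i < b) (v - fcomp (fpsC (w ^+ i) * s) y) * eps.
Proof.
move=> s0 v0; have [U [V [UV FE]]] := puiseux_factor.
exists (bsub s v U).
  have : fcoef (bsub s v (U * V)) 0 = 1 by rewrite UV rmorph1.
  rewrite rmorphM fcoef0M => h; apply/eqP => h0; move: h.
  by rewrite h0 mul0r => /esym/eqP; rewrite oner_eq0.
have E : fcomp s (fpsX K ^+ b) = s ^+ b by rewrite rmorphXn /= fcompX (ftailE s0).
have := bsub_map s v f Xb0; rewrite E => <-; rewrite FE rmorphM rmorph_prod; congr (_ * _).
apply: eq_bigr => i _; rewrite rmorphB /= bsubX bsubC /= (ftailE v0) /pconj.
rewrite fcomp_fcomp; last exact: rot0.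
by rewrite rmorphM /= fcompC fcompX (ftailE s0).
Qed.

(** A series vanishing at y vanishes at all conjugates, so h(t^b, x1) is a multiple of f(t^b, x1);
    [undil] brings the quotient back to K[[x0]][[x1]]. *)
Lemma bsub_ker h : bsub (fpsX K ^+ b) y h = 0 -> ring_dvd f h.
Proof.
move=> hy; have [U [V [UV FE]]] := puiseux_factor.
have [|||Q HE] := @feval_factors _ (map_fps (fcomp (fpsX K ^+ b)) h) conj b.
- by move=> i _; rewrite fcomp0.
- by move=> i j; apply: conj_neq.
- by move=> i _; rewrite feval_id_map -/(bsub _ _ _) bsub_conj hy rmorph0.
have {}HE : map_fps (fcomp (fpsX K ^+ b)) h =
    map_fps (fcomp (fpsX K ^+ b)) f * (V * Q).
  by rewrite FE -mulrA (mulrA U) UV mul1r.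
exists (map_fps (undil b) (V * Q)); apply: fpsP => n.
have hE : fcoef h n = undil b (fcoef (map_fps (fcomp (fpsX K ^+ b)) h) n).
  rewrite fcoef_map /= -[fcomp _ _]mulr1 undilM //.
  rewrite (_ : undil b 1 = 1) ?mulr1 //; apply: fpsP => k.
  by rewrite fcoefF !fcoef1 muln_eq0 eqn0Ngt b0.
rewrite hE HE !fcoefM.
have uD (u v : fps K) : undil b (u + v) = undil b u + undil b v by apply: fpsP.
rewrite (big_morph (undil b) uD (_ : undil b 0 = 0)); last by apply: fpsP.
by apply: eq_bigr => i _; rewrite fcoef_map /= undilM.
Qed.

End PuiseuxFactor.

Lemma prod_cycle (R : comNzRingType) (b : nat) (F : nat -> R) i0 :
  (forall i, F (i + b)%N = F i) -> \prod_(i < b) F i = \prod_(k < b) F (i0 + k)%N.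
Proof.
move=> Fb; elim: i0 => [//|i0 ->]; case: b Fb => [|b] Fb; first by rewrite !big_ord0.
rewrite big_ord_recl big_ord_recr /= mulrC addn0; congr (_ * _); last first.
  by rewrite -(Fb i0) addSnnS.
by apply: eq_bigr => i _; rewrite addSnnS.
Qed.

(** * Order of a product over conjugates in terms of the largest contact *)

Section Contact.
Variables (K : numClosedFieldType) (b : nat) (w : K) (y : fps K) (delta : nat -> nat).
Hypothesis b0 : (0 < b)%N.
Hypothesis wP : b.-primitive_root w.
Hypothesis deltaP : forall k, (0 < k < b)%N -> ordeq (y - pconj w y k) (delta k).

(** Order of the product when the largest order of a factor is T: a factor k places away differs
    from the largest one by a series of order [kappa * delta k], so it has order min(T, kappa
    delta_k). *)
Definition contact_sum (kappa T : nat) : nat :=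
  (T + \sum_(1 <= k < b) minn T (kappa * delta k))%N.

Variables (s X : fps K) (kappa : nat).
Hypothesis kappa0 : (0 < kappa)%N.
Hypothesis sP : ordeq s kappa.


Let D i := X - fcomp (fpsC (w ^+ i) * s) y.

Let Db i : D (i + b)%N = D i.
Proof. by rewrite /D exprD (prim_expr_order wP) mulr1. Qed.

Let rot_s i : ordeq (fpsC (w ^+ i) * s) kappa.
Proof.
rewrite -[kappa]add0n; apply: ordeqM => //; split=> //.
rewrite fcoefC expf_neq0 //; apply/eqP => w00; have := prim_expr_order wP.
by rewrite w00 expr0n eqn0Ngt b0 => /esym/eqP; rewrite oner_eq0.
Qed.

Let rot_s0 i : fcoef (fpsC (w ^+ i) * s) 0 = 0.
Proof. by case: (rot_s i) => h _; apply: h. Qed.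

Let D_diff i k : (0 < k < b)%N -> ordeq (D (i + k)%N - D i) (kappa * delta k).
Proof.
move=> /deltaP hk; suff -> : D (i + k)%N - D i = fcomp (fpsC (w ^+ i) * s) (y - pconj w y k).
  exact: ordeq_fcomp (rot_s i) hk.
rewrite rmorphB /= /pconj fcomp_fcomp; last by rewrite fcoefCM fcoefX mulr0.
rewrite rmorphM /= fcompC fcompX (ftailE (rot_s0 i)) /D opprB addrC subrKA.
by rewrite mulrA -rmorphM /= -exprD addnC.
Qed.

Lemma contact_ge i T : vge T (D i) ->
  vge (contact_sum kappa T) (\prod_(i < b) (X - fcomp (fpsC (w ^+ i) * s) y)).
Proof.
move=> hT; rewrite -/(D _) (prod_cycle i Db) /contact_sum.
case: b b0 deltaP D_diff => // b' _ _ Dd; rewrite big_ord_recl /= addn0; apply: vgeM => //.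
rewrite big_add1 big_mkord; apply: vge_prod => k _.
rewrite -(subrK (D i) (D _)); apply: vgeD; last by apply: vgeW hT; apply: geq_minl.
have [|h _] := Dd i (bump 0 k); first by rewrite /bump leq0n add1n ltnS; have := ltn_ord k; lia.
by apply: vgeW h; rewrite /bump leq0n add1n geq_minr.
Qed.

Lemma contact_lt T : (forall i, (i < b)%N -> ~ vge T.+1 (D i)) ->
  ~ vge (contact_sum kappa T).+1 (\prod_(i < b) (X - fcomp (fpsC (w ^+ i) * s) y)).
Proof.
move=> hT; have Dx i : exists2 c, (c <= T)%N & ordeq (D i) c.
  have h : ~ vge T.+1 (D i).
    have -> : D i = D (i %% b)%N.
      rewrite [in LHS](divn_eq i b) addnC; elim: (i %/ b)%N => [|q IH]; first by rewrite addn0.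
      by rewrite mulSn addnCA addnC Db.
    by apply: hT; rewrite ltn_mod.
  have [|c hc] := @ordeq_ex _ (D i); first by move=> D0; apply: h; rewrite D0.
  exists c => //; rewrite leqNgt; apply/negP => Tc; apply: h.
  by case: hc => hc _; apply: vgeW hc.
have [c cT cP] : exists2 c : nat -> nat, (forall i, (c i <= T)%N) & forall i, ordeq (D i) (c i).
  by exists (fun i => s2val (cid2 (Dx i))) => i; case: (cid2 (Dx i)).
pose i0 : 'I_b := [arg max_(i > Ordinal b0) c i].
have ci0 i : (c i <= c i0)%N.
  have -> : c i = c (i %% b)%N.
    apply: (ordeq_uniq (cP i)); rewrite [in X in ordeq X _](divn_eq i b) addnC.
    elim: (i %/ b)%N => [|q IH]; first by rewrite addn0; apply: cP.
    by rewrite mulSn addnCA addnC Db.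
  have ib : (i %% b < b)%N by rewrite ltn_mod.
  by rewrite /i0; case: arg_maxnP => // j _ /(_ (Ordinal ib)); apply.
(* Otherwise both factors, hence their difference, would have order above [kappa * delta k], since
   the one at [i0] is at least as large. *)
have ck k : (0 < k < b)%N -> (c (i0 + k)%N <= kappa * delta k)%N.
  move=> kb; rewrite leqNgt; apply/negP => lt.
  have h : vge (kappa * delta k).+1 (D (i0 + k)%N - D i0).
    apply: vgeB; [case: (cP (i0 + k)%N) | case: (cP i0)] => + _; apply: vgeW => //.
    exact: leq_trans lt (ci0 _).
  by have := ordeq_le (D_diff i0 kb) h; rewrite ltnn.
move=> hv; suff : ((contact_sum kappa T).+1 <= \sum_(k < b) c (i0 + k)%N)%N.
  apply/negP; rewrite -leqNgt -(big_mkord xpredT (fun k => c (i0 + k)%N)) /contact_sum.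
  rewrite big_ltn // addn0; apply: leq_add => //.
  rewrite !big_nat; apply: leq_sum => k kb.
  by rewrite leq_min cT ck.
move: hv; rewrite -/(D _) (prod_cycle i0 Db); apply: ordeq_le.
by apply: ordeq_prod => k _.
Qed.

End Contact.

Local Arguments gcd_seq : simpl never.

(** * Arithmetic of the characteristic exponents and of the semigroup generators *)

Section Characteristic.
Variables (beta : nat -> nat) (g : nat).
Local Notation e := (gcd_seq beta).
Local Notation n := (ratio_n beta).
Local Notation b := (beta 0).
Hypothesis b0 : (0 < b)%N.
Hypothesis e_last : e g = 1%N.
Hypothesis beta_ndvd : forall i, (1 <= i <= g)%N -> ~~ (e i.-1 %| beta i)%N.
Hypothesis beta_inc : forall i, (1 <= i < g)%N -> (beta i < beta i.+1)%N.

Lemma gcd_seqS i : e i.+1 = gcdn (e i) (beta i.+1). Proof. by []. Qed.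

Lemma gcd_seq_gt0 i : (0 < e i)%N.
Proof. by elim: i => //= i IH; rewrite gcdn_gt0 IH. Qed.

Lemma gcd_seq_dvd i j : (i <= j)%N -> (e j %| e i)%N.
Proof.
elim: j => [|j IH]; first by rewrite leqn0 => /eqP ->.
rewrite leq_eqVlt => /orP[/eqP -> //|/IH]; apply: dvdn_trans; exact: dvdn_gcdl.
Qed.

Lemma gcd_seq_dvd0 j : (e j %| b)%N. Proof. exact: (gcd_seq_dvd (leq0n j)). Qed.

Lemma gcd_seq_dvd_beta i j : (i <= j)%N -> (e j %| beta i)%N.
Proof.
move=> /gcd_seq_dvd ej; apply: dvdn_trans ej _.
by case: i => [//|i]; apply: dvdn_gcdr.
Qed.

Lemma ratio_nE i : (n i.+1 * e i.+1)%N = e i.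
Proof. by rewrite /ratio_n /= divnK // dvdn_gcdl. Qed.

Lemma ratio_n_gt1 i : (1 <= i <= g)%N -> (1 < n i)%N.
Proof.
case: i => // i ig; rewrite ltnNge; apply/negP => n1.
have := beta_ndvd ig => /negP[] /=.
have := ratio_nE i; have := gcd_seq_gt0 i.
case: (n i.+1) n1 => [|[|//]] _; first by rewrite mul0n => + h; rewrite -h.
by rewrite mul1n => _ <-; apply: dvdn_gcdr.
Qed.

(** Equal to n_1 ... n_j: the number of distinct conjugates of y truncated before beta_(j+1). *)
Definition coindex (j : nat) : nat := b %/ e j.

Lemma coindexE j : (coindex j * e j)%N = b.
Proof. by rewrite divnK // gcd_seq_dvd0. Qed.

Lemma coindex_gt0 j : (0 < coindex j)%N.
Proof. by rewrite divn_gt0 ?gcd_seq_gt0 // dvdn_leq // gcd_seq_dvd0. Qed.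

Lemma coindexS j : coindex j.+1 = (n j.+1 * coindex j)%N.
Proof.
apply/eqP; rewrite -(eqn_pmul2r (gcd_seq_gt0 j.+1)) coindexE.
by rewrite mulnAC ratio_nE mulnC coindexE.
Qed.

Lemma coindex_prod j : coindex j = (\prod_(1 <= l < j.+1) n l)%N.
Proof.
elim: j => [|j IH]; first by rewrite big_geq // /coindex /= divnn b0.
by rewrite big_nat_recr //= -IH coindexS mulnC.
Qed.

Lemma coindex_dvd i j : (i <= j)%N -> (coindex i %| coindex j)%N.
Proof.
elim: j => [|j IH]; first by rewrite leqn0 => /eqP ->.
rewrite leq_eqVlt => /orP[/eqP -> //|/IH h]; rewrite coindexS; exact: dvdn_mull.
Qed.

Lemma coindex_last : coindex g = b. Proof. by rewrite /coindex e_last divn1. Qed.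

Lemma coindex_last_prod j : (j <= g)%N ->
  (\prod_(j.+1 <= l < g.+1) n l)%N = e j.
Proof.
move=> jg; apply/eqP; rewrite -(eqn_pmul2l (coindex_gt0 j)) coindexE.
rewrite coindex_prod -(@big_cat_nat _ _ _ j.+1) //=.
by rewrite -coindex_prod coindex_last.
Qed.

(** After division by e_j this is the coprimality of n_j and beta_j / e_j. *)
Lemma dvd_beta k j : (1 <= j <= g)%N -> (coindex j.-1 %| k)%N ->
  (b %| k * beta j)%N = (coindex j %| k)%N.
Proof.
case: j => //= j jg /dvdnP[q ->].
rewrite coindexS dvdn_pmul2r ?coindex_gt0 //.
rewrite -{1}(coindexE j) [(coindex j * e j)%N]mulnC mulnAC dvdn_pmul2r ?coindex_gt0 //.
rewrite -(ratio_nE j).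
have /dvdnP[c hc] : (e j.+1 %| beta j.+1)%N by apply: gcd_seq_dvd_beta.
rewrite hc mulnA dvdn_pmul2r ?gcd_seq_gt0 // Gauss_dvdl //.
rewrite /coprime -(eqn_pmul2r (gcd_seq_gt0 j.+1)) muln_gcdl ratio_nE -hc mul1n.
by rewrite gcd_seqS.
Qed.

(* k is divisible by n_1 ... n_(j-1) but not by n_1 ... n_j for j = level k. *)
Definition level (k : nat) : nat :=
  (find (fun l => ~~ (coindex l.+1 %| k)%N) (iota 0 g)).+1.

Lemma levelP k : (0 < k < b)%N -> [/\ (1 <= level k <= g)%N,
  (coindex (level k).-1 %| k)%N & ~~ (coindex (level k) %| k)%N].
Proof.
move=> kb; pose P l := ~~ (coindex l.+1 %| k)%N.
have hP : has P (iota 0 g).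
  case: (posnP g) => g0; first by move: kb; rewrite -coindex_last g0 /coindex divnn b0; lia.
  apply/hasP; exists g.-1; first by rewrite mem_iota /= add0n prednK.
  by rewrite /P prednK // coindex_last; apply/negP => /dvdn_leq; lia.
have hg := hP; rewrite has_find size_iota in hg.
have := nth_find 0%N hP; rewrite nth_iota // add0n => hn.
split=> //; rewrite /level -/P /=.
case E : (find P (iota 0 g)) => [|l]; first by rewrite /coindex divnn b0 dvd1n.
have := @before_find _ 0%N P (iota 0 g) l; rewrite E ltnS leqnn nth_iota ?add0n; last lia.
by move=> /(_ isT) /negbFE.
Qed.

(** There are e_j - 1 multiples of n_1 ... n_j strictly between 0 and b, so exactly e_(l-1) - e_l of
    the indices k have level l. *)
Lemma sum_level (G : nat -> nat) :
  (\sum_(1 <= k < b) G (level k) = \sum_(1 <= l < g.+1) (e l.-1 - e l) * G l)%N.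
Proof.
have count j : (\sum_(1 <= k < b | coindex j %| k) 1 = e j - 1)%N.
  have bE : b = b.-1.+1 by rewrite prednK.
  rewrite big_mkcond /= {1}bE -(divn_count_dvd (coindex j)).
  apply/eqP; rewrite -(eqn_add2r 1) subnK ?gcd_seq_gt0 //.
  have := coindexE j; have := coindex_gt0 j; have := gcd_seq_gt0 j.
  case: (e j) => // ej _; case: (coindex j) => // m _ <-.
  by rewrite mulnS addSn /= [(m.+1 * ej)%N]mulnC [(m + _)%N]addnC divnMDl // divn_small // addn0 addn1.
have step i : (i <= g)%N -> (\sum_(1 <= k < b) G (level k) =
    \sum_(1 <= l < i.+1) (e l.-1 - e l) * G l +
    \sum_(1 <= k < b | coindex i %| k) G (level k))%N.
  elim: i => [|i IH] ig.
    rewrite [X in (X + _)%N]big_geq // add0n; apply: eq_bigl => k.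
    by rewrite /coindex divnn b0 dvd1n.
  rewrite IH 1?ltnW // [in RHS]big_nat_recr //= -addnA; congr (_ + _)%N.
  rewrite (bigID (fun k => coindex i.+1 %| k)%N) /= addnC; congr (_ + _)%N; last first.
    apply: eq_bigl => k; apply: andb_idl => h.
    by apply: dvdn_trans h; apply: coindex_dvd.
  have lv k : (1 <= k < b)%N && ((coindex i %| k)%N && ~~ (coindex i.+1 %| k)%N) -> level k = i.+1.
    move=> /and3P[kb h1 h2]; have [_ h3 h4] := levelP kb.
    have [lt|lt|//] := ltngtP (level k) i.+1.
      by case/negP: h4; apply: dvdn_trans h1; apply: coindex_dvd.
    case/negP: h2; apply: dvdn_trans h3; apply: coindex_dvd; lia.
  rewrite big_nat_cond (eq_bigr (fun=> G i.+1 * 1)%N) => [|k /lv ->]; last by rewrite muln1.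
  rewrite -big_nat_cond -big_distrr /= mulnC; congr (_ * _)%N.
  have := count i; rewrite (bigID (fun k => coindex i.+1 %| k)%N) /=.
  rewrite (eq_bigl (fun k => coindex i.+1 %| k)%N) ?count => [|k]; last first.
    by apply: andb_idl => h; apply: dvdn_trans h; apply: coindex_dvd.
  by rewrite -?gcd_seqS; have := gcd_seq_gt0 i.+1; lia.
rewrite (step g (leqnn g)) coindex_last [X in (_ + X)%N](_ : _ = 0%N) ?addn0 //.
rewrite big_nat_cond big1 // => k /andP[/andP[k1 kb]] /(dvdn_leq k1).
by rewrite leqNgt kb.
Qed.

Lemma sum_gap j k : (j <= k)%N -> (\sum_(j.+1 <= l < k.+1) (e l.-1 - e l) = e j - e k)%N.
Proof.
elim: k => [|k IH]; first by rewrite leqn0 => /eqP ->; rewrite big_geq // subnn.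
rewrite leq_eqVlt => /orP[/eqP ->|jk]; first by rewrite big_geq // subnn.
rewrite big_nat_recr ?IH //=.
have h1 := dvdn_leq (gcd_seq_gt0 k) (gcd_seq_dvd (leqnSn k)).
have := dvdn_leq (gcd_seq_gt0 j) (gcd_seq_dvd (jk : j <= k)%N).
by rewrite -?gcd_seqS; lia.
Qed.

Lemma beta_mono i k : (1 <= i)%N -> (i <= k <= g)%N -> (beta i <= beta k)%N.
Proof.
move=> i1; elim: k => [|k IH]; first by lia.
rewrite leq_eqVlt => /andP[/orP[/eqP -> //|ik] kg].
by apply: leq_trans (IH _) (ltnW (beta_inc _)); lia.
Qed.

Lemma big_gap_beta j : (1 <= j <= g)%N ->
  (\sum_(1 <= l < g.+1) (e l.-1 - e l) * minn (beta j) (beta l) =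
   \sum_(1 <= l < j) (e l.-1 - e l) * beta l + (e j.-1 - 1) * beta j)%N.
Proof.
move=> jg; have mono := beta_mono.
rewrite (@big_cat_nat _ _ _ j) /=; [|lia|lia]; congr (_ + _)%N.
  by rewrite !big_nat; apply: eq_bigr => l lj; rewrite (minn_idPr _) ?mono //; lia.
rewrite big_nat (eq_bigr (fun l => (e l.-1 - e l) * beta j)%N); last first.
  by move=> l lj; rewrite (minn_idPl _) ?mono //; lia.
rewrite -big_nat -big_distrl /=; congr (_ * _)%N.
by case: j jg => // j jg; rewrite sum_gap ?e_last //; lia.
Qed.

(* The minimal generators of the semigroup, computed from the exponents. *)
Fixpoint semigen (j : nat) : nat :=
  match j with
  | 0 => b
  | 1 => beta 1
  | j'.+1 => n j' * semigen j' + (beta j - beta j')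
  end%N.

Local Arguments semigen : simpl never.

Lemma semigenS j : (1 <= j)%N ->
  semigen j.+1 = (n j * semigen j + (beta j.+1 - beta j))%N.
Proof. by case: j. Qed.

(** The recursion unrolled, in the shape in which a sum of contacts produces it. *)
Lemma semigen_sum j : (1 <= j <= g)%N -> (e j.-1 * semigen j =
  \sum_(1 <= l < j) (e l.-1 - e l) * beta l + e j.-1 * beta j)%N.
Proof.
elim: j => // -[|j] IH jg; first by rewrite big_nil.
rewrite semigenS // mulnDr [j.+2.-1]/= mulnA [(e j.+1 * n _)%N]mulnC ratio_nE IH; last lia.
rewrite [in RHS]big_nat_recr //= mulnBr.
have h1 := dvdn_leq (gcd_seq_gt0 j) (gcd_seq_dvd (leqnSn j)).
have h2 : (beta j.+1 < beta j.+2)%N by apply: beta_inc; lia.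
have h3 : (e j.+1 * beta j.+1 <= e j.+1 * beta j.+2)%N by rewrite leq_mul2l ltnW ?orbT.
have h4 : (e j.+1 * beta j.+1 <= e j * beta j.+1)%N by rewrite leq_mul2r h1 orbT.
by rewrite mulnBl; lia.
Qed.

(** The congruence with beta_j modulo e_(j-1) transfers the gcd and divisibility properties of the
    exponents to the generators. *)
Lemma semigen_mod j : (1 <= j <= g)%N -> exists c, semigen j = (beta j + e j.-1 * c)%N.
Proof.
elim: j => // -[|j] IH jg; first by exists 0%N; rewrite muln0 addn0.
have [|c hc] := IH; first lia.
have /dvdnP[x hx] := gcd_seq_dvd_beta (leqnn j.+1).
have h2 : (beta j.+1 < beta j.+2)%N by apply: beta_inc; lia.
have n2 : (1 < n j.+1)%N by apply: ratio_n_gt1; lia.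
exists ((n j.+1 - 1) * x + n j.+1 * n j.+1 * c)%N.
rewrite semigenS // [j.+2.-1]/= hc [j.+1.-1]/= -(ratio_nE j).
rewrite (_ : e j.+1 * _ = (n j.+1 - 1) * beta j.+1 + n j.+1 * (n j.+1 * e j.+1 * c))%N; last first.
  by rewrite hx; ring.
rewrite mulnBl mulnDr mul1n.
have : (beta j.+1 <= n j.+1 * beta j.+1)%N by apply: leq_pmull; lia.
by lia.
Qed.

Lemma gcd_semigen j : (1 <= j <= g)%N -> gcdn (e j.-1) (semigen j) = e j.
Proof.
move=> jg; have [c ->] := semigen_mod jg; case: j jg => // j _ /=.
by rewrite addnC mulnC gcdnMDl.
Qed.

Lemma semigen_dvd i j : (i <= j <= g)%N -> (e j %| semigen i)%N.
Proof.
move=> ij; case: i ij => [|i] ij; first exact: gcd_seq_dvd0.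
apply: dvdn_trans (gcd_seq_dvd (_ : i.+1 <= j)%N) _; first lia.
by rewrite -(@gcd_semigen i.+1) ?dvdn_gcdr //; lia.
Qed.

Lemma semigen_ndvd k j : (1 <= j <= g)%N ->
  (e j.-1 %| k * semigen j)%N -> (n j %| k)%N.
Proof.
move=> jg; have := gcd_semigen jg; case: j jg => // j _ /= h.
have /dvdnP[x hx] : (e j.+1 %| semigen j.+1)%N by rewrite -h dvdn_gcdr.
rewrite hx -{1}(ratio_nE j) mulnA dvdn_pmul2r ?gcd_seq_gt0 //.
rewrite Gauss_dvdl // /coprime -(eqn_pmul2r (gcd_seq_gt0 j.+1)) muln_gcdl ratio_nE -hx mul1n.
by rewrite h.
Qed.

End Characteristic.

Local Arguments semigen : simpl never.

(** The form in which the branch is used from here on: [pb_supp] and [pb_lead] describe the support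
    of y, [pb_reg] is regularity of order b in x1, and [pb_weight] bounds the Newton polygon. *)
Record puiseux_branch (K : numClosedFieldType) (f : bps K) (a : nat -> K) (g : nat)
    (beta : nat -> nat) (w : K) : Prop := PuiseuxBranch {
  pb_b : (1 < beta 0)%N;
  pb_prim : (beta 0).-primitive_root w;
  pb_g : (2 <= g)%N;
  pb_last : gcd_seq beta g = 1%N;
  pb_ndvd : forall i, (1 <= i <= g)%N -> ~~ (gcd_seq beta i.-1 %| beta i)%N;
  pb_inc : forall i, (1 <= i < g)%N -> (beta i < beta i.+1)%N;
  pb_supp : forall i l, (i < g)%N -> (l < beta i.+1)%N -> a l != 0 ->
    (gcd_seq beta i %| l)%N;
  pb_lead : forall i, (i < g)%N -> a (beta i.+1) != 0;
  pb_low : forall l, (l < beta 1)%N -> a l = 0;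
  pb_b1 : (beta 0 < beta 1)%N;
  pb_root : bsub (fpsX K ^+ beta 0) (FPS a) f = 0;
  pb_reg : forall j, (j <= beta 0)%N -> bcoef f 0 j = (j == beta 0)%:R;
  pb_weight : forall i j, (i * beta 0 + j * beta 1 < beta 0 * beta 1)%N ->
    bcoef f i j = 0 }.

(** * Weighted orders and the consequences of adapted coordinates *)

Section Weights.
Variables (K : fieldType) (b c : nat).
Implicit Types p q : bps K.

Definition weight_ge (N : nat) p :=
  forall i j, (i * b + j * c < N)%N -> bcoef p i j = 0.

Lemma weight_geM N M p q : weight_ge N p -> weight_ge M q -> weight_ge (N + M) (p * q).
Proof.
move=> hp hq i j ij; rewrite /bcoef fcoefM fcoef_sum big1 // => l _.
rewrite fcoefM big1 // => k _.
have [lt|ge] := ltnP (k * b + l * c) N; first by rewrite [X in X * _](hp _ _ lt) mul0r.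
rewrite [X in _ * X](hq (i - k) (j - l))%N ?mulr0 //.
have hk := ltn_ord k; have hl := ltn_ord l; nia.
Qed.

Lemma weight_geX N p k : weight_ge N p -> weight_ge (N * k) (p ^+ k).
Proof.
move=> hp; elim: k => [|k IH]; first by rewrite muln0.
by rewrite exprS mulnS; apply: weight_geM.
Qed.

Lemma weight_geB N p q : weight_ge N p -> weight_ge N q -> weight_ge N (p - q).
Proof.
move=> hp hq i j ij; rewrite /bcoef !fcoefB.
by rewrite [X in X - _](hp _ _ ij) [X in _ - X](hq _ _ ij) subr0.
Qed.

Lemma weight_geD N p q : weight_ge N p -> weight_ge N q -> weight_ge N (p + q).
Proof.
move=> hp hq i j ij; rewrite /bcoef !fcoefD.
by rewrite [X in X + _](hp _ _ ij) [X in _ + X](hq _ _ ij) addr0.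
Qed.

Lemma weight_ge_x1 : weight_ge c (bps_x1 K).
Proof.
move=> i j ij; rewrite /bcoef fcoefX; case: eqP => [e|_]; last by [].
by rewrite e in ij; lia.
Qed.

Lemma weight_ge_x0 : weight_ge b (bps_x0 K).
Proof.
move=> i j ij; rewrite /bcoef fcoefC; case: eqP => // _.
by rewrite fcoefX; case: eqP => [e|//]; rewrite e in ij; lia.
Qed.

End Weights.

Lemma weight_eq beta : (0 < beta 0)%N ->
  (ratio_m beta 1 * beta 0 = ratio_n beta 1 * beta 1)%N /\
  (ratio_n beta 1 * gcd_seq beta 1 = beta 0)%N.
Proof.
move=> b0; have h1 : (ratio_n beta 1 * gcd_seq beta 1 = beta 0)%N := ratio_nE beta 0.
split=> //.
have h2 : (ratio_m beta 1 * gcd_seq beta 1 = beta 1)%N.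
  by rewrite /ratio_m divnK // gcd_seqS dvdn_gcdr.
by rewrite -{1}h1 mulnCA h2.
Qed.

Section BranchData.
Variables (K : numClosedFieldType) (f : bps K) (a : nat -> K) (g : nat) (beta : nat -> nat).
Local Notation b := (beta 0).
Local Notation e := (gcd_seq beta).
Hypothesis b1 : (1 < b)%N.
Hypothesis fpar : is_parametrization f b a.
Hypothesis fexp : puiseux_exponents a g beta.
Hypothesis fcoord : adapted_coordinates f beta.
Hypothesis g2 : (2 <= g)%N.

Let fmin i : (1 <= i <= g)%N -> [/\ a (beta i) != 0, ~~ (e i.-1 %| beta i)%N &
  forall l, a l != 0 -> ~~ (e i.-1 %| l)%N -> (beta i <= l)%N].
Proof.
move=> ig; case: fexp => /(_ i ig)[[/eqP h1 h2] h3] _; split=> // l /eqP h4 h5.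
exact: h3.
Qed.

Let a0 : a 0 = 0. Proof. by case: fpar => h _; apply: h; lia. Qed.

Let b_lt_b1 : (b < beta 1)%N.
Proof.
have [|h1 h2 _] := @fmin 1; first lia.
rewrite ltnNge leq_eqVlt; apply/negP => /orP[/eqP E|lt].
  by rewrite E dvdnn in h2.
by case: fpar => h _; rewrite h ?eqxx in h1.
Qed.

Lemma adapted_weight : weight_ge b (beta 1) (b * beta 1) f.
Proof.
have [h1 h2] := weight_eq (ltnW b1).
have [c [r [_ hr ->]]] := fcoord; apply: weight_geD; last first.
  move=> i j ij; apply/eqP/negPn/negP => /eqP /hr; lia.
rewrite (_ : (b * beta 1 = ratio_n beta 1 * beta 1 * e 1)%N); last by rewrite mulnAC h2.
apply: weight_geX; apply: weight_geB.
  by rewrite mulnC; apply: weight_geX; apply: weight_ge_x1.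
rewrite -h1 mulnC -[X in weight_ge _ _ X](add0n); apply: weight_geM => //.
by apply: weight_geX; apply: weight_ge_x0.
Qed.

Lemma adapted_reg j : (j <= b)%N -> bcoef f 0 j = (j == b)%:R.
Proof.
have [h1 h2] := weight_eq (ltnW b1).
have m0 : (0 < ratio_m beta 1)%N.
  by rewrite -(ltn_pmul2r (ltnW b1)) h1 mul0n muln_gt0; nia.
have [c [r [_ hr ->]]] := fcoord => jb.
pose ev := map_fps (@fconst K); rewrite -[bcoef _ _ _]/(fcoef (ev _) j) /ev.
rewrite rmorphD rmorphXn rmorphB rmorphM !rmorphXn /= map_fpsX !map_fpsC /=.
rewrite (_ : fconst (fpsX K) = 0) // rmorph0 expr0n eqn0Ngt m0 mulr0 subr0.
rewrite -exprM h2 fcoefD fcoefXn fcoef_map /=.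
have -> : fconst (fcoef r j) = 0; last by rewrite addr0.
apply/eqP/negPn/negP => /eqP /(hr 0%N j); rewrite mul0n add0n; nia.
Qed.

Let froot : bsub (fpsX K ^+ b) (FPS a) f = 0.
Proof.
by case: fpar => _ <-; rewrite bps_substE // fcoefXn ltn_eqF // ltnW.
Qed.

(** If y began at an exponent l < beta_1, then in f(t^b, y) the coefficient of t^(l b) would be
    a_l^b alone: any other monomial reaching that order would have weight below b beta_1. *)
Lemma adapted_low l : (l < beta 1)%N -> a l = 0.
Proof.
elim/ltn_ind: l => -[|l] IH lb; first exact: a0.
apply/eqP/negPn/negP => al.
have hv : vge l.+1 (FPS a) by move=> k kl; apply: IH; lia.
have : fcoef (bps_subst f (fpsX K ^+ b) (FPS a)) (l.+1 * b) = 0.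
  by case: fpar => _ ->.
have n0 : (0 < (l.+1 * b).+1)%N by [].
have nb : (b < (l.+1 * b).+1)%N by rewrite ltnS leq_pmull.
rewrite fcoefF (bigD1 (Ordinal n0)) //= (bigD1 (Ordinal nb)) //=.
rewrite adapted_reg // eqxx mul1r expr0 mul1r fcoefX_lead //.
have key (i j : nat) : (i != 0%N) || (j != b) ->
    bcoef f i j * fcoef ((fpsX K ^+ b) ^+ i * FPS a ^+ j) (l.+1 * b) = 0.
  move=> ij; rewrite -exprM fcoefXnM; case: ltnP => [|h1]; first by rewrite mulr0.
  have [h2|h2] := ltnP (l.+1 * b - b * i) (l.+1 * j).
    by rewrite (@vgeX _ _ _ j hv _ h2) mulr0.
  rewrite adapted_weight ?mul0r //.
  have jb : (j <= b)%N by nia.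
  have [jb'|jb'] := eqVneq j b; first by subst j; rewrite eqxx orbF in ij; nia.
  nia.
rewrite big1 ?addr0 => [|j jb]; last first.
  by apply: key; rewrite /= -val_eqE in jb *.
rewrite big1 ?addr0 => [|i i0]; last first.
  by rewrite big1 // => j _; apply: key; rewrite -val_eqE /= in i0; rewrite i0.
by move=> /eqP; rewrite fcoefF expf_eq0 (negbTE al) andbF.
Qed.

Lemma puiseux_branch_ex : exists w, puiseux_branch f a g beta w.
Proof.
have [w wP] := prim_root_ex K (ltnW b1); exists w.
have nd i : (1 <= i <= g)%N -> ~~ (e i.-1 %| beta i)%N by move=> /fmin[].
have sp i l : (i < g)%N -> (l < beta i.+1)%N -> a l != 0 -> (e i %| l)%N.
  move=> ig lb al; apply/negPn/negP => h.
  have [|_ _ /(_ l al h)] := @fmin i.+1; first lia.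
  by rewrite leqNgt lb.
split=> //.
- by case: fexp.
(* The exponent beta_(i+1) is also indivisible by e_(i-1), so minimality of beta_i gives the weak
   inequality; they differ because e_i divides beta_i only. *)
- move=> i ig; have [|h1 h2 _] := @fmin i.+1; first lia.
  have [|_ _ h3] := @fmin i; first lia.
  rewrite ltn_neqAle h3 ?andbT //.
    apply: contra h2 => /eqP <-; exact: gcd_seq_dvd_beta.
  apply: contra h2; apply: dvdn_trans; apply: gcd_seq_dvd; lia.
- by move=> i ig; have [|//] := @fmin i.+1; lia.
- exact: adapted_low.
- exact: adapted_reg.
- exact: adapted_weight.
Qed.

End BranchData.

(** * Order of f along an arc *)

Section BranchOrder.
Variables (K : numClosedFieldType) (f : bps K) (a : nat -> K) (g : nat).
Variables (beta : nat -> nat) (w : K).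
Hypothesis H : puiseux_branch f a g beta w.
Local Notation b := (beta 0).
Local Notation e := (gcd_seq beta).
Local Notation y := (FPS a).

Let b0 : (0 < b)%N. Proof. exact: ltnW (pb_b H). Qed.
Let wP := pb_prim H.
Let last_ := pb_last H.
Let inc := pb_inc H.

Let y0 : fcoef y 0 = 0.
Proof. by apply: (pb_low H); have := pb_b1 H; lia. Qed.

(** The i-th coefficient of the difference is a_i (1 - w^(k i)). With l the level of k, every
    exponent i of y below beta_l is a multiple of e_(l-1) while k is one of n_1 ... n_(l-1), so b
    divides k i; at beta_l itself it does not. *)
Lemma conj_ordeq k : (0 < k < b)%N -> ordeq (y - pconj w y k) (beta (level beta g k)).
Proof.
move=> kb; have [lg l1 l2] := levelP b0 last_ kb.
move: (level beta g k) lg l1 l2 => [|l] //= lg l1 l2.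
have E i : fcoef (y - pconj w y k) i = a i * (1 - w ^+ (k * i)).
  by rewrite fcoefB /pconj fcoef_rot -exprM mulrBr mulr1.
split=> [i il|].
  rewrite E; have [->|ai] := eqVneq (a i) 0; first by rewrite mul0r.
  have /dvdnP[x ->] := pb_supp H (lg : (l < g)%N) il ai.
  case/dvdnP: l1 => z ->.
  rewrite mulnACA -[(z * x * _)%N]mulnC exprM coindexE (prim_expr_order wP).
  by rewrite expr1n subrr mulr0.
rewrite E mulf_neq0 ?(pb_lead H) // subr_eq0 eq_sym -(prim_order_dvd wP).
by rewrite (@dvd_beta beta g b0).
Qed.

Lemma conj_neq_root k : (0 < k < b)%N -> y <> fcomp (fpsC (w ^+ k) * fpsX K) y.
Proof. by move=> /conj_ordeq/ordeq_neq0 + h; apply; apply/eqP; rewrite subr_eq0 {1}h. Qed.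

Definition contact (kappa T : nat) : nat :=
  contact_sum b (fun k => beta (level beta g k)) kappa T.

Lemma contactE kappa T : contact kappa T =
  (T + \sum_(1 <= l < g.+1) (e l.-1 - e l) * minn T (kappa * beta l))%N.
Proof.
rewrite /contact /contact_sum.
by rewrite (sum_level b0 last_ (fun l => minn T (kappa * beta l))).
Qed.

Lemma leq_contact kappa T T' : (T <= T')%N -> (contact kappa T <= contact kappa T')%N.
Proof.
move=> le; rewrite !contactE leq_add // leq_sum // => l _.
by rewrite leq_mul2l leq_min !geq_min le leqnn !orbT.
Qed.

(** This is where the semigroup generators enter: they measure f when the contact stops exactly at
    beta_(j+1). *)
Lemma contact_semigen kappa j : (j < g)%N ->
  contact kappa (kappa * beta j.+1) = (e j * (kappa * semigen beta j.+1))%N.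
Proof.
move=> jg; rewrite contactE (mulnCA (e j)).
rewrite (semigen_sum b0 last_ inc (_ : 1 <= j.+1 <= g)%N) //.
under eq_bigr => l _ do rewrite -minnMr mulnCA.
rewrite -big_distrr /= (big_gap_beta b0 last_ inc) // -mulnDr; congr (_ * _)%N.
have := leq_pmull (beta j.+1) (gcd_seq_gt0 b0 j); rewrite [j.+1.-1]/= mulnBl mul1n; lia.
Qed.

Section Arc.
Variables (s X : fps K) (kappa : nat).
Hypothesis kappa0 : (0 < kappa)%N.
Hypothesis sP : ordeq s kappa.
Hypothesis X0 : fcoef X 0 = 0.

Let s0 : fcoef s 0 = 0. Proof. by case: sP => h _; apply: h. Qed.

Lemma vge_bsub_prod T : vge T (bsub (s ^+ b) X f) <->
  vge T (\prod_(i < b) (X - fcomp (fpsC (w ^+ i) * s) y)).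
Proof.
have [eps eps0 ->] := bsub_pow b0 wP y0 (pb_root H) conj_neq_root (pb_reg H) s0 X0.
have [|r er] := @fps_inv _ eps (fcoef eps 0)^-1; first by rewrite mulfV.
split=> [h|]; last exact: vgeMl.
move: (\prod_(i < b) _) h => P h.
rewrite (_ : P = P * eps * r); last by rewrite -mulrA er mulr1.
exact: vgeMl h.
Qed.

Lemma bsub_ge i T : vge T (X - fcomp (fpsC (w ^+ i) * s) y) ->
  vge (contact kappa T) (bsub (s ^+ b) X f).
Proof.
move=> h; apply/vge_bsub_prod; exact: (contact_ge b0 wP conj_ordeq kappa0 sP h).
Qed.

Lemma bsub_lt T : (forall i, ~ vge T.+1 (X - fcomp (fpsC (w ^+ i) * s) y)) ->
  ~ vge (contact kappa T).+1 (bsub (s ^+ b) X f).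
Proof.
move=> h /vge_bsub_prod; apply: (contact_lt b0 wP conj_ordeq kappa0 sP) => i _.
exact: h.
Qed.

End Arc.

(* The part of y below the exponent D, as a series in t ^ (e i). *)
Definition ytrunc (i D : nat) : fps K :=
  FPS (fun k => if (k * e i < D)%N then a (k * e i) else 0).

Lemma ytrunc0 i D : fcoef (ytrunc i D) 0 = 0.
Proof. by rewrite fcoefF; case: ifP => // _; apply: y0. Qed.

Section Level.
Variables (i D : nat).
Hypothesis DP : forall l, (l < D)%N -> a l != 0 -> (e i %| l)%N.

Let e0 : (0 < e i)%N. Proof. exact: gcd_seq_gt0. Qed.

Local Notation dil := (fcomp (fpsX K ^+ e i)).

Let dil0 c : fcoef (dil c) 0 = fcoef c 0. Proof. exact: fcomp0. Qed.

Let Xe0 : fcoef (fpsX K ^+ e i) 0 = 0. Proof. by rewrite fcoefXn ltn_eqF. Qed.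

Lemma dil_ytrunc : dil (ytrunc i D) = ftrunc D y.
Proof.
apply: fpsP => n; rewrite fcoef_dil // fcoef_trunc fcoefF.
case: ifP => [/divnK -> //|h]; case: ifP => // nD.
by apply/esym/eqP; apply: contraFT h => an; apply: DP.
Qed.

Variables (s v : fps K) (kappa : nat).
Hypothesis kappa0 : (0 < kappa)%N.
Hypothesis sP : ordeq s kappa.
Hypothesis v0 : fcoef v 0 = 0.

Let s0 : fcoef s 0 = 0. Proof. by case: sP => h _; apply: h. Qed.

(** After t -> t^(e_i) the series s acquires an e_i-th root s', so x0 = s^(M i) becomes the b-th
    power of s' and the factorization applies. *)
Let dil_root : exists2 s', ordeq s' kappa & s' ^+ e i = dil s.
Proof. by apply: ordeq_root => //; rewrite mulnC; apply: ordeq_fcomp (ordeq_fpsX _ _) sP. Qed.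

Let dil_bsub (s' : fps K) : s' ^+ e i = dil s ->
  dil (bsub (s ^+ coindex beta i) v f) = bsub (s' ^+ b) (dil v) f.
Proof.
have sM0 : fcoef (s ^+ coindex beta i) 0 = 0.
  by rewrite fcoef0X s0 expr0n eqn0Ngt coindex_gt0.
move=> hs'; rewrite [LHS](fcomp_bsub _ _ sM0 v0).
rewrite rmorphXn /= -hs' -exprM mulnC coindexE.
reflexivity.
Qed.

Let tail_ (s' : fps K) (k : nat) := fcomp (fpsC (w ^+ k) * s') (y - ftrunc D y).

Let rot_root (s' : fps K) (k : nat) : ordeq s' kappa -> ordeq (fpsC (w ^+ k) * s') kappa.
Proof.
move=> h; rewrite -[kappa]add0n; apply: ordeqM => //; split=> //.
rewrite fcoefC expf_neq0 //; apply/eqP => w00; have := prim_expr_order wP.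
by rewrite w00 expr0n eqn0Ngt b0 => /esym/eqP; rewrite oner_eq0.
Qed.

(** The first term only has exponents divisible by e_i and sees the truncation of y; the tail starts
    at order [kappa * D] or later. Only the power w^(e_i k) survives in the truncation. *)
Let factor_split (s' : fps K) (k : nat) : ordeq s' kappa -> s' ^+ e i = dil s ->
  dil v - fcomp (fpsC (w ^+ k) * s') y =
  dil (v - fcomp (fpsC (w ^+ (e i * k)) * s) (ytrunc i D)) - tail_ s' k.
Proof.
move=> hs hs'; rewrite /tail_ -{1}(subrK (ftrunc D y) y) rmorphD /= opprD addrCA addrC.
congr (_ - _); rewrite rmorphB /=; congr (_ - _).
have r0 : fcoef (fpsC (w ^+ k) * s') 0 = 0.
  by case: (rot_root k hs) => h _; apply: h.
have r1 : fcoef (fpsC (w ^+ (e i * k)) * s) 0 = 0 by rewrite fcoef0M s0 mulr0.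
rewrite -dil_ytrunc (fcomp_fcomp _ _ Xe0) (fcomp_fcomp _ _ r1).
have -> : fcomp (fpsC (w ^+ k) * s') (fpsX K ^+ e i) = dil (fpsC (w ^+ (e i * k)) * s).
  rewrite rmorphXn /= fcompX (ftailE r0) exprMn hs' fpsC_exp.
  by rewrite rmorphM /= fcompC -exprM [(k * _)%N]mulnC.
reflexivity.
Qed.

Let tail_ge (s' : fps K) (k : nat) : ordeq s' kappa -> vge (kappa * D) (tail_ s' k).
Proof.
move=> hs; apply: vge_fcomp => //; first by case: (rot_root k hs).
exact: vge_ftrunc.
Qed.

Lemma level_ge T : (T <= kappa * D)%N -> (exists2 L, vge L (v - fcomp s (ytrunc i D)) &
    (T <= e i * L)%N) ->
  vge (contact kappa T) (dil (bsub (s ^+ coindex beta i) v f)).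
Proof.
move=> TD [L hL TL]; have [s' hs hs'] := dil_root.
rewrite (dil_bsub hs'); apply: (@bsub_ge _ _ _ kappa0 hs _ 0%N); first by rewrite dil0.
rewrite (factor_split _ hs hs'); apply: vgeB; last by apply: vgeW (tail_ge _ hs).
apply: vgeW TL _; apply: (vge_dil _ _ e0).1.
by rewrite muln0 expr0 (_ : fpsC 1 = 1) ?mul1r.
Qed.

Lemma level_lt L : (e i * L < kappa * D)%N ->
  (forall k, ~ vge L.+1 (v - fcomp (fpsC (w ^+ (e i * k)) * s) (ytrunc i D))) ->
  ~ vge (contact kappa (e i * L)).+1 (dil (bsub (s ^+ coindex beta i) v f)).
Proof.
move=> LD hL; have [s' hs hs'] := dil_root.
rewrite (dil_bsub hs'); apply: (bsub_lt kappa0 hs) => [|k]; first by rewrite dil0.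
rewrite (factor_split _ hs hs') => h; apply: (hL k).
have {}h : vge (e i * L).+1 (dil (v - fcomp (fpsC (w ^+ (e i * k)) * s) (ytrunc i D))).
  rewrite -[X in vge _ X](subrK (tail_ s' k)); apply: vgeD => //.
  by apply: vgeW (tail_ge _ hs).
move=> l lL; have := h (e i * l)%N; rewrite fcoef_dil // dvdn_mulr // mulKn //.
by apply; rewrite ltnS leq_pmul2l.
Qed.

(** The tail has order exactly [kappa * D], where the ramified part has no term since e_i does not
    divide this number. Hence no factor exceeds that order, whatever v is. *)
Lemma level_max : fcoef y D != 0 -> ~~ (e i %| kappa * D)%N ->
  ~ vge (contact kappa (kappa * D)).+1 (dil (bsub (s ^+ coindex beta i) v f)).
Proof.
move=> yD nD; have [s' hs hs'] := dil_root.
rewrite (dil_bsub hs'); apply: (bsub_lt kappa0 hs) => [|k]; first by rewrite dil0.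
rewrite (factor_split _ hs hs') => /(_ (kappa * D)%N (leqnn _)).
rewrite fcoefB (fcoef_dil _ _ e0) (negbTE nD) sub0r => /eqP; rewrite oppr_eq0.
have [_ /negP] : ordeq (tail_ s' k) (kappa * D); last by [].
apply: ordeq_fcomp (rot_root k hs) _ => //; split; first exact: vge_ftrunc.
by rewrite fcoefB fcoef_trunc ltnn subr0.
Qed.

End Level.
End BranchOrder.

(** * Jets as truncated arcs *)

Local Notation arc := Defs.arc.

Section JetArcs.
Variables (K : fieldType) (m : nat).
Implicit Types (u v : fps K) (x : jet_space K m).

Definition mkjet u v : jet_space K m :=
  \matrix_(i, j) fcoef (if i == ord0 then u else v) j.

Lemma arc_mkjet0 u v : arc (mkjet u v) ord0 = ftrunc m.+1 u.
Proof.
apply: fpsP => k; rewrite fcoefF fcoef_trunc ltnS; case: ifP => // km.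
by rewrite mxE eqxx inordK.
Qed.

Lemma arc_mkjet1 u v : arc (mkjet u v) ord_max = ftrunc m.+1 v.
Proof.
apply: fpsP => k; rewrite fcoefF fcoef_trunc ltnS; case: ifP => // km.
by rewrite mxE inordK.
Qed.

Lemma ord2P (i : 'I_2) : i = ord0 \/ i = ord_max.
Proof. by case: i => -[|[|//]] ?; [left|right]; apply: val_inj. Qed.

Lemma eq_mkjet x u v : vge m.+1 (arc x ord0 - u) -> vge m.+1 (arc x ord_max - v) ->
  x = mkjet u v.
Proof.
move=> /vgeBP hu /vgeBP hv; apply/matrixP => i j; rewrite mxE.
have jm : (j <= m)%N by rewrite -ltnS.
by case: (ord2P i) => ->; rewrite ?eqxx /= -?hu -?hv // fcoefF jm inord_val.
Qed.

Lemma mkjet_arc x : x = mkjet (arc x ord0) (arc x ord_max).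
Proof. by apply: eq_mkjet; rewrite subrr. Qed.

Lemma eq_mkjet2 u u' v v' : vge m.+1 (u - u') -> vge m.+1 (v - v') ->
  mkjet u v = mkjet u' v'.
Proof.
move=> hu hv; apply: eq_mkjet; rewrite ?arc_mkjet0 ?arc_mkjet1;
  by apply: vgeB_trans (vgeBC (@vge_ftrunc _ _ _)) _.
Qed.

Lemma jets0_mkjet f u v : fcoef u 0 = 0 -> fcoef v 0 = 0 ->
  jets0 m f (mkjet u v) <-> vge m.+1 (bsub u v f).
Proof.
move=> u0 v0.
have u0' : fcoef (ftrunc m.+1 u) 0 = 0 by [].
have v0' : fcoef (ftrunc m.+1 v) 0 = 0 by [].
have h : vge m.+1 (bsub u v f - bsub (ftrunc m.+1 u) (ftrunc m.+1 v) f).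
  by apply: vge_bsubB; apply: vge_ftrunc.
split=> [[_]|hv].
  rewrite arc_mkjet0 arc_mkjet1 (bps_substE _ u0' v0') => hk.
  rewrite -(subrK (bsub (ftrunc m.+1 u) (ftrunc m.+1 v) f) (bsub u v f)).
  by apply: vgeD => // k km; apply: hk.
split=> [i|k km]; first by rewrite mxE; case: ifP.
rewrite arc_mkjet0 arc_mkjet1 (bps_substE _ u0' v0').
by have := vgeD (vgeBC h) hv; rewrite subrK; apply.
Qed.

Lemma arc0 x i : x i ord0 = 0 -> fcoef (arc x i) 0 = 0.
Proof. by move=> h; rewrite fcoefF /= (_ : inord 0 = ord0) //; apply: val_inj; rewrite /= inordK. Qed.

Lemma jets0P f x : jets0 m f x <->
  [/\ fcoef (arc x ord0) 0 = 0, fcoef (arc x ord_max) 0 = 0 &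
      vge m.+1 (bsub (arc x ord0) (arc x ord_max) f)].
Proof.
split=> [h|[h0 h1 hv]]; last by rewrite (mkjet_arc x); apply/jets0_mkjet.
have h0 := arc0 (h.1 ord0); have h1 := arc0 (h.1 ord_max); split=> //.
by move: h; rewrite {1}(mkjet_arc x) => /jets0_mkjet; apply.
Qed.

Lemma is_min_ordeq u k : is_min [set k | fcoef u k <> 0] k <-> ordeq u k.
Proof.
split=> [[/eqP h1 h2]|[h1 /eqP h2]]; split=> //.
  by move=> l lk; apply: contrapT => /h2; rewrite leqNgt lk.
by move=> l ul; rewrite leqNgt; apply/negP => /h1.
Qed.

Lemma cont_eqP f k x : cont_eq m f k x <-> jets0 m f x /\ ordeq (arc x ord0) k.
Proof. by split=> -[h1 h2]; split=> //; apply/is_min_ordeq. Qed.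

Lemma cont_gtP f k x : cont_gt m f k x <-> jets0 m f x /\ vge k.+1 (arc x ord0).
Proof. by []. Qed.

Lemma ordeq_arc x k : ordeq (arc x ord0) k -> (k <= m)%N.
Proof. by move=> [_]; rewrite fcoefF; case: ifP => //; rewrite eqxx. Qed.

Lemma ordeq_trunc u k : (k <= m)%N -> ordeq u k -> ordeq (ftrunc m.+1 u) k.
Proof.
move=> km [h1 h2]; split; last by rewrite fcoef_trunc ltnS km.
by move=> l lk; rewrite fcoef_trunc; case: ifP => // _; apply: h1.
Qed.

End JetArcs.

Section ContDescription.
Variables (K : numClosedFieldType) (f : bps K) (a : nat -> K) (g : nat).
Variables (beta : nat -> nat) (w : K) (m : nat).
Hypothesis H : puiseux_branch f a g beta w.
Local Notation b := (beta 0).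
Local Notation e := (gcd_seq beta).
Local Notation M := (coindex beta).
Local Notation contact := (contact g beta).
Let b0 : (0 < b)%N. Proof. exact: ltnW (pb_b H). Qed.

(* The exponent up to which the arcs with ord x0 = kappa * M i can follow the branch. *)
Definition cutoff (i : nat) : nat := if (i < g)%N then beta i.+1 else m.+1.

(** For i = g there is no divisibility condition: the order of x0 is then any positive multiple of
    b. *)
Definition level_of (i kappa : nat) : Prop :=
  [/\ (i <= g)%N, (0 < kappa)%N & (i < g)%N -> ~~ (ratio_n beta i.+1 %| kappa)%N].

Definition feasible (i kappa : nat) : Prop :=
  (i < g)%N -> (m < kappa * semigen beta i.+1)%N.

Let cutoffP i : (i <= g)%N -> forall l, (l < cutoff i)%N -> a l != 0 -> (e i %| l)%N.
Proof.
rewrite /cutoff leq_eqVlt => /orP[/eqP -> l _ _|ig l].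
  by rewrite (pb_last H) dvd1n.
by rewrite ig; apply: (pb_supp H).
Qed.

Let feasibleE i kappa : level_of i kappa -> feasible i kappa ->
  (e i * m.+1 <= contact kappa (kappa * cutoff i))%N.
Proof.
rewrite /feasible /cutoff => -[ig k0 _]; case: ifP => [lt /(_ isT) h|ge _].
  by rewrite (contact_semigen H) // leq_mul2l h orbT.
have -> : i = g by lia.
by rewrite (pb_last H) mul1n (contactE H); have := leq_pmull m.+1 k0; lia.
Qed.

(** By [level_max] the order of f is at most kappa betab_(i+1), hence at most m, for every choice of
    x1. *)
Lemma cont_eq_empty i kappa x : level_of i kappa -> ~ feasible i kappa ->
  ~ cont_eq m f (kappa * M i) x.
Proof.
move=> [ig k0 hi] /not_implyP[lt /negP]; rewrite -leqNgt => km.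
move=> /cont_eqP[/jets0P[u0 v0 hv] hu].
have [s hs sE] := ordeq_root (coindex_gt0 b0 i) hu.
have := @level_max _ _ _ _ _ _ H i (beta i.+1) _ s (arc x ord_max) kappa k0 hs v0.
rewrite sE; apply.
- by have := cutoffP ig; rewrite /cutoff lt.
- by rewrite fcoefF (pb_lead H).
- apply/negP => hd; case/negP: (hi lt); move: hd.
  have := gcd_seq_dvd_beta beta (leqnn i.+1) => /dvdnP[c hc].
  rewrite hc -(ratio_nE beta i) mulnA dvdn_pmul2r ?gcd_seq_gt0 //.
  rewrite Gauss_dvdl // /coprime -(eqn_pmul2r (gcd_seq_gt0 b0 i.+1)) muln_gcdl.
  by rewrite ratio_nE -hc mul1n gcd_seqS.
rewrite (contact_semigen H _ lt); apply: (vgeW (b := (e i * m.+1)%N)).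
  have := gcd_seq_gt0 b0 i; have : (e i * (kappa * semigen beta i.+1) <= e i * m)%N.
    by rewrite leq_mul2l km orbT.
  by rewrite mulnS; lia.
by apply: (vge_dil _ _ _).1 => //; apply: gcd_seq_gt0.
Qed.

(** L is the least contact forcing f to vanish modulo t^(m+1). By monotonicity of the contact sum,
    vanishing of f is equivalent to agreement with one conjugate modulo t^L, and the choice of s
    makes this conjugate the standard one. *)
Lemma cont_eq_desc i kappa : level_of i kappa -> feasible i kappa ->
  (kappa * M i <= m)%N -> exists L,
  [/\ (0 < L)%N, (e i * L.-1 < kappa * cutoff i)%N,
      (e i * m.+1 <= contact kappa (minn (e i * L) (kappa * cutoff i)))%N &
      (contact kappa (e i * L.-1) < e i * m.+1)%N] /\
  forall x, cont_eq m f (kappa * M i) x <->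
    exists s v : fps K, [/\ ordeq s kappa,
      vge L (v - fcomp s (ytrunc a beta i (cutoff i))) & x = mkjet m (s ^+ M i) v].
Proof.
move=> lv fe Nm; have [ig k0 _] := lv; have e0 := gcd_seq_gt0 b0 i.
pose T := (kappa * cutoff i)%N.
have exL : exists L, (e i * m.+1 <= contact kappa (minn (e i * L) T))%N.
  by exists T; rewrite (minn_idPr _) ?leq_pmull //; apply: feasibleE.
case: (ex_minnP exL) => L hL minL.
have L0 : (0 < L)%N.
  rewrite lt0n; apply/eqP => L0; move: hL.
  rewrite L0 muln0 min0n (contactE H) big1 => [|l _]; last by rewrite min0n muln0.
  by rewrite leqNgt muln_gt0 e0.
have nL : (contact kappa (minn (e i * L.-1) T) < e i * m.+1)%N.
  by rewrite ltnNge; apply/negP => /minL; rewrite leqNgt prednK // leqnn.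
have LT : (e i * L.-1 < T)%N.
  rewrite ltnNge; apply/negP => /minn_idPr h; move: nL; rewrite h ltnNge.
  by rewrite feasibleE.
rewrite (minn_idPl (ltnW LT)) in nL.
exists L; split=> // x; split=> [/cont_eqP[/jets0P[u0 v0 hv] hu]|[s [v [hs hv ->]]]].
  have [s hs sE] := ordeq_root (coindex_gt0 b0 i) hu.
  have [k hk] : exists k, vge L (Defs.arc x ord_max -
      fcomp (fpsC (w ^+ (e i * k)) * s) (ytrunc a beta i (cutoff i))).
    apply: contrapT => /forallNP nk.
    apply: (level_lt H (cutoffP ig) k0 hs v0 LT) => [k|]; first by rewrite prednK.
    apply: (vgeW nL); rewrite sE; apply: (vge_dil _ _ e0).1; exact: hv.
  (* Absorbing the root of unity into s leaves x0 unchanged, since its [M i]-th power is w^(b k) =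
     1. *)
  exists (fpsC (w ^+ (e i * k)) * s), (Defs.arc x ord_max); split=> //.
    rewrite -[kappa]add0n; apply: ordeqM => //; split=> //.
    rewrite fcoefC expf_neq0 //; apply/eqP => w00; have := prim_expr_order (pb_prim H).
    by rewrite w00 expr0n eqn0Ngt b0 => /esym/eqP; rewrite oner_eq0.
  rewrite exprMn fpsC_exp -exprM (_ : (e i * k * M i = b * k)%N); last first.
    by rewrite mulnAC [(e i * M i)%N]mulnC coindexE.
  rewrite exprM.
  by rewrite (prim_expr_order (pb_prim H)) expr1n (_ : fpsC 1 = 1) // mul1r sE; apply: mkjet_arc.
have v0 : fcoef v 0 = 0.
  have := hv 0%N L0; rewrite fcoefB fcomp0 (ytrunc0 H) subr0; apply.
have s0 : fcoef (s ^+ M i) 0 = 0.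
  by apply: (ordeqX (M i) hs).1; rewrite muln_gt0 k0 coindex_gt0.
apply/cont_eqP; split; last first.
  by rewrite arc_mkjet0; apply: ordeq_trunc => //; apply: ordeqX.
apply/(jets0_mkjet m f s0 v0); apply: (vge_dil _ _ e0).2; apply: (vgeW hL).
apply: (level_ge H (cutoffP ig) k0 hs v0); first exact: geq_minr.
by exists L => //; apply: geq_minl.
Qed.

End ContDescription.

(** * Regular functions, irreducible sets and components *)

Section FunRing.
Variables (K : comNzRingType) (T : Type).
Implicit Types (P : (T -> K) -> Prop) (F G : T -> fps K).

(** One notion for three algebras: polynomial functions on the line (curves), on K^d
    (parametrizations) and regular functions on matrices. All coefficients of the series
    constructions below stay inside such an algebra. *)
Definition funring P := [/\ forall c, P (fun=> c),
  forall F G : T -> K, P F -> P G -> P (fun t => F t + G t) &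
  forall F G : T -> K, P F -> P G -> P (fun t => F t * G t)].

Variable P : (T -> K) -> Prop.
Hypothesis PR : funring P.

Lemma funring_ext (F G : T -> K) : F =1 G -> P F -> P G.
Proof. by move=> /funext ->. Qed.

Lemma funring_sum (I : Type) (r : seq I) (Q : pred I) (F : I -> T -> K) :
  (forall i, P (F i)) -> P (fun t => \sum_(i <- r | Q i) F i t).
Proof.
case: PR => Pc Pa _ hF; elim: r => [|i r IH].
  by apply: funring_ext (Pc 0) => t; rewrite big_nil.
case Qi : (Q i); last by apply: funring_ext IH => t; rewrite big_cons Qi.
by apply: funring_ext (Pa _ _ (hF i) IH) => t; rewrite big_cons Qi.
Qed.

Lemma funring_prod (I : Type) (r : seq I) (Q : pred I) (F : I -> T -> K) :
  (forall i, P (F i)) -> P (fun t => \prod_(i <- r | Q i) F i t).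
Proof.
case: PR => Pc _ Pm hF; elim: r => [|i r IH].
  by apply: funring_ext (Pc 1) => t; rewrite big_nil.
case Qi : (Q i); last by apply: funring_ext IH => t; rewrite big_cons Qi.
by apply: funring_ext (Pm _ _ (hF i) IH) => t; rewrite big_cons Qi.
Qed.

Lemma funring_exp (F : T -> K) n : P F -> P (fun t => F t ^+ n).
Proof.
case: PR => Pc _ Pm hF; elim: n => [|n IH].
  by apply: funring_ext (Pc 1) => t; rewrite expr0.
by apply: funring_ext (Pm _ _ hF IH) => t; rewrite exprS.
Qed.

Definition ffunring F := forall n, P (fun t => fcoef (F t) n).

Lemma ffunring_cst (c : fps K) : ffunring (fun=> c).
Proof. by case: PR => Pc _ _ n. Qed.

Lemma ffunringD F G : ffunring F -> ffunring G -> ffunring (fun t => F t + G t).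
Proof. by case: PR => _ Pa _ hF hG n; apply: Pa. Qed.

Lemma ffunringM F G : ffunring F -> ffunring G -> ffunring (fun t => F t * G t).
Proof.
case: PR => _ _ Pm hF hG n.
apply: (funring_ext (F := fun t => \sum_(i < n.+1) fcoef (F t) i * fcoef (G t) (n - i))) => [t|].
  by rewrite fcoefM.
by apply: (@funring_sum _ _ _ (fun (i : 'I_n.+1) t => fcoef (F t) i * fcoef (G t) (n - i))) => i; apply: Pm.
Qed.

Lemma ffunringX F n : ffunring F -> ffunring (fun t => F t ^+ n).
Proof.
move=> hF; elim: n => [|n IH].
  by move=> k; apply: funring_ext (ffunring_cst 1 k) => t; rewrite expr0.
by move=> k; apply: funring_ext (ffunringM hF IH k) => t; rewrite exprS.
Qed.

Lemma ffunring_fcomp F (c : fps K) : ffunring F -> ffunring (fun t => fcomp (F t) c).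
Proof.
move=> hF n.
apply: (funring_ext (F := fun t => \sum_(j < n.+1) fcoef (fpsC (fcoef c j) * ftail (F t) ^+ j) n)) => [t|].
  by rewrite fcoef_fcomp.
apply: (@funring_sum _ _ _ (fun (j : 'I_n.+1) t => fcoef (fpsC (fcoef c j) * ftail (F t) ^+ j) n)) => j.
apply: ffunringM; first exact: ffunring_cst.
apply: ffunringX => k; case: k => [|k]; last exact: hF.
by case: PR => Pc _ _; apply: Pc.
Qed.

Lemma ffunring_trunc F n : ffunring F -> ffunring (fun t => ftrunc n (F t)).
Proof.
move=> hF k; case: (ltnP k n) => kn.
  by apply: funring_ext (hF k) => t; rewrite fcoef_trunc kn.
case: PR => Pc _ _; apply: funring_ext (Pc 0) => t.
by rewrite fcoef_trunc ltnNge kn.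
Qed.

End FunRing.

Section PolyFun.
Variable K : fieldType.

Definition polyfun (F : K -> K) := exists p : {poly K}, forall u, F u = p.[u].

Lemma polyfun_ring : funring polyfun.
Proof.
split=> [c|F G [p hp] [q hq]|F G [p hp] [q hq]].
- by exists c%:P => u; rewrite hornerC.
- by exists (p + q) => u; rewrite hornerD hp hq.
by exists (p * q) => u; rewrite hornerM hp hq.
Qed.

Lemma polyfun_id : polyfun id.
Proof. by exists 'X => u; rewrite hornerX. Qed.

Definition mpolyfun d (F : ('I_d -> K) -> K) :=
  exists p : mpoly d K, forall v, F v = meval v p.

Lemma mpolyfun_ring d : funring (@mpolyfun d).
Proof.
split=> [c|F G [p hp] [q hq]|F G [p hp] [q hq]].
- by exists (mpolyC d c) => v; rewrite mevalC.
- by exists (p + q) => v; rewrite mevalD hp hq.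
by exists (p * q) => v; rewrite mevalM hp hq.
Qed.

Lemma mpolyfun_coord d i : mpolyfun (fun v : 'I_d -> K => v i).
Proof. by exists (mpolyX K (mnm1 i)) => v; rewrite mevalXU. Qed.

End PolyFun.

Section ZariskiFacts.
Variables (K : numFieldType) (r s : nat).
Implicit Types X Y Z : set 'M[K]_(r, s).

Definition regular (F : 'M[K]_(r, s) -> K) :=
  exists p : mpoly (r * s) K, forall x, F x = meval (mxvec x ord0) p.

Lemma regular_ring : funring regular.
Proof.
split=> [c|F G [p hp] [q hq]|F G [p hp] [q hq]].
- by exists (mpolyC _ c) => v; rewrite mevalC.
- by exists (p + q) => v; rewrite mevalD hp hq.
by exists (p * q) => v; rewrite mevalM hp hq.
Qed.

Lemma regular_coord i j : regular (fun x => x i j).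
Proof.
exists (mpolyX K (mnm1 (mxvec_index i j))) => x.
by rewrite mevalXU mxvecE.
Qed.

Lemma zclosed_regular F : regular F -> zclosed [set x | F x = 0].
Proof.
move=> [p hp]; exists [set p]; apply/seteqP; split=> x /=.
  by move=> h q ->; rewrite -hp.
by rewrite hp; apply.
Qed.

Lemma zclosedI_fam (I : Type) (Y : I -> set 'M[K]_(r, s)) :
  (forall i, zclosed (Y i)) -> zclosed [set x | forall i, Y i x].
Proof.
move=> /choice[P hP]; exists [set p | exists i, P i p]; apply/seteqP; split=> x /=.
  by move=> h p [i ip]; have := h i; rewrite hP; apply.
by move=> h i; rewrite hP => p ip; apply: h; exists i.
Qed.

Lemma zclosedU Y1 Y2 : zclosed Y1 -> zclosed Y2 -> zclosed (Y1 `|` Y2)%classic.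
Proof.
move=> [P1 ->] [P2 ->]; exists [set p | exists p1 p2, [/\ P1 p1, P2 p2 & p = p1 * p2]].
apply/seteqP; split=> x /=.
  by move=> [h|h] p [p1 [p2 [h1 h2 ->]]]; rewrite mevalM ?(h _ h1) ?(h _ h2) ?mul0r ?mulr0.
move=> h; apply: contrapT => /not_orP[/existsNP[p1 /not_implyP[h1 n1]]].
move=> /existsNP[p2 /not_implyP[h2 n2]].
have /eqP := h (p1 * p2) (ex_intro _ p1 (ex_intro _ p2 (And3 h1 h2 erefl))).
by rewrite mevalM mulf_eq0 => /orP[/eqP|/eqP].
Qed.

Lemma poly_nonroot (p : {poly K}) : p != 0 -> exists u, p.[u] != 0.
Proof.
move=> p0; apply: contrapT => /forallNP h.
pose rs := [seq (i%:R : K) | i <- iota 0 (size p)].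
have := @max_poly_roots _ p rs p0; rewrite size_map size_iota ltnn => hr.
have {hr} : false; last by []; apply: hr.
  by apply/allP => u _; rewrite rootE; have /negP := h u; rewrite negbK.
by rewrite map_inj_uniq ?iota_uniq // => i j /eqP; rewrite eqr_nat => /eqP.
Qed.

Lemma regular_comp (T : Type) (P : (T -> K) -> Prop) F (c : T -> 'M[K]_(r, s)) :
  funring P -> regular F -> (forall i j, P (fun t => c t i j)) -> P (fun t => F (c t)).
Proof.
move=> PR [p hp] hc; have [Pc _ Pm] := PR.
apply: (funring_ext (F := fun t => \sum_(m <- msupp p) mcoeff m p *
    \prod_i (mxvec (c t) ord0 i) ^+ (fun_of_multinom m i))) => [t|].
  by rewrite hp mevalE.
apply: (funring_sum PR) => m; apply: Pm; first exact: Pc.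
apply: (funring_prod PR) => k; apply: (funring_exp PR).
by case/mxvec_indexP: k => i j; apply: funring_ext (hc i j) => t; rewrite mxvecE.
Qed.

Definition polycurve (c : K -> 'M[K]_(r, s)) := forall i j, polyfun (fun u => c u i j).

Lemma regular_curve F c : regular F -> polycurve c -> polyfun (fun u => F (c u)).
Proof. by move=> hF hc; apply: regular_comp => //; apply: polyfun_ring. Qed.

(* Two polynomials that do not vanish identically along a curve have a common
   non-zero on it. *)
Lemma zirreducible_curves Z : (Z !=set0)%classic ->
  (forall x y, Z x -> Z y -> exists c (q : {poly K}),
     [/\ polycurve c, c 0 = x, c 1 = y, q != 0 & forall u, q.[u] != 0 -> Z (c u)]) ->
  zirreducible Z.
Proof.
move=> Z0 hZ; split=> // Y1 Y2 [P1 ->] [P2 ->] sub.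
apply: contrapT => /not_orP[/existsNP[x /not_implyP[Zx]]].
move=> /existsNP[p1 /not_implyP[h1 n1]] /existsNP[y /not_implyP[Zy]].
move=> /existsNP[p2 /not_implyP[h2 n2]].
have [c [q [hc c0 c1 q0 hq]]] := hZ x y Zx Zy.
have [|q1 hq1] := @regular_curve (fun x => meval (mxvec x ord0) p1) c _ hc; first by exists p1.
have [|q2 hq2] := @regular_curve (fun x => meval (mxvec x ord0) p2) c _ hc; first by exists p2.
have q10 : q1 != 0 by apply/eqP => h; apply: n1; rewrite -c0 hq1 h horner0.
have q20 : q2 != 0 by apply/eqP => h; apply: n2; rewrite -c1 hq2 h horner0.
have [|u] := @poly_nonroot (q1 * q2 * q); first by rewrite !mulf_neq0.
rewrite !hornerM !mulf_eq0 !negb_or -andbA => /and3P[/eqP u1 /eqP u2 u3].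
by case: (sub _ (hq u u3)) => /= h; [apply: u1; rewrite -hq1 h | apply: u2; rewrite -hq2 h].
Qed.

Lemma zirreducible_closure X Z : (Z `<=` X)%classic -> zirreducible Z ->
  zirreducible (zclosure_in X Z).
Proof.
move=> ZX [[z Zz] hZ]; split.
  by exists z; split=> [|Y _]; [apply: ZX | apply].
move=> Y1 Y2 c1 c2 sub.
have [|h|h] := hZ Y1 Y2 c1 c2.
- by move=> x Zx; apply: sub; split=> [|Y _]; [apply: ZX | apply].
- by left=> x [_]; apply.
by right=> x [_]; apply.
Qed.

Section Components.
Variables (X : set 'M[K]_(r, s)) (n : nat) (P : nat -> Prop).
Variable F : nat -> set 'M[K]_(r, s).
Hypothesis Firr : forall k, (k < n)%N -> P k -> zirreducible (F k).
Hypothesis Fclosed : forall k, (k < n)%N -> P k ->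
  exists2 Y, zclosed Y & F k = (X `&` Y)%classic.
Hypothesis Fcover : forall x, X x -> exists k, [/\ (k < n)%N, P k & F k x].
Hypothesis Fincl : forall k l, (k < n)%N -> (l < n)%N -> P k -> P l ->
  (F k `<=` F l)%classic -> k = l.

(** Induction on the number of sets: an irreducible set covered by the first N+1 of them lies in the
    last one or in the union of the others, which is the trace on X of a closed set. *)
Let irr_sub Z : zirreducible Z -> (Z `<=` X)%classic ->
  exists k, [/\ (k < n)%N, P k & (Z `<=` F k)%classic].
Proof.
move=> [Z0 hZ] ZX.
have hcov0 x : Z x -> exists k, [/\ (k < n)%N, P k & F k x] by move=> /ZX/Fcover.
move: (n) Fclosed hcov0 => N; elim: N => [|N IH] hc hcov.
  by case: Z0 => z /hcov[k []].
have [PN|nPN] := pselect (P N); last first.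
  have [||k [kN Pk h]] := IH; last by exists k; split=> //; apply: ltnW.
    by move=> k kN; apply: hc; apply: ltnW.
  move=> x /hcov[k [kN Pk Fk]]; exists k; split=> //.
  by move: kN; rewrite ltnS leq_eqVlt => /orP[/eqP kN|//]; rewrite kN in Pk.
have [Y cY FY] := hc N (leqnn _) PN.
have [U cU hU] : exists2 U, zclosed U & forall x, X x ->
    (U x <-> exists k, [/\ (k < N)%N, P k & F k x]).
  have {}hc k : (k < N)%N -> P k -> exists2 Y, zclosed Y & F k = (X `&` Y)%classic.
    by move=> kN; apply: hc; apply: ltnW.
  elim: (N) hc => [_|N' IH' hc].
    exists set0; last by move=> x _; split=> // -[k []].
    exists setT; apply/seteqP; split=> x //= h; have := h 1 I.
    by rewrite meval1 => /eqP; rewrite oner_eq0.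
  have [|U cU hU] := IH'; first by move=> k kN; apply: hc; apply: ltnW.
  have [PN'|nPN'] := pselect (P N').
    have [Y' cY' FY'] := hc N' (leqnn _) PN'.
    exists (U `|` Y')%classic; first exact: zclosedU.
    move=> x Xx; split=> [[/(hU x Xx)[k [kN Pk Fk]]|Yx]|[k [kN Pk Fk]]].
    - by exists k; split=> //; apply: ltnW.
    - by exists N'; split=> //; rewrite FY'.
    move: kN; rewrite ltnS leq_eqVlt => /orP[/eqP kN|kN]; last first.
      by left; apply/(hU x Xx); exists k.
    by right; move: Fk; rewrite kN FY' => -[].
  exists U => // x Xx; rewrite (hU x Xx); split=> -[k [kN Pk Fk]]; exists k; split=> //.
    exact: ltnW.
  by move: kN; rewrite ltnS leq_eqVlt => /orP[/eqP kN|//]; rewrite kN in Pk.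
have [|h|h] := hZ U Y cU cY.
- move=> x Zx; have [k [kN Pk Fk]] := hcov x Zx.
  move: kN; rewrite ltnS leq_eqVlt => /orP[/eqP kN|kN].
    by right; move: Fk; rewrite kN FY => -[].
  by left; apply/(hU x (ZX _ Zx)); exists k.
- have [||k [kN Pk hk]] := IH; last by exists k; split=> //; apply: ltnW.
    by move=> k kN; apply: hc; apply: ltnW.
  by move=> x Zx; apply/(hU x (ZX _ Zx)); apply: h.
by exists N; split=> // x Zx; rewrite FY; split; [apply: ZX | apply: h].
Qed.

Lemma irreducible_componentE Z :
  irreducible_component X Z <-> exists k, [/\ (k < n)%N, P k & Z = F k].
Proof.
have FX k : (k < n)%N -> P k -> (F k `<=` X)%classic.
  by move=> kn Pk; have [Y _ ->] := Fclosed kn Pk; move=> x [].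
split=> [[ZX Zi Zm]|[k [kn Pk ->]]].
  have [k [kn Pk ZF]] := irr_sub Zi ZX; exists k; split=> //.
  by rewrite (Zm (F k)) //; [apply: FX | apply: Firr].
split; [exact: FX | exact: Firr |].
move=> Y YX Yi sub; have [l [ln Pl YF]] := irr_sub Yi YX.
have kl : k = l by apply: Fincl => // x /sub/YF.
by apply/seteqP; split=> //; rewrite kl.
Qed.

End Components.
End ZariskiFacts.

Lemma linear_dependence (K : fieldType) (I J : finType) (A : I -> J -> K) :
  (#|J| < #|I|)%N ->
  exists2 c : I -> K, (exists i, c i != 0) & forall j, \sum_i c i * A i j = 0.
Proof.
move=> JI; pose M := \matrix_(i < #|I|, j < #|J|) A (enum_val i) (enum_val j).
pose v := nz_row (kermx M).
have v0 : v != 0.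
  rewrite nz_row_eq0 -mxrank_eq0 mxrank_ker subn_eq0 -ltnNge.
  exact: leq_ltn_trans (rank_leq_col _) JI.
have vM : v *m M = 0 by apply/sub_kermxP; apply: nz_row_sub.
exists (fun i => v 0 (enum_rank i)).
  have [j vj] := rV0Pn _ v0; exists (enum_val j); by rewrite enum_valK.
move=> j; have /matrixP/(_ 0 (enum_rank j)) := vM; rewrite !mxE => h; rewrite -[RHS]h.
rewrite [RHS](reindex (@enum_rank I)) /=; last exact/onW_bij/enum_rank_bij.
by apply: eq_bigr => i _; rewrite mxE !enum_rankK.
Qed.

Section AlgebraicDependence.
Variables (K : fieldType) (d : nat).
Implicit Types p q : mpoly d K.

(** The added 1 makes this degree bound subadditive on products without excluding zero factors. *)
Let mu p := (msize p).+1.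

Let muM p q : (mu (p * q)%R <= mu p + mu q)%N.
Proof. by rewrite /mu addSn addnS ltnS; apply: msizeM_le. Qed.

Let mu_pow p q k : (mu (p ^+ k * q)%R <= k * mu p + mu q)%N.
Proof.
elim: k => [|k IH]; first by rewrite expr0 mul1r.
by rewrite exprS -mulrA mulSn -addnA; apply: leq_trans (muM _ _) _; rewrite leq_add2l.
Qed.

(** The D^(d+1) products of the Q i with exponents below D lie in the span of at most (C D)^d
    monomials, with C independent of D; D > C^d makes the former more numerous. *)
Lemma alg_dependence (Q : 'I_d.+1 -> mpoly d K) :
  exists (D : nat) (c : {ffun 'I_d.+1 -> 'I_D} -> K), (exists al, c al != 0) /\
    forall v, \sum_al c al * \prod_i meval v (Q i) ^+ al i = 0.
Proof.
pose E := (\sum_i mu (Q i))%N; pose C := (d.+1 * E + 2)%N.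
pose D := (C ^ d).+1.
pose mon (al : {ffun 'I_d.+1 -> 'I_D}) := \prod_i Q i ^+ al i.
have mon_mu al : (mu (mon al) <= C * D)%N.
  have h : (mu (mon al) <= \sum_(i < d.+1) D * E + 2)%N.
    rewrite /mon; elim/big_rec2: _ => [|i n p _ h]; first by rewrite /mu msize1.
    apply: leq_trans (mu_pow _ _ _) _; rewrite -addnA leq_add // leq_mul //.
      exact: ltnW.
    by rewrite /E (bigD1 i) //= leq_addr.
  apply: leq_trans h _; rewrite sum_nat_const card_ord mulnDl leq_add //.
    by rewrite mulnA [(d.+1 * D)%N]mulnC -mulnA mulnC.
  by rewrite leq_pmulr.
pose bx (be : {ffun 'I_d -> 'I_(C * D)}) : multinom d := Multinom [tuple (be i : nat) | i < d].
have [|c c0 hc] := @linear_dependence K {ffun 'I_d.+1 -> 'I_D}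
   {ffun 'I_d -> 'I_(C * D)} (fun al be => mcoeff (bx be) (mon al)).
  rewrite !card_ffun !card_ord expnMn [in X in (_ < X)%N]expnS ltn_pmul2r ?expn_gt0 //.
exists D, c; split=> // v.
suff : \sum_al c al *: mon al = 0.
  move=> /(congr1 (meval v)); rewrite rmorph_sum meval0 /= => h.
  rewrite -[RHS]h; apply: eq_bigr => al _; rewrite mevalZ rmorph_prod /=.
  by congr (_ * _); apply: eq_bigr => i _; rewrite rmorphXn.
apply/mpolyP => m; rewrite mcoeff0 raddf_sum /=.
have [hm|/forallPn[i hi]] := boolP [forall i, (fun_of_multinom m i < C * D)%N].
  pose be := [ffun i => Ordinal (forallP hm i)].
  have -> : m = bx be.
    by apply/mnmP => i; rewrite mnmE ffunE.
  by rewrite -[RHS](hc be); apply: eq_bigr => al _; rewrite mcoeffZ.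
rewrite big1 // => al _; rewrite mcoeffZ memN_msupp_eq0 ?mulr0 //.
apply: msize_mdeg_ge; have := mon_mu al; rewrite /mu => h.
apply: leq_trans (ltnW h) _; apply: leq_trans (_ : fun_of_multinom m i <= _)%N.
  by rewrite leqNgt.
by rewrite mdegE (bigD1 i) //= leq_addr.
Qed.

End AlgebraicDependence.

Lemma digits_inj (D d : nat) (al be : nat -> nat) :
  (forall i, (i < d)%N -> (al i < D)%N) -> (forall i, (i < d)%N -> (be i < D)%N) ->
  (\sum_(i < d) al i * D ^ i = \sum_(i < d) be i * D ^ i)%N ->
  forall i, (i < d)%N -> al i = be i.
Proof.
elim: d al be => [//|d IH] al be hal hbe.
rewrite !big_ord_recl !expn0 !muln1.
have shift (ga : nat -> nat) : (\sum_(i < d) ga (bump 0 i) * D ^ bump 0 i =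
    (\sum_(i < d) ga i.+1 * D ^ i) * D)%N.
  rewrite big_distrl /=; apply: eq_bigr => i _.
  by rewrite /bump leq0n add1n expnSr mulnA.
rewrite !shift => E.
have D0 : (0 < D)%N by have := hal 0%N isT; lia.
have h0 : al 0%N = be 0%N.
  have /(congr1 (modn^~ D)) := E; rewrite ![(_ + _ * D)%N]addnC !modnMDl.
  by rewrite !modn_small ?hal ?hbe.
have h1 : (\sum_(i < d) al i.+1 * D ^ i = \sum_(i < d) be i.+1 * D ^ i)%N.
  by apply/eqP; rewrite -(eqn_pmul2r D0) -(eqn_add2l (al 0%N)) {2}h0 E.
move=> [//|i] id; apply: (IH (fun i => al i.+1) (fun i => be i.+1)) => // k kd.
  exact: hal.
exact: hbe.
Qed.

Section Dominance.
Variables (K : numFieldType) (r s d : nat).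
Implicit Types A B Y : set 'M[K]_(r, s).

(* A is parametrized by d coordinates, so c0 and the d functions J satisfy a
   relation on A, which can be made not divisible by c0.  Setting c0 = 0 in it gives
   a non-trivial relation between the J i on every part of the closure of A where
   c0 vanishes. *)
Lemma not_dominant A B (phi : ('I_d -> K) -> 'M[K]_(r, s)) (c0 : 'M[K]_(r, s) -> K)
    (J : 'I_d -> 'M[K]_(r, s) -> K) :
  regular c0 -> (forall i, regular (J i)) ->
  (forall i j, mpolyfun (fun v => phi v i j)) ->
  (forall x, A x -> exists v, x = phi v) -> (forall x, A x -> c0 x != 0) ->
  (forall Y, zclosed Y -> A `<=` Y -> B `<=` Y) -> (forall x, B x -> c0 x = 0) ->
  ~ (forall t : 'I_d -> K, (forall i, t i != 0) ->
       exists2 x, B x & forall i, J i x = t i).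
Proof.
move=> rc0 rJ hphi Aphi Ac0 AB Bc0 dom.
pose F (i : 'I_d.+1) := if unlift ord0 i is Some i' then J i' else c0.
have rF i : regular (F i) by rewrite /F; case: (unlift _ _).
have /choice[Q hQ] : forall i, exists p : mpoly d K, forall v, F i (phi v) = meval v p.
  by move=> i; apply: (regular_comp (@mpolyfun_ring _ _) (rF i) hphi).
have [D [c [[al0 cal0] hc]]] := alg_dependence Q.
have [al1 cal1 min1] : exists2 al1, c al1 != 0 &
    forall al, c al != 0 -> (al1 ord0 <= al ord0)%N.
  exists [arg min_(al < al0 | c al != 0) (al ord0 : nat)]; by case: arg_minnP.
pose k0 : nat := al1 ord0.
pose G x := \sum_al c al * (c0 x ^+ (al ord0 - k0) *
  \prod_(i < d) J i x ^+ al (lift ord0 i)).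
have rG : regular G.
  have RR := @regular_ring K r s; have [Rc _ Rm] := RR.
  apply: (funring_sum RR) => al; apply: (Rm _ _ (Rc _)); apply: Rm.
    exact: (funring_exp RR).
  by apply: (funring_prod RR) => i; apply: (funring_exp RR).
have GA x : A x -> G x = 0.
  move=> Ax; have [v xv] := Aphi x Ax; have := Ac0 x Ax => x0.
  have h : c0 x ^+ k0 * G x = 0.
    rewrite /G mulr_sumr -[RHS](hc v); apply: eq_bigr => al _.
    have [->|cal] := eqVneq (c al) 0; first by rewrite !mul0r mulr0.
    rewrite mulrCA; congr (_ * _); rewrite mulrA -exprD subnKC ?min1 //.
    rewrite big_ord_recl -!hQ -xv /F unlift_none; congr (_ * _).
    by apply: eq_bigr => i _; rewrite -hQ -xv /F liftK.
  by move/eqP: h; rewrite mulf_eq0 expf_eq0 (negbTE x0) andbF /= => /eqP.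
have GB x : B x -> G x = 0.
  by apply: (AB [set x | G x = 0]) => //; apply: zclosed_regular.
(* Kronecker substitution: putting J i = u^(D^i) sends distinct exponent vectors to distinct powers
   of u, so the relation remaining at c0 = 0 becomes a polynomial in u that must vanish for all u !=
   0. *)
pose code (al : {ffun 'I_d.+1 -> 'I_D}) := (\sum_(i < d) al (lift ord0 i) * D ^ i)%N.
pose p : {poly K} := \sum_(al : {ffun 'I_d.+1 -> 'I_D} | al ord0 == k0 :> nat) c al *: 'X^(code al).
have p_roots u : u != 0 -> p.[u] = 0.
  move=> u0; have [|x Bx hx] := dom (fun i => u ^+ (D ^ i)).
    by move=> i; rewrite expf_neq0.
  rewrite -[RHS](GB x Bx) /G /p horner_sum big_mkcond /=; apply: eq_bigr => al _.
  rewrite (Bc0 x Bx); have [ak|ak] := eqVneq (al ord0 : nat) k0.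
    rewrite ak subnn expr0 mul1r hornerZ hornerXn; congr (_ * _).
    rewrite /code expr_sum; apply: eq_bigr => i _.
    by rewrite hx -exprM mulnC.
  have [->|cal] := eqVneq (c al) 0; first by rewrite mul0r.
  rewrite expr0n subn_eq0 leqNgt ltn_neqAle eq_sym ak min1 //=.
  by rewrite mul0r mulr0.
have p0 : p = 0.
  apply/eqP/negPn/negP => p0; have [|u] := @poly_nonroot _ (p * 'X).
    by rewrite mulf_neq0 // polyX_eq0.
  rewrite hornerM hornerX; have [->|u0] := eqVneq u 0; first by rewrite mulr0 eqxx.
  by rewrite p_roots // mul0r eqxx.
have : p`_(code al1) = c al1.
  rewrite /p coef_sum (bigD1 al1) //= coefZ coefXn eqxx mulr1 big1 ?addr0 //.
  move=> al /andP[/eqP ak ne]; rewrite coefZ coefXn; case: eqP => [E|]; last by rewrite mulr0.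
  case/negP: ne; apply/eqP/ffunP => i; apply: val_inj.
  case: (unliftP ord0 i) => [i'|] -> //=.
  pose dg (be : {ffun 'I_d.+1 -> 'I_D}) k : nat :=
    if insub k is Some k' then be (lift ord0 (k' : 'I_d)) else 0%N.
  have dgE be (k : 'I_d) : dg be k = be (lift ord0 k) by rewrite /dg valK.
  rewrite -!dgE; apply: (@digits_inj D d).
  - by move=> k kd; rewrite (dgE al (Ordinal kd)).
  - by move=> k kd; rewrite (dgE al1 (Ordinal kd)).
  - by under eq_bigr do rewrite dgE; under [RHS]eq_bigr do rewrite dgE.
  exact: ltn_ord.
by rewrite p0 coef0 => /esym/eqP; rewrite (negbTE cal1).
Qed.

End Dominance.

(** * The strata of the jet scheme *)

Section DenseCurves.
Variables (K : numFieldType) (r s : nat).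
Implicit Types A Z : set 'M[K]_(r, s).

Lemma curve_closure A (c : K -> 'M[K]_(r, s)) (q : {poly K}) Y : polycurve c -> q != 0 ->
  (forall u, q.[u] != 0 -> A (c u)) -> zclosed Y -> A `<=` Y -> Y (c 0).
Proof.
move=> hc q0 hA [P ->] sub p Pp.
have [|q1 hq1] := @regular_curve _ _ _ (fun x => meval (mxvec x ord0) p) c _ hc; first by exists p.
rewrite hq1; have [->|q10] := eqVneq q1 0; first by rewrite horner0.
have [|u] := @poly_nonroot _ (q1 * q); first by rewrite mulf_neq0.
rewrite hornerM mulf_eq0 negb_or => /andP[/eqP u1 u2].
by case: u1; rewrite -hq1; apply: sub => //; apply: hA.
Qed.

Lemma zirreducible_dense A Z : zirreducible A -> A `<=` Z ->
  (forall x Y, Z x -> zclosed Y -> A `<=` Y -> Y x) -> zirreducible Z.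
Proof.
move=> [[z Az] hA] AZ dense; split; first by exists z; apply: AZ.
move=> Y1 Y2 c1 c2 sub; have [x Ax|h|h] := hA Y1 Y2 c1 c2.
- by apply: sub; apply: AZ.
- by left=> x Zx; apply: dense h.
by right=> x Zx; apply: dense h.
Qed.

End DenseCurves.

Section JetFamilies.
Variables (K : numFieldType) (m : nat).

Lemma mkjet_funring T (P : (T -> K) -> Prop) (U V : T -> fps K) : ffunring P U ->
  ffunring P V -> forall i j, P (fun t => mkjet m (U t) (V t) i j).
Proof.
move=> hU hV i j; case: (ord2P i) => ->.
  by apply: funring_ext (hU j) => t; rewrite mxE eqxx.
by apply: funring_ext (hV j) => t; rewrite mxE.
Qed.

Lemma ffunring_line (x y : fps K) : ffunring (@polyfun K) (fun u => x + fpsC u * (y - x)).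
Proof.
have PR := polyfun_ring K; apply: (ffunringD PR); first exact: ffunring_cst.
apply: (ffunringM PR); last exact: ffunring_cst.
move=> n; case: n => [|n]; first exact: polyfun_id.
by case: PR => Pc _ _; apply: Pc.
Qed.

Definition jet_orders (N o : nat) : set (jet_space K m) :=
  [set x : jet_space K m | vge N (arc x ord0) /\ vge o (arc x ord_max)].

Lemma jet_orders_irr N o : zirreducible (jet_orders N o).
Proof.
apply: zirreducible_curves.
  exists (mkjet m 0 0); split; rewrite ?arc_mkjet0 ?arc_mkjet1 => k _;
  by rewrite fcoef_trunc fcoef0 if_same.
move=> x y [x0 x1] [y0 y1].
exists (fun u => mkjet m (arc x ord0 + fpsC u * (arc y ord0 - arc x ord0))
  (arc x ord_max + fpsC u * (arc y ord_max - arc x ord_max))), 1.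
split; rewrite ?oner_neq0 //.
- by move=> i j; apply: mkjet_funring; apply: ffunring_line.
- by rewrite (_ : fpsC 0 = 0) ?mul0r ?addr0 -?mkjet_arc // rmorph0.
- by rewrite (_ : fpsC 1 = 1) // !mul1r !subrKC -mkjet_arc.
move=> u _; split; rewrite ?arc_mkjet0 ?arc_mkjet1.
  move=> k kN; rewrite fcoef_trunc; case: ifP => // _.
  by apply: (vgeD x0 (vgeMr _ (vgeB y0 x0))).
move=> k kN; rewrite fcoef_trunc; case: ifP => // _.
by apply: (vgeD x1 (vgeMr _ (vgeB y1 x1))).
Qed.

End JetFamilies.

Section Strata.
Variables (K : numClosedFieldType) (f : bps K) (a : nat -> K) (g : nat).
Variables (beta : nat -> nat) (w : K) (m : nat).
Hypothesis H : puiseux_branch f a g beta w.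
Local Notation b := (beta 0).
Local Notation e := (gcd_seq beta).
Local Notation n := (ratio_n beta).
Local Notation M := (coindex beta).
Local Notation contact := (contact g beta).
Let b0 : (0 < b)%N. Proof. exact: ltnW (pb_b H). Qed.
Let e0 i : (0 < e i)%N. Proof. exact: gcd_seq_gt0. Qed.

Lemma contact_scale c kappa T : contact (c * kappa) (c * T) = (c * contact kappa T)%N.
Proof.
rewrite !(contactE H) mulnDr big_distrr /=; congr (_ + _)%N; apply: eq_bigr => l _.
by rewrite -mulnA -minnMr mulnCA.
Qed.

Lemma contact_leq kappa T : (contact kappa T <= b * T)%N.
Proof.
rewrite /contact /contact_sum -{2}(prednK b0) mulSn leq_add2l.
have -> : (b.-1 * T = \sum_(1 <= k < b) T)%N by rewrite sum_nat_const_nat subn1.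
by apply: leq_sum => k _; apply: geq_minl.
Qed.

(** Take i maximal along the chain of divisors n_1 ... n_i of N. If n_1 divides N the chain does not
    stop at 0. *)
Lemma level_ex N : (0 < N)%N -> exists i kappa,
  [/\ level_of g beta i kappa, N = (kappa * M i)%N & (n 1 %| N)%N -> (0 < i)%N].
Proof.
move=> N0; have g2 := pb_g H.
suff : forall l, (l <= g)%N -> (M l %| N)%N \/ exists i kappa,
    [/\ level_of g beta i kappa, N = (kappa * M i)%N & (n 1 %| N)%N -> (0 < i)%N].
  move=> /(_ g (leqnn g))[/dvdnP[kappa NE]|//]; exists g, kappa; split=> //; last by lia.
  split=> //; last by rewrite ltnn.
  by case: kappa NE N0 => // ->.
elim=> [_|l IH lg]; first by left; rewrite /coindex divnn b0 dvd1n.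
have [/dvdnP[kappa NE]|?] := IH (ltnW lg); last by right.
have k0 : (0 < kappa)%N by case: kappa NE N0 => // ->.
have E : (M l.+1 %| N)%N = (n l.+1 %| kappa)%N.
  by rewrite NE (coindexS b0) dvdn_pmul2r // coindex_gt0.
have [h|h] := boolP (n l.+1 %| kappa)%N; first by left; rewrite E.
right; exists l, kappa; split=> //; first by split=> //; apply: ltnW.
by case: (l) h NE => // /negP h ->; rewrite /M /coindex divnn b0 muln1.
Qed.

(** In the coordinates s and v - y(s), with y truncated, the stratum is given by linear conditions
    and one inequality, so two of its jets are joined by a line. *)
Lemma cont_eq_irr i kappa : level_of g beta i kappa -> feasible g beta m i kappa ->
  (kappa * M i <= m)%N -> zirreducible (cont_eq m f (kappa * M i)).
Proof.
move=> lv fe Nm; have [L [_ D]] := cont_eq_desc H lv fe Nm.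
pose yt := ytrunc a beta i (cutoff g beta m i).
apply: zirreducible_curves.
  exists (mkjet m ((fpsX K ^+ kappa) ^+ M i) (fcomp (fpsX K ^+ kappa) yt)).
  apply/D; exists (fpsX K ^+ kappa), (fcomp (fpsX K ^+ kappa) yt); split=> //.
    exact: ordeq_fpsX.
  by rewrite subrr.
move=> x x' /D[s [v [hs hv ->]]] /D[s' [v' [hs' hv' ->]]].
pose S u := s + fpsC u * (s' - s).
pose r := v - fcomp s yt; pose r' := v' - fcomp s' yt.
pose V u := fcomp (S u) yt + (r + fpsC u * (r' - r)).
have S0 : S 0 = s by rewrite /S (_ : fpsC 0 = 0) ?mul0r ?addr0 // rmorph0.
have S1 : S 1 = s' by rewrite /S (_ : fpsC 1 = 1) // mul1r subrKC.
exists (fun u => mkjet m (S u ^+ M i) (V u)),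
  (* The leading coefficient of [S u]; the curve lies in the stratum wherever it does not vanish. *)
  ((fcoef s kappa)%:P + (fcoef s' kappa - fcoef s kappa) *: 'X).
have PR := polyfun_ring K.
split.
- apply: mkjet_funring; first by apply: (ffunringX PR); apply: ffunring_line.
  apply: (ffunringD PR); last exact: ffunring_line.
  by apply: (ffunring_fcomp PR); apply: ffunring_line.
- by rewrite /V S0 (_ : fpsC 0 = 0) ?mul0r ?addr0 ?subrKC // rmorph0.
- by rewrite /V S1 (_ : fpsC 1 = 1) // mul1r !subrKC.
- apply/eqP => /(congr1 (horner^~ 0)); rewrite hornerD hornerC hornerZ hornerX mulr0.
  by rewrite addr0 horner0 => /eqP; case: hs => _ /negbTE ->.
move=> u; rewrite hornerD hornerC hornerZ hornerX => hu.
apply/D; exists (S u), (V u); split; last reflexivity.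
  split; last by rewrite fcoefD fcoefCM fcoefB mulrC.
  by apply: vgeD; [case: hs | apply: vgeMr; apply: vgeB; [case: hs' | case: hs]].
have -> : V u - fcomp (S u) yt = r + fpsC u * (r' - r).
  by rewrite /V addrAC subrr add0r.
exact: vgeD hv (vgeMr _ (vgeB hv' hv)).
Qed.

(** With ord x0 > m / beta_1 and ord x1 > m / b, a monomial of weight at least b beta_1 has order
    above m; f has no other monomials. *)
Lemma bsub_weight N o (u v : fps K) : (m < N * beta 1)%N -> (m < b * o)%N ->
  fcoef u 0 = 0 -> fcoef v 0 = 0 -> vge N u -> vge o v -> vge m.+1 (bsub u v f).
Proof.
move=> Nm om u0 v0 hu hv k km; rewrite -(bps_substE f u0 v0) fcoefF.
rewrite big1 // => i _; rewrite big1 // => j _.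
have [lt|ge] := ltnP (i * b + j * beta 1) (b * beta 1).
  by rewrite (pb_weight H lt) mul0r.
have hz : vge (N * i + o * j) (u ^+ i * v ^+ j) by apply: vgeM; apply: vgeX.
rewrite hz ?mulr0 //.
rewrite ltnNge; apply/negP => le.
have b10 : (0 < beta 1)%N by have := pb_b1 H; lia.
have h1 : (i * b * m.+1 <= i * b * (N * beta 1))%N by rewrite leq_mul2l Nm orbT.
have h2 : (j * beta 1 * m.+1 <= j * beta 1 * (b * o))%N by rewrite leq_mul2l om orbT.
have h3 : ((N * i + o * j) * (b * beta 1) <= m * (b * beta 1))%N.
  by rewrite leq_mul2r; apply/orP; right; lia.
have h4 : (b * beta 1 * m.+1 <= (i * b + j * beta 1) * m.+1)%N by rewrite leq_mul2r ge orbT.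
have h5 : (0 < b * beta 1)%N by rewrite muln_gt0 b0.
move: h5 h4 h3 h2 h1; rewrite !mulnDl !mulnS.
have -> : (N * i * (b * beta 1) = i * b * (N * beta 1))%N by ring.
have -> : (o * j * (b * beta 1) = j * beta 1 * (b * o))%N by ring.
have -> : (m * (b * beta 1) = b * beta 1 * m)%N by ring.
by lia.
Qed.

(** When ord x0 > m / beta_1, the truncation of y before beta_1 is zero, so the contact of x1 with
    every conjugate is measured by ord x1 itself, and f has order at most b ord x1. *)
Lemma jets_order_x1 x o : jets0 m f x ->
  (forall N, ordeq (arc x ord0) N -> (m < N * beta 1)%N) ->
  ordeq (arc x ord_max) o -> (m < b * o)%N.
Proof.
move=> /jets0P[u0 v0 hv] hN ho; rewrite ltnNge; apply/negP => om.
have g0 : (0 < g)%N by have := pb_g H; lia.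
have [N [s [N0 sN hs Ns]]] : exists N (s : fps K), [/\ (0 < N)%N, ordeq s N,
    vge m.+1 (bsub s (arc x ord_max) f) & (m < N * beta 1)%N].
  have [uz|/eqP/ordeq_ex[N uN]] := eqVneq (arc x ord0) 0; last first.
    exists N, (arc x ord0); split=> //; last exact: hN.
    by case: N uN => // -[_]; rewrite u0 eqxx.
  have b10 : (0 < beta 1)%N by have := pb_b1 H; lia.
  (* A zero x0 is replaced by t^(m+1), which has an order and gives the same jet. *)
  exists m.+1, (fpsX K ^+ m.+1); split; [by [] | exact: ordeq_fpsX | | by rewrite leq_pmulr].
    rewrite -(subrK (bsub (arc x ord0) (arc x ord_max) f) (bsub _ _ _)).
    apply: vgeD => //; apply: vge_bsubB; last by rewrite subrr.
    by rewrite uz subr0; apply: vge_fpsX.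
have cutP : forall l, (l < beta 1)%N -> a l != 0 -> (e 0 %| l)%N by move=> l; apply: (pb_supp H).
have yt0 : ytrunc a beta 0 (beta 1) = 0.
  by apply: fpsP => k; rewrite fcoefF; case: ifP => // /(pb_low H) ->.
apply: (level_lt H cutP N0 sN v0 (L := o)) => [|k|].
- exact: leq_ltn_trans om Ns.
- by rewrite yt0 rmorph0 subr0 => h; have := ordeq_le ho h; rewrite ltnn.
have -> : M 0 = 1%N by rewrite /coindex divnn b0.
rewrite expr1; apply: (@vgeW _ _ (e 0 * m.+1)).
  have := contact_leq N (e 0 * o); rewrite -[e 0]/b => h.
  rewrite mulnS; have : (b * (b * o) <= b * m)%N by rewrite leq_mul2l om orbT.
  lia.
exact: (vge_dil _ _ (e0 0)).1.
Qed.

End Strata.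

Lemma fcomp_lead (K : fieldType) (s c : fps K) (k n : nat) : (0 < k)%N -> vge k s ->
  vge n c -> fcoef (fcomp s c) (k * n) = fcoef c n * fcoef s k ^+ n.
Proof.
move=> k0 hs hc; rewrite [in LHS](fshiftK hc) rmorphM rmorphXn /= fcompX ftailE; last exact: hs.
rewrite -[X in fcoef _ X]addn0 fcoefM_lead //; last exact: vgeX.
by rewrite fcoefX_lead // fcomp0 fcoef_shift add0n mulrC.
Qed.

(** * Numerical comparison of the strata *)

Section Thresholds.
Variables (K : numClosedFieldType) (f : bps K) (a : nat -> K) (g : nat).
Variables (beta : nat -> nat) (w : K) (m : nat).
Hypothesis H : puiseux_branch f a g beta w.
Local Notation b := (beta 0).
Local Notation e := (gcd_seq beta).
Local Notation n := (ratio_n beta).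
Local Notation M := (coindex beta).
Local Notation contact := (contact g beta).
Local Notation m1 := (ratio_m beta 1).
Let b0 : (0 < b)%N. Proof. exact: ltnW (pb_b H). Qed.
Let e0 i : (0 < e i)%N. Proof. exact: gcd_seq_gt0. Qed.
Let g2 : (2 <= g)%N. Proof. exact: pb_g H. Qed.

Lemma n1e1 : (n 1 * e 1 = b)%N. Proof. exact: (ratio_nE beta 0). Qed.

Lemma m1e1 : (m1 * e 1 = beta 1)%N.
Proof. by rewrite /ratio_m divnK // gcd_seqS dvdn_gcdr. Qed.

Lemma n1_gt1 : (1 < n 1)%N.
Proof. by apply: (ratio_n_gt1 b0 (pb_ndvd H)); lia. Qed.

Lemma n1_lt_m1 : (n 1 < m1)%N.
Proof. by rewrite -(ltn_pmul2r (e0 1)) n1e1 m1e1; apply: (pb_b1 H). Qed.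

Lemma b_m1 k : (b * (m1 * k) = n 1 * k * beta 1)%N.
Proof. by rewrite -n1e1 -m1e1; ring. Qed.

(* The contribution to contact of the conjugates having contact above beta 1. *)
Definition high_contact (kappa T : nat) : nat :=
  (T + \sum_(2 <= l < g.+1) (e l.-1 - e l) * minn T (kappa * beta l))%N.

Lemma contact_split kappa T :
  contact kappa T = ((b - e 1) * minn T (kappa * beta 1) + high_contact kappa T)%N.
Proof.
have g1 : (1 < g.+1)%N by apply: leq_trans (pb_g H) _.
by rewrite (contactE H) (big_ltn g1) /high_contact addnCA.
Qed.

Let gap1 : (\sum_(2 <= l < g.+1) (e l.-1 - e l) = e 1 - 1)%N.
Proof. by rewrite (sum_gap b0 (pb_last H)) ?(pb_last H) //; lia. Qed.

(** The slope in T is at most 1 plus the sum of the gaps e_(l-1) - e_l for l >= 2, which is e_1. *)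
Lemma high_contact_lip kappa T t :
  (high_contact kappa (T + t) <= high_contact kappa T + e 1 * t)%N.
Proof.
rewrite /high_contact -(prednK (e0 1)) -subn1 -gap1 mulSn.
rewrite [X in (_ <= X)%N]addnACA leq_add2l big_distrl -big_split /=.
apply: leq_sum => l _; rewrite -mulnDr leq_mul2l.
by apply/orP; right; lia.
Qed.

Lemma high_contact_leq kappa T : (high_contact kappa T <= e 1 * T)%N.
Proof.
have := high_contact_lip kappa 0 T; rewrite add0n {2}/high_contact big1 ?add0n //.
by move=> l _; rewrite min0n muln0.
Qed.

Lemma high_contact_mono kappa kappa' T : (kappa <= kappa')%N ->
  (high_contact kappa T <= high_contact kappa' T)%N.
Proof.
move=> le; rewrite leq_add2l leq_sum // => l _; rewrite leq_mul2l.
by apply/orP; right; rewrite leq_min geq_minl geq_min leq_mul2r le !orbT.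
Qed.

Lemma high_contact_eq kappa T : (forall l, (2 <= l <= g)%N -> (T <= kappa * beta l)%N) ->
  high_contact kappa T = (e 1 * T)%N.
Proof.
move=> h; rewrite /high_contact big_nat.
rewrite (eq_bigr (fun l => (e l.-1 - e l) * T)%N) => [|l lg]; last first.
  by rewrite (minn_idPl _) ?h.
by rewrite -big_nat -big_distrl /= gap1 -mulSn subn1 prednK.
Qed.

(* L is the number of coefficients of x1 determined by x0 in Cont^N. *)
Definition threshold (N cut L : nat) : Prop :=
  [/\ (0 < L)%N, (b * L.-1 < N * cut)%N,
      (b * m.+1 <= contact N (minn (b * L) (N * cut)))%N &
      (contact N (b * L.-1) < b * m.+1)%N].

(** Multiplying the inequalities for L by [M i] removes the level: they involve only N and the
    common factor b, so strata of different levels become comparable. *)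
Lemma cont_desc N x0 : (0 < N)%N -> cont_eq m f N x0 -> exists i kappa L,
  [/\ level_of g beta i kappa, N = (kappa * M i)%N, (n 1 %| N)%N -> (0 < i)%N,
      threshold N (cutoff g beta m i) L & forall x, cont_eq m f N x <->
    exists s v : fps K, [/\ ordeq s kappa,
      vge L (v - fcomp s (ytrunc a beta i (cutoff g beta m i))) &
      x = mkjet m (s ^+ M i) v]].
Proof.
move=> N0 hx; have [i [kappa [lv NE i0]]] := level_ex H N0.
have Nm : (N <= m)%N by case/cont_eqP: hx => _; apply: ordeq_arc.
have fe : feasible g beta m i kappa.
  by apply: contrapT => nfe; apply: (cont_eq_empty H lv nfe (x := x0)); rewrite -NE.
have [|L [[L0 L1 L2 L3] D]] := cont_eq_desc H lv fe; first by rewrite -NE.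
exists i, kappa, L; split=> //; last by rewrite NE.
have Mi := coindex_gt0 b0 i.
have bE : b = (M i * e i)%N by rewrite coindexE.
have Nc : (N * cutoff g beta m i = M i * (kappa * cutoff g beta m i))%N by rewrite NE; ring.
split=> //.
- by rewrite Nc {1}bE -mulnA ltn_pmul2l.
- rewrite Nc (_ : (b * L = M i * (e i * L))%N); last by rewrite mulnA -bE.
  rewrite -minnMr NE [(kappa * M i)%N]mulnC (contact_scale H).
  by rewrite (_ : (b * m.+1 = M i * (e i * m.+1))%N) ?leq_pmul2l // mulnA -bE.
rewrite NE [(kappa * M i)%N]mulnC (_ : (b * L.-1 = M i * (e i * L.-1))%N); last by rewrite mulnA -bE.
rewrite (contact_scale H).
by rewrite (_ : (b * m.+1 = M i * (e i * m.+1))%N) ?ltn_pmul2l // mulnA -bE.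
Qed.

Lemma threshold_low k cut L : (n 1 * k * beta 1 <= m)%N ->
  threshold (n 1 * k) cut L -> (m1 * k < L)%N.
Proof.
move=> km [L0 _ h _]; rewrite ltnNge; apply/negP => le.
have := leq_trans h (contact_leq H _ _); rewrite leq_pmul2l // => h2.
have : (minn (b * L) (n 1 * k * cut) <= b * (m1 * k))%N by rewrite geq_min leq_mul2l le orbT.
by rewrite b_m1; lia.
Qed.

(** Here N + L is the number of conditions defining a stratum. Raising k to k' adds n_1 (k' - k)
    conditions on x0, but the b - e_1 conjugates of contact beta_1 gain so much that L drops by at
    least (n_1 - 1) m_1 (k' - k), which is larger because 2 <= n_1 < m_1. *)
Lemma threshold_codim k k' cut cut' L L' : (k < k')%N -> (n 1 * k' * beta 1 <= m)%N ->
  threshold (n 1 * k) cut L -> threshold (n 1 * k') cut' L' ->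
  (n 1 * k' + L' <= n 1 * k + L)%N.
Proof.
move=> kk' km h h'; have lo := threshold_low km h'.
case: h h' => [_ _ h _] [L'0 _ _ h'].
have {}h := leq_trans h (leq_contact H _ (geq_minl _ _)).
move: h h'; rewrite !contact_split.
have -> : minn (b * L'.-1) (n 1 * k' * beta 1) = (b * (m1 * k'))%N.
  by rewrite -b_m1; apply/minn_idPr; rewrite leq_mul2l; apply/orP; right; lia.
have h1 : ((b - e 1) * minn (b * L) (n 1 * k * beta 1) <= (b - e 1) * (b * (m1 * k)))%N.
  by rewrite leq_mul2l -b_m1 geq_minr orbT.
have h2 := high_contact_mono (b * L) (leq_mul (leqnn (n 1)) (ltnW kk')).
move=> h3 h4.
have [LL|LL] := leqP L L'.-1.
  exfalso; have h5 : (high_contact (n 1 * k') (b * L) <= high_contact (n 1 * k') (b * L'.-1))%N.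
    by apply: leq_add; [rewrite leq_mul2l LL orbT | apply: leq_sum => l _;
       rewrite leq_mul2l leq_min !geq_min leq_mul2l LL leqnn !orbT].
  have : ((b - e 1) * (b * (m1 * k)) <= (b - e 1) * (b * (m1 * k')))%N.
    by rewrite !leq_mul2l (ltnW kk') !orbT.
  lia.
have h5 := high_contact_lip (n 1 * k') (b * L'.-1) (b * (L - L'.-1)).
rewrite -mulnDr subnKC in h5; last exact: ltnW.
have h6 : ((b - e 1) * (b * (m1 * k')) < (b - e 1) * (b * (m1 * k)) + e 1 * (b * (L - L'.-1)))%N.
  lia.
have bE : (b - e 1 = e 1 * (n 1 - 1))%N by rewrite mulnBr muln1 mulnC n1e1.
move: h6; rewrite bE.
have -> : (e 1 * (n 1 - 1) * (b * (m1 * k')) = e 1 * b * ((n 1 - 1) * m1 * k'))%N by ring.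
have -> : (e 1 * (n 1 - 1) * (b * (m1 * k)) = e 1 * b * ((n 1 - 1) * m1 * k))%N by ring.
rewrite [(e 1 * (b * (L - _)))%N]mulnA -mulnDr ltn_pmul2l ?muln_gt0 ?e0 // => h6.
have := n1_lt_m1; have := n1_gt1; move: (n 1) (m1) h6 => N1 M1 h6 N2 NM.
have h7 : (N1 * (k' - k) <= (N1 - 1) * M1 * (k' - k))%N.
  rewrite leq_mul2r; apply/orP; right.
  by apply: leq_trans (ltnW NM) _; apply: leq_pmull; lia.
have h8 : ((N1 - 1) * M1 * k' = (N1 - 1) * M1 * k + (N1 - 1) * M1 * (k' - k))%N.
  by rewrite -mulnDr subnKC // ltnW.
have h9 : (N1 * k' = N1 * k + N1 * (k' - k))%N by rewrite -mulnDr subnKC // ltnW.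
lia.
Qed.

(** The left side is the number of equations of the linear space contained in B_m. Dividing by e_1
    reduces the claim to an estimate with n_1, m_1 and mu = m / e_1. *)
Lemma threshold_codim_lin k q cut L : (k <= q)%N -> (n 1 * q * beta 1 + e 1 <= m)%N ->
  threshold (n 1 * k) cut L ->
  ((m %/ beta 1).+1 + (m %/ b).+1 <= n 1 * k + L)%N.
Proof.
move=> kq qm [_ _ h _].
have {}h := leq_trans h (leq_contact H _ (geq_minl _ _)).
move: h; rewrite contact_split.
have h1 : ((b - e 1) * minn (b * L) (n 1 * k * beta 1) <= (b - e 1) * (b * (m1 * k)))%N.
  by rewrite leq_mul2l -b_m1 geq_minr orbT.
have h2 := high_contact_leq (n 1 * k) (b * L).
move=> h3; have {h1 h2 h3} h : (b * m.+1 <= (b - e 1) * (b * (m1 * k)) + e 1 * (b * L))%N by lia.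
have bE : (b - e 1 = e 1 * (n 1 - 1))%N by rewrite mulnBr muln1 mulnC n1e1.
move: h; have -> : ((b - e 1) * (b * (m1 * k)) + e 1 * (b * L) =
    b * (e 1 * ((n 1 - 1) * m1 * k + L)))%N by rewrite bE; ring.
rewrite leq_pmul2l // => h.
have {h} h : (m %/ e 1 < (n 1 - 1) * m1 * k + L)%N by rewrite ltn_divLR // mulnC.
have qm' : (n 1 * m1 * q + 1 <= m %/ e 1)%N.
  by rewrite leq_divRL // mulnDl mul1n; apply: leq_trans qm; rewrite -m1e1; lia.
have -> : (m %/ beta 1 = m %/ e 1 %/ m1)%N by rewrite -divnMA mulnC m1e1.
have -> : (m %/ b = m %/ e 1 %/ n 1)%N by rewrite -divnMA mulnC n1e1.
have := n1_lt_m1; have := n1_gt1; move: (n 1) (m1) (m %/ e 1)%N h qm' => N1 M1 mu h qmu N2 NM.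
(* The summand e_1 in the lower bound for m makes mu exceed k n_1 m_1 by at least 1. With 0 in place
   of [nu.+1], the inequality [d5] would fail. *)
have [nu muE] : exists nu, mu = (k * (N1 * M1) + nu.+1)%N.
  exists (mu - k * (N1 * M1)).-1; have : (N1 * M1 * k <= N1 * M1 * q)%N by rewrite leq_mul2l kq orbT.
  lia.
have d1 : (mu %/ M1 = k * N1 + nu.+1 %/ M1)%N by rewrite muE mulnA divnMDl //; lia.
have d2 : (mu %/ N1 = k * M1 + nu.+1 %/ N1)%N.
  by rewrite muE [(N1 * M1)%N]mulnC mulnA divnMDl //; lia.
(* The worst case of n_1 >= 2, m_1 >= 3. *)
have d3 : (nu.+1 %/ M1 <= nu.+1 %/ 3)%N by apply: leq_div2l => //; apply: leq_trans NM.
have d4 : (nu.+1 %/ N1 <= nu.+1 %/ 2)%N by apply: leq_div2l.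
have d5 : (nu.+1 %/ 3 + nu.+1 %/ 2 + 1 <= nu.+1)%N by clear; lia.
have d6 : ((N1 - 1) * M1 * k + M1 * k = k * (N1 * M1))%N.
  by rewrite -mulnDl addnC -mulSn subn1 prednK 1?mulnC // ltnW.
rewrite d1 d2; move: (nu.+1 %/ M1)%N (nu.+1 %/ N1)%N (nu.+1 %/ 3)%N (nu.+1 %/ 2)%N d3 d4 d5 => x1 x2 x3 x4 d3 d4 d5.
move: muE h d6; clear -d3 d4 d5; lia.
Qed.

(** At contact T = b (m_1 k + 1) the order of f, scaled by b, is already b (N beta_1 + e_1), hence
    above b m. So x1 is constrained only up to its coefficient of index m_1 k. *)
Lemma threshold_high k i kappa L : (0 < i)%N -> (i <= g)%N ->
  (n 1 * k = kappa * M i)%N -> (0 < kappa)%N ->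
  (m < n 1 * k * beta 1 + e 1)%N -> threshold (n 1 * k) (cutoff g beta m i) L ->
  (L <= (m1 * k).+1)%N.
Proof.
move=> i0 ig NE k0 mk [L0 Lc _ h]; rewrite leqNgt; apply/negP => lt.
pose N := (n 1 * k)%N; pose T := (b * (m1 * k).+1)%N.
have TL : (T <= b * L.-1)%N by rewrite leq_mul2l; apply/orP; right; lia.
(* Here T = N beta_1 + b. For l > i the cutoff bounds T; for l <= i the difference beta_l - beta_1
   is a positive multiple of e_l and N e_l >= b. *)
have hT l : (2 <= l <= g)%N -> (T <= N * beta l)%N.
  move=> lg; have [il|li] := ltnP i l.
    have ig' : (i < g)%N by lia.
    move: Lc; rewrite /cutoff ig' => Lc.
    apply: leq_trans TL (leq_trans (ltnW Lc) _); rewrite leq_mul2l; apply/orP; right.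
    by apply: (beta_mono b0 (pb_last H) (pb_inc H)) => //; lia.
  have lt1 : (beta 1 < beta l)%N.
    apply: leq_trans (pb_inc H (_ : 1 <= 1 < g)%N) _; first lia.
    by apply: (beta_mono b0 (pb_last H) (pb_inc H)) => //; lia.
  have /dvdnP[c hc] : (e l %| beta l - beta 1)%N.
    by apply: dvdn_sub; apply: gcd_seq_dvd_beta; lia.
  have c0 : (0 < c)%N by case: c hc => //; lia.
  have el : (e i <= e l)%N by apply: dvdn_leq => //; apply: gcd_seq_dvd.
  rewrite /T mulnS b_m1 -/N -(subnKC (ltnW lt1)) mulnDr addnC leq_add2l hc /N NE.
  rewrite -(coindexE beta i) -mulnA mulnA -mulnA mulnCA leq_mul2l; apply/orP; right.
  by rewrite -{1}(mul1n (e i)) leq_mul // -{1}(mul1n (e i)) leq_mul.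
have := leq_ltn_trans (leq_contact H _ TL) h.
rewrite contact_split (high_contact_eq hT) (minn_idPr _); last first.
  by rewrite -/N /T mulnS b_m1 leq_addl.
rewrite -b_m1 /T; have bE : (b = e 1 + (b - e 1))%N.
  by rewrite subnKC // -n1e1 leq_pmull // ltnW // n1_gt1.
move: mk; rewrite -b_m1 => mk.
have : (b * m.+1 <= b * (b * (m1 * k) + e 1))%N by rewrite leq_mul2l mk orbT.
have -> : (b * (b * (m1 * k) + e 1) = (b - e 1) * (b * (m1 * k)) + e 1 * (b * (m1 * k).+1))%N.
  have hX : (b * (b * (m1 * k)) = e 1 * (b * (m1 * k)) + (b - e 1) * (b * (m1 * k)))%N.
    by rewrite -mulnDl -bE.
  by rewrite mulnDr hX [(b * (m1 * k).+1)%N]mulnS mulnDr [(b * e 1)%N]mulnC; ring.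
by lia.
Qed.

End Thresholds.

(** * The residual set B_m and its irreducibility *)

Section Stratification.
Variables (K : numClosedFieldType) (f : bps K) (a : nat -> K) (g : nat).
Variables (beta : nat -> nat) (w : K) (m : nat).
Hypothesis H : puiseux_branch f a g beta w.
Local Notation b := (beta 0).
Local Notation e := (gcd_seq beta).
Local Notation n := (ratio_n beta).
Local Notation M := (coindex beta).
Local Notation m1 := (ratio_m beta 1).
Let b0 : (0 < b)%N. Proof. exact: ltnW (pb_b H). Qed.
Let e0 i : (0 < e i)%N. Proof. exact: gcd_seq_gt0. Qed.
Let b10 : (0 < beta 1)%N. Proof. exact: leq_ltn_trans (leq0n _) (pb_b1 H). Qed.
Let e1b1 : (e 1 <= beta 1)%N.
Proof. by apply: dvdn_leq => //; apply: gcd_seq_dvd_beta. Qed.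
Let n10 : (0 < n 1)%N. Proof. exact: ltnW (n1_gt1 H). Qed.

Lemma cont_eq_gt0 N x : cont_eq m f N x -> (0 < N)%N.
Proof.
by move=> /cont_eqP[/jets0P[u0 _ _] [_ h]]; case: N h => //; rewrite u0 eqxx.
Qed.

(** If n_1 does not divide N, then N has level 0 with kappa = N, and the stratum is empty as soon as
    N betab_1 = N beta_1 <= m. *)
Lemma cont_eq_dvd N x : cont_eq m f N x -> (N * beta 1 <= m)%N -> (n 1 %| N)%N.
Proof.
move=> hx Nm; apply/negPn/negP => nN.
have lv : level_of g beta 0 N by split=> //; apply: cont_eq_gt0 hx.
have M0 : M 0 = 1%N by rewrite /coindex divnn b0.
apply: (cont_eq_empty H lv (m := m) (x := x)); last by rewrite M0 muln1.
have g0 : (0 < g)%N by apply: leq_trans (pb_g H).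
by move=> /(_ g0); rewrite ltnNge Nm.
Qed.

(** The jets on which every monomial allowed by the Newton polygon of f vanishes modulo t^(m+1) for
    reasons of order alone. *)
Definition Lin := @jet_orders K m (m %/ beta 1).+1 (m %/ b).+1.

Section Residual.
Variable q : nat.
Hypothesis qm : (n 1 * q * beta 1 <= m)%N.
Hypothesis mq : (m < n 1 * q.+1 * beta 1 + e 1)%N.

Lemma Lin_sub : Lin `<=` cont_gt m f (n 1 * q).
Proof.
move=> x [hu hv]; apply/cont_gtP; split; last first.
  by apply: vgeW hu; rewrite ltnS leq_divRL.
have u0 := hu 0%N isT; have v0 := hv 0%N isT.
apply/jets0P; split=> //; apply: (bsub_weight H _ _ u0 v0 hu hv).
  exact: ltn_ceil.
by rewrite mulnC; apply: ltn_ceil.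
Qed.

(** An order N of x0 with N beta_1 <= m is a multiple of n_1, and the upper bound on m leaves only
    n_1 (q+1); all other jets satisfy both order conditions of [Lin]. *)
Lemma cont_gt_cover x : cont_gt m f (n 1 * q) x ->
  Lin x \/ ((n 1 * q.+1 * beta 1 <= m)%N /\ cont_eq m f (n 1 * q.+1) x).
Proof.
move=> /cont_gtP[jx hu].
have [[N [uN Nm]]|nN] := pselect (exists N, ordeq (arc x ord0) N /\ (N * beta 1 <= m)%N).
  right; have cx : cont_eq m f N x by apply/cont_eqP.
  have /dvdnP[k NE] := cont_eq_dvd cx Nm.
  have lo := ordeq_le uN hu.
  suff kq : k = q.+1 by rewrite (_ : (n 1 * q.+1 = N)%N) // NE kq mulnC.
  have kq : (q < k)%N by rewrite NE mulnC ltn_pmul2r in lo.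
  apply/eqP; rewrite eqn_leq kq andbT leqNgt; apply/negP => lt.
  have : (n 1 * q.+2 * beta 1 <= m)%N.
    by apply: leq_trans Nm; rewrite NE [(k * _)%N]mulnC leq_mul2r leq_mul2l lt !orbT.
  have : (n 1 * q.+1 * beta 1 + e 1 <= n 1 * q.+2 * beta 1)%N.
    rewrite [(n 1 * q.+2)%N]mulnS mulnDl [X in (_ <= X)%N]addnC leq_add2l.
    by apply: leq_trans e1b1 _; apply: leq_pmull.
  by move=> h1 h2; have := leq_trans h1 h2; rewrite leqNgt mq.
have {}nN N : ordeq (arc x ord0) N -> (m < N * beta 1)%N.
  by move=> uN; rewrite ltnNge; apply/negP => Nm; apply: nN; exists N.
left; split.
  have [->|/eqP/ordeq_ex[N uN]] := eqVneq (arc x ord0) 0; first exact: vgez.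
  by case: (uN) => h _; apply: vgeW h; rewrite ltn_divLR // nN.
have [->|/eqP/ordeq_ex[o vo]] := eqVneq (arc x ord_max) 0; first exact: vgez.
case: (vo) => h _; apply: vgeW h; rewrite ltn_divLR // mulnC.
exact: (jets_order_x1 H jx nN vo).
Qed.

Lemma cont_eq_sub_gt : cont_eq m f (n 1 * q.+1) `<=` cont_gt m f (n 1 * q).
Proof.
move=> x /cont_eqP[jx [h _]]; apply/cont_gtP; split=> //.
by apply: vgeW h; rewrite ltn_pmul2l.
Qed.

(** Either the set is the linear space [Lin], or Cont^(n_1 (q+1)) is non-empty and dense in it. *)
Lemma cont_gt_irr : zirreducible (cont_gt m f (n 1 * q)).
Proof.
have [[km [x0 hx0]]|nA] :=
  pselect ((n 1 * q.+1 * beta 1 <= m)%N /\ exists x, cont_eq m f (n 1 * q.+1) x); last first.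
  have -> : cont_gt m f (n 1 * q) = Lin; last exact: jet_orders_irr.
  apply/seteqP; split; last exact: Lin_sub.
  by move=> x /cont_gt_cover[//|[h1 h2]]; case: nA; split=> //; exists x.
set N := (n 1 * q.+1)%N; have N0 : (0 < N)%N by rewrite muln_gt0 n10.
have [i [kappa [L [lv NE i0 thr D]]]] := cont_desc H N0 hx0.
have {}i0 : (0 < i)%N by apply: i0; apply: dvdn_mulr.
have [ig k0 _] := lv.
have LE := threshold_high H i0 ig NE k0 mq thr.
apply: (@zirreducible_dense _ _ _ (cont_eq m f N)); last 1 first.
- move=> x Y /cont_gt_cover[|[_ Ax] _ sub]; last exact: sub.
  move=> [hu hv] cY sub.
  pose p := (beta 1 %/ e i)%N.
  have pE : (p * e i = beta 1)%N.
    by rewrite divnK //; apply: dvdn_trans (gcd_seq_dvd beta i0) (gcd_seq_dvd_beta beta (leqnn 1)).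
  have kp : (kappa * p = m1 * q.+1)%N.
    apply/eqP; rewrite -(eqn_pmul2l b0) (b_m1 beta) -/N NE -pE.
    by rewrite -{1}(coindexE beta i); apply/eqP; ring.
  have p0 : (0 < p)%N by rewrite lt0n; apply/eqP => p00; have := b10; rewrite -pE p00 mul0n.
  have Mi := coindex_gt0 b0 i.
  have N1 : (N < (m %/ beta 1).+1)%N by rewrite ltnS leq_divRL.
  have o1 : (m1 * q.+1 < (m %/ b).+1)%N by rewrite ltnS leq_divRL // mulnC (b_m1 beta).
  (* A curve through the given jet at t = 0 that lies in the stratum for t != 0: s is to have
     leading coefficient t, so x0 gets t^(M i) at index N and x1 gets a_(beta_1) t^p at index m_1
     (q+1) = kappa p. By [LE] no further coefficient is constrained. *)
  pose U t := fpsC (t ^+ M i) * fpsX K ^+ N + arc x ord0.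
  pose V t := fpsC (a (beta 1) * t ^+ p) * fpsX K ^+ (m1 * q.+1) + arc x ord_max.
  have -> : x = mkjet m (U 0) (V 0).
    rewrite /U /V !expr0n !eqn0Ngt Mi p0 mulr0 (_ : fpsC 0 = 0) ?rmorph0 //.
    by rewrite !mul0r !add0r; apply: mkjet_arc.
  have PR := polyfun_ring K; have [Pc _ Pm] := PR.
  have mono (c : K) j k : ffunring (@polyfun K) (fun t => fpsC (c * t ^+ j) * fpsX K ^+ k).
    apply: (ffunringM PR); last exact: ffunring_cst.
    case=> [|l]; last exact: Pc.
    by apply: Pm => //; apply: (funring_exp PR); apply: polyfun_id.
  apply: (@curve_closure _ _ _ (cont_eq m f N) (fun t => mkjet m (U t) (V t)) 'X) => //.
  + apply: mkjet_funring; apply: (ffunringD PR); try exact: ffunring_cst.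
      by move=> l; apply: funring_ext (mono 1 (M i) N l) => t; rewrite mul1r.
    exact: mono.
  + by rewrite polyX_eq0.
  move=> t; rewrite hornerX => t0.
  have Uc : fcoef (U t) N = t ^+ M i.
    by rewrite fcoefD fcoefCM fcoefXn eqxx mulr1 hu // addr0.
  have Uo : ordeq (U t) (kappa * M i).
    rewrite -NE; split; last by rewrite Uc expf_neq0.
    by apply: vgeD; [apply: vgeMr; apply: vge_fpsX | apply: vgeW hu; apply: ltnW].
  have [|s [hs sE sk]] := ordeq_root_lead Mi Uo (c := t); first by rewrite -NE Uc.
  apply/D; exists s, (V t); split=> //; last by rewrite sE.
  have ytv : vge p (ytrunc a beta i (cutoff g beta m i)).
    move=> l lp; rewrite fcoefF; case: ifP => // _; apply: (pb_low H).
    by rewrite -pE ltn_pmul2r.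
  have ytp : fcoef (ytrunc a beta i (cutoff g beta m i)) p = a (beta 1).
    rewrite fcoefF pE; case: ifP => //; rewrite /cutoff; case: ifP => [ig'|_] /negP[].
      by apply: (leq_trans (pb_inc H (_ : 1 <= 1 < g)%N)); [lia |
         apply: (beta_mono b0 (pb_last H) (pb_inc H)) => //; lia].
    by rewrite ltnS; apply: leq_trans km; apply: leq_pmull; rewrite muln_gt0 n10.
  apply: (vgeW LE); have sv : vge kappa s by case: hs.
  move=> l; rewrite ltnS leq_eqVlt => /orP[/eqP ->|lt].
    rewrite fcoefB fcoefD fcoefCM fcoefXn eqxx mulr1 hv // addr0.
    by rewrite -kp (fcomp_lead k0 sv ytv) ytp sk subrr.
  rewrite fcoefB fcoefD fcoefCM fcoefXn ltn_eqF // mulr0 add0r hv ?sub0r; last exact: ltn_trans lt o1.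
  by rewrite (vge_fcomp k0 sv ytv) ?oppr0 // kp.
- by rewrite {1}NE; apply: (cont_eq_irr H lv); [
    apply: contrapT => nfe; apply: (cont_eq_empty H lv nfe (x := x0)); rewrite -NE |
    rewrite -NE; case/cont_eqP: hx0 => _; apply: ordeq_arc].
exact: cont_eq_sub_gt.
Qed.

End Residual.
End Stratification.

(** Factor the difference of powers: each of the n terms of the cofactor has order at least k (n -
    1). *)
Lemma vgeBX_gain (R : comNzRingType) (s s' : fps R) h k n : (0 < n)%N ->
  vge h (s - s') -> vge k s -> vge k s' -> vge (h + k * n.-1) (s ^+ n - s' ^+ n).
Proof.
move=> n0 hs ks ks'; rewrite subrXX; apply: vgeM => //; apply: vge_sum => i _.
apply: vgeW (vgeM (@vgeX _ _ _ (n.-1 - i) ks) (@vgeX _ _ _ i ks')).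
by rewrite -mulnDr leq_mul2l; apply/orP; right; have := ltn_ord i; lia.
Qed.

Lemma vge_fcompB_gain (K : fieldType) (s s' c : fps K) h k n : (0 < k)%N -> (0 < n)%N ->
  vge h (s - s') -> vge k s -> vge k s' -> vge n c ->
  vge (h + k * n.-1) (fcomp s c - fcomp s' c).
Proof.
move=> k0 n0 hs ks ks' nc.
rewrite (fshiftK nc) !rmorphM !rmorphXn /= !fcompX (ftailE (ks 0%N k0)) (ftailE (ks' 0%N k0)).
set c' := fshift n c; rewrite -(subrKA (s' ^+ n * fcomp s c')) -mulrBl -mulrBr.
apply: vgeD; first by apply: vgeMl; apply: vgeBX_gain.
rewrite addnC; apply: vgeM.
  by apply: vgeW (@vgeX _ _ _ n ks'); rewrite leq_mul2l leq_pred orbT.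
by apply: vge_fevalB => // d; rewrite subrr.
Qed.

(** * No larger stratum lies in the closure of a smaller one *)

Section Inclusions.
Variables (K : numClosedFieldType) (f : bps K) (a : nat -> K) (g : nat).
Variables (beta : nat -> nat) (w : K) (m : nat).
Hypothesis H : puiseux_branch f a g beta w.
Local Notation b := (beta 0).
Local Notation e := (gcd_seq beta).
Local Notation n := (ratio_n beta).
Local Notation M := (coindex beta).
Let b0 : (0 < b)%N. Proof. exact: ltnW (pb_b H). Qed.
Let e0 i : (0 < e i)%N. Proof. exact: gcd_seq_gt0. Qed.
Let b10 : (0 < beta 1)%N. Proof. exact: leq_ltn_trans (leq0n _) (pb_b1 H). Qed.
Let n10 : (0 < n 1)%N. Proof. exact: ltnW (n1_gt1 H). Qed.

Lemma cont_eq_coef N x : cont_eq m f N x -> x ord0 (inord N) != 0.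
Proof.
by move=> /cont_eqP[_ h]; have Nm := ordeq_arc h; case: h => _; rewrite fcoefF Nm.
Qed.

(** Default z outside the range: 0 for missing coefficients, 1 where a non-zero value must be
    prescribed. *)
Let ext (d : nat) (z : K) (v : 'I_d -> K) (k : nat) : K :=
  if insub k is Some i then v i else z.

Let extE d z (v : 'I_d -> K) (i : 'I_d) : ext z v i = v i.
Proof. by rewrite /ext valK. Qed.

(** The stratum has (m+1-N) + (m+1-L) parameters and B at least as many free coordinates, while the
    leading coefficient of x0 vanishes on B; [not_dominant] forbids this inside the closure. *)
Lemma closure_not_sub i kappa L (B : set (jet_space K m)) N' L' : (0 < kappa)%N ->
  (kappa * M i <= m)%N -> (L <= m.+1)%N ->
  (forall x, cont_eq m f (kappa * M i) x -> exists s v : fps K, [/\ ordeq s kappa,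
      vge L (v - fcomp s (ytrunc a beta i (cutoff g beta m i))) &
      x = mkjet m (s ^+ M i) v]) ->
  (N' <= m.+1)%N -> (L' <= m.+1)%N -> (N' + L' <= kappa * M i + L)%N ->
  (forall x, B x -> x ord0 (inord (kappa * M i)) = 0) ->
  (forall tu tv : nat -> K, (forall k, tu k != 0) -> (forall k, tv k != 0) ->
    exists x, [/\ B x, forall k, (N' <= k <= m)%N -> x ord0 (inord k) = tu k &
      forall k, (L' <= k <= m)%N -> x ord_max (inord k) = tv k]) ->
  ~ (B `<=` cont_closure m f (kappa * M i)).
Proof.
set N := (kappa * M i)%N => k0 Nm Lm D Nm' Lm' NL B0 dens sub.
pose yt := ytrunc a beta i (cutoff g beta m i).
pose d1 := (m.+1 - N)%N; pose d := (d1 + (m.+1 - L))%N.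
have Mi := coindex_gt0 b0 i.
(* Exponents of y are at least beta_1 > b = M i e_i; this order makes the composite y(s) as
   insensitive to the tail of s as s^(M i) is. *)
have ytM : vge (M i) yt.
  move=> k kM; rewrite fcoefF; case: ifP => // _; apply: (pb_low H).
  by apply: leq_trans (pb_b1 H); rewrite ltnW // ltnS -(coindexE beta i) ltn_pmul2r.
pose S (v : 'I_d -> K) : fps K := FPS (fun k =>
  if (kappa <= k < kappa + d1)%N then ext 0 v (k - kappa) else 0).
pose V (v : 'I_d -> K) : fps K := FPS (fun k =>
  if (L <= k <= m)%N then ext 0 v (d1 + (k - L)) else 0).
pose phi v := mkjet m (S v ^+ M i) (ftrunc L (fcomp (S v) yt) + V v).
pose d1' := (m.+1 - N')%N.
pose J (j : 'I_d) (x : jet_space K m) := if (j < d1')%N then x ord0 (inord (N' + j))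
  else x ord_max (inord (L' + (j - d1'))).
have RM := @mpolyfun_ring K d; have [Mc _ _] := RM.
have extP z k : mpolyfun (fun v : 'I_d -> K => ext z v k).
  by rewrite /ext; case: (insub k) => [j|]; [apply: mpolyfun_coord | apply: Mc].
apply: (@not_dominant K 2 m.+1 d (cont_eq m f N) B phi (fun x => x ord0 (inord N)) J).
- exact: regular_coord.
- by move=> j; rewrite /J; case: (j < d1')%N; apply: regular_coord.
- have hS : ffunring (@mpolyfun K d) S.
    move=> k; rewrite /S; case E : (kappa <= k < kappa + d1)%N.
      by apply: funring_ext (extP 0 (k - kappa)%N) => v; rewrite fcoefF E.
    by apply: funring_ext (Mc 0) => v; rewrite fcoefF E.
  have hV : ffunring (@mpolyfun K d) V.
    move=> k; rewrite /V; case E : (L <= k <= m)%N.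
      by apply: funring_ext (extP 0 (d1 + (k - L))%N) => v; rewrite fcoefF E.
    by apply: funring_ext (Mc 0) => v; rewrite fcoefF E.
  apply: mkjet_funring; first exact: (ffunringX RM).
  by apply: (ffunringD RM) => //; apply: (ffunring_trunc RM); apply: (ffunring_fcomp RM).
- move=> x /D[s [v [hs hv ->]]].
  pose t (j : 'I_d) := if (j < d1)%N then fcoef s (kappa + j) else fcoef v (L + (j - d1)).
  have tS k : (k < d1)%N -> ext 0 t k = fcoef s (kappa + k).
    move=> kd; have kd' : (k < d)%N by rewrite /d; lia.
    by rewrite (extE 0 t (Ordinal kd')) /t /= kd.
  have tV k : (L <= k <= m)%N -> ext 0 t (d1 + (k - L)) = fcoef v k.
    move=> kd; have kd' : (d1 + (k - L) < d)%N by rewrite /d; lia.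
    rewrite (extE 0 t (Ordinal kd')) /t /= ltnNge leq_addr /= addKn subnKC //; lia.
  have ks : vge kappa s by case: hs.
  have kS : vge kappa (S t).
    by move=> k kk; rewrite fcoefF leqNgt kk.
  have hSs : vge (kappa + d1) (s - S t).
    apply/vgeBP => k kk; rewrite fcoefF kk andbT; case: leqP => [le|lt]; last exact: ks.
    by rewrite tS; [rewrite subnKC | lia].
  (* Altering s beyond its first [d1] relevant coefficients changes s^(M i) and y(s) only from index
     m+1 on, thanks to the gain kappa (M i - 1). *)
  have pw : (kappa + d1 + kappa * (M i).-1 = m.+1)%N.
    by rewrite addnAC -mulnS prednK // -/N subnKC // ltnW.
  exists t; apply: eq_mkjet2; first by rewrite -pw; apply: vgeBX_gain.
  have hc : vge m.+1 (fcomp s yt - fcomp (S t) yt).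
    by rewrite -pw; apply: vge_fcompB_gain.
  apply/vgeBP => k km; rewrite fcoefD fcoef_trunc.
  have -> : fcoef (V t) k = if (L <= k)%N then ext 0 t (d1 + (k - L)) else 0.
    by have km' : (k <= m)%N := km; rewrite /V fcoefF km' andbT.
  case: (ltnP k L) => kL; last by rewrite add0r tV // kL -ltnS.
  rewrite addr0; move/vgeBP: hv => hv; move/vgeBP: hc => hc.
  exact: etrans (hv _ kL) (hc _ km).
- exact: cont_eq_coef.
- by move=> Y cY AY x /sub[_]; apply.
- exact: B0.
move=> t t0; pose tu k := ext 1 t (k - N'); pose tv k := ext 1 t (d1' + (k - L')).
have ext0 k : ext 1 t k != 0.
  by rewrite /ext; case: (insub k) => [j|]; [apply: t0 | apply: oner_neq0].
have [|//|x [Bx hu hv]] := dens tu tv; first by move=> k; apply: ext0.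
  by move=> k; apply: ext0.
exists x => // j; rewrite /J; case: ltnP => jd.
  rewrite hu; last by rewrite /d1' in jd; lia.
  by rewrite /tu addKn extE.
rewrite hv; last by have := ltn_ord j; rewrite /d1' /d /d1 in jd *; lia.
by rewrite /tv addKn subnKC // extE.
Qed.

Lemma cont_eq_not_sub k k' x0 x1 : (0 < k)%N -> (k < k')%N ->
  (n 1 * k' * beta 1 <= m)%N -> cont_eq m f (n 1 * k) x0 -> cont_eq m f (n 1 * k') x1 ->
  ~ (cont_eq m f (n 1 * k') `<=` cont_closure m f (n 1 * k)).
Proof.
move=> k0 kk' km hx0 hx1.
have N0 : (0 < n 1 * k)%N by rewrite muln_gt0 n10.
have N0' : (0 < n 1 * k')%N by rewrite muln_gt0 n10 (ltn_trans k0).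
have [i [ka [L [[_ ka0 _] NE _ thr D]]]] := cont_desc H N0 hx0.
have [i' [ka' [L' [[_ ka0' _] NE' _ thr' D']]]] := cont_desc H N0' hx1.
have Lm N cut L1 : threshold g beta m N cut L1 -> (L1 <= m.+1)%N.
  move=> [L10 _ _ h]; have : (b * L1.-1 < b * m.+1)%N.
    by apply: leq_ltn_trans h; rewrite (contactE H) leq_addr.
  by rewrite ltn_pmul2l // => h2; lia.
have Nm : (n 1 * k <= m)%N by case/cont_eqP: hx0 => _; apply: ordeq_arc.
have Nm' : (n 1 * k' <= m)%N by case/cont_eqP: hx1 => _; apply: ordeq_arc.
have cd := threshold_codim H kk' km thr thr'.
rewrite [in cont_closure _ _ _]NE.
apply: (@closure_not_sub i ka L _ (n 1 * k') L'); rewrite -?NE //.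
- exact: Lm thr.
- by move=> x /D.
- exact: leqW.
- exact: Lm thr'.
- move=> x /cont_eqP[_ [h _]]; have := h (n 1 * k)%N; rewrite fcoefF Nm; apply.
  by rewrite ltn_pmul2l.
move=> tu tv tu0 tv0.
(* All prescribed values are non-zero, so u has order exactly n_1 k'. A root s of u then fixes v
   below L', and v is free above. *)
pose u : fps K := FPS (fun j => if (j < n 1 * k')%N then 0 else tu j).
have uo : ordeq u (ka' * M i').
  rewrite -NE'; split; last by rewrite fcoefF ltnn.
  by move=> j h; rewrite fcoefF h.
have [s hs sE] := ordeq_root (coindex_gt0 b0 i') uo.
pose yt := ytrunc a beta i' (cutoff g beta m i').
pose v : fps K := FPS (fun j => if (j < L')%N then fcoef (fcomp s yt) j else tv j).
exists (mkjet m (s ^+ M i') v); split.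
- apply/D'; exists s, v; split=> //.
  by apply/vgeBP => j h; rewrite fcoefF h.
- move=> j /andP[h1 h2]; rewrite mxE eqxx inordK // sE fcoefF ltnNge h1 //.
by move=> j /andP[h1 h2]; rewrite mxE inordK // fcoefF ltnNge h1.
Qed.

(** Already the linear space [Lin] inside B_m escapes the closure. *)
Lemma cont_gt_not_sub k q x0 : (0 < k)%N -> (k <= q)%N ->
  (n 1 * q * beta 1 + e 1 <= m)%N -> (m < n 1 * q.+1 * beta 1 + e 1)%N ->
  cont_eq m f (n 1 * k) x0 ->
  ~ (cont_gt m f (n 1 * q) `<=` cont_closure m f (n 1 * k)).
Proof.
move=> k0 kq qm mq hx0 sub.
have qm' : (n 1 * q * beta 1 <= m)%N by apply: leq_trans qm; apply: leq_addr.
have N0 : (0 < n 1 * k)%N by rewrite muln_gt0 n10.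
have [i [ka [L [[_ ka0 _] NE _ thr D]]]] := cont_desc H N0 hx0.
have Nm : (n 1 * k <= m)%N by case/cont_eqP: hx0 => _; apply: ordeq_arc.
have cd := threshold_codim_lin H kq qm thr.
have {}sub : @Lin K beta m `<=` cont_closure m f (n 1 * k).
  by move=> x /(Lin_sub H qm') /sub.
move: sub; rewrite [in cont_closure _ _ _]NE.
apply: (@closure_not_sub i ka L _ (m %/ beta 1).+1 (m %/ b).+1); rewrite -?NE //.
- case: thr => [L10 _ _ h]; have : (b * L.-1 < b * m.+1)%N.
    by apply: leq_ltn_trans h; rewrite (contactE H) leq_addr.
  by rewrite ltn_pmul2l // => h2; lia.
- by move=> x /D.
- by rewrite ltnS leq_div.
- by rewrite ltnS leq_div.
- move=> x [h _]; have := h (n 1 * k)%N; rewrite fcoefF Nm; apply.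
  rewrite ltnS leq_divRL //; apply: leq_trans qm'.
  by rewrite leq_mul2r leq_mul2l kq !orbT.
move=> tu tv tu0 tv0.
exists (mkjet m (FPS (fun j => if (j < (m %/ beta 1).+1)%N then 0 else tu j))
  (FPS (fun j => if (j < (m %/ b).+1)%N then 0 else tv j))); split.
- by split; rewrite ?arc_mkjet0 ?arc_mkjet1 => j jm; rewrite fcoef_trunc fcoefF jm if_same.
- by move=> j /andP[h1 h2]; rewrite mxE eqxx inordK // fcoefF ltnNge h1.
by move=> j /andP[h1 h2]; rewrite mxE inordK // fcoefF ltnNge h1.
Qed.

End Inclusions.

(** * The value semigroup *)

Lemma prod_periodic (R : comNzRingType) (M e : nat) (F : nat -> R) :
  (forall k, F (k + M)%N = F k) -> \prod_(k < e * M) F k = (\prod_(k < M) F k) ^+ e.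
Proof.
move=> FM; elim: e => [|e IH]; first by rewrite mul0n big_ord0 expr0.
rewrite mulSn exprS -IH -!(big_mkord xpredT F) (@big_cat_nat _ _ _ M) //= ?leq_addr //.
congr (_ * _); rewrite -{1}[M]add0n big_addn addKn.
by apply: eq_bigr => k _; apply: FM.
Qed.

(** Distinct orders exclude cancellation, so the order of the sum is that of one summand. *)
Lemma ordeq_sum (K : fieldType) (n : nat) (F : nat -> fps K) v :
  (forall k l o, (k < n)%N -> (l < n)%N -> ordeq (F k) o -> ordeq (F l) o -> k = l) ->
  ordeq (\sum_(k < n) F k) v -> exists2 k, (k < n)%N & ordeq (F k) v.
Proof.
elim: n v => [|n IH] v dis; first by rewrite big_ord0 => /ordeq_neq0.
have {}IH v' : ordeq (\sum_(k < n) F k) v' -> exists2 k, (k < n)%N & ordeq (F k) v'.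
  by apply: IH => k l o kn ln; apply: dis; apply: ltnW.
rewrite big_ord_recr /=.
have [->|/eqP/ordeq_ex[v' hv']] := eqVneq (\sum_(i < n) F i) 0.
  by rewrite add0r => h; exists n.
have [k kn hk] := IH _ hv'.
have [->|/eqP/ordeq_ex[o ho]] := eqVneq (F n) 0.
  by rewrite addr0 => h; have [l ln hl] := IH _ h; exists l => //; apply: ltnW.
have [lt|lt|E] := ltngtP v' o; last first.
- by have := dis k n o (ltnW kn) (ltnSn n); rewrite -{1}E => /(_ hk ho) kE; rewrite kE ltnn in kn.
- rewrite addrC => h; exists n => //.
  suff <- : o = v by [].
  by apply: ordeq_uniq h; apply: ordeqDl => //; apply: vgeW (hv'.1).
move=> h; exists k; first exact: ltnW.
suff <- : v' = v by [].
by apply: ordeq_uniq h; apply: ordeqDl => //; apply: vgeW (ho.1).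
Qed.

Lemma monic_expansion (R : comNzRingType) (h p : {poly R}) (n : nat) : h \is monic ->
  (size p <= n * (size h).-1)%N -> exists r : nat -> {poly R},
    (forall k, (size (r k) <= (size h).-1)%N) /\ p = \sum_(k < n) r k * h ^+ k.
Proof.
move=> hm; have h0 : (0 < size h)%N by rewrite size_poly_gt0 monic_neq0.
elim: n p => [|n IH] p sp.
  exists (fun=> 0); split=> [k|]; first by rewrite size_poly0.
  by rewrite big_ord0; apply/eqP; rewrite -size_poly_leq0.
have pE := Pdiv.RingMonic.rdivp_eq hm p.
have sr : (size (Pdiv.Ring.rmodp p h) < size h)%N.
  by rewrite Pdiv.CommonRing.ltn_rmodp monic_neq0.
move: (Pdiv.Ring.rdivp p h) (Pdiv.Ring.rmodp p h) pE sr => q r0 pE sr.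
have [|r [hr qE]] := IH q.
  have [->|q0] := eqVneq q 0; first by rewrite size_poly0.
  have sq : (0 < size q)%N by rewrite size_poly_gt0.
  have sqh := size_Mmonic q0 hm.
  have : (size p = (size q + size h).-1)%N.
    by rewrite pE size_polyDl sqh //; apply: leq_trans sr _; rewrite -(prednK sq) addSn leq_addl.
  by move=> spE; move: sp; rewrite spE mulSn -{1}(prednK h0) addnS [_.+1.-1]/= addnC leq_add2l.
exists (fun k => if k is k'.+1 then r k' else r0); split=> [[|k]|]; [by rewrite -ltnS prednK | exact: hr |].
rewrite big_ord_recl expr0 mulr1 addrC pE qE mulr_suml; congr (_ + _).
by apply: eq_bigr => k _; rewrite /= exprSr mulrA.
Qed.

Section Values.
Variables (K : numClosedFieldType) (f : bps K) (a : nat -> K) (g : nat).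
Variables (beta : nat -> nat) (w : K).
Hypothesis H : puiseux_branch f a g beta w.
Local Notation b := (beta 0).
Local Notation e := (gcd_seq beta).
Local Notation M := (coindex beta).
Local Notation y := (FPS a).
Let b0 : (0 < b)%N. Proof. exact: ltnW (pb_b H). Qed.
Let e0 i : (0 < e i)%N. Proof. exact: gcd_seq_gt0. Qed.

(** Evaluation of p at (t^b, y). Polynomials in x1 are needed here for Euclidean division. *)
Definition psub (p : {poly fps K}) : fps K := (map_poly (fcomp (fpsX K ^+ b)) p).[y].

Lemma psubD p q : psub (p + q) = psub p + psub q.
Proof. by rewrite /psub rmorphD hornerD. Qed.
Lemma psubM p q : psub (p * q) = psub p * psub q.
Proof. by rewrite /psub rmorphM hornerM. Qed.
Lemma psubX p k : psub (p ^+ k) = psub p ^+ k.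
Proof. by rewrite /psub rmorphXn horner_exp. Qed.
Lemma psubC c : psub c%:P = fcomp (fpsX K ^+ b) c.
Proof. by rewrite /psub map_polyC hornerC. Qed.
Lemma psub_sum k (F : nat -> {poly fps K}) :
  psub (\sum_(i < k) F i) = \sum_(i < k) psub (F i).
Proof. by rewrite /psub rmorph_sum horner_sum. Qed.

Let tr (i : nat) : fps K := ftrunc (beta i.+1) y.
Let conj_tr (i k : nat) : fps K := fcomp (fpsC (w ^+ k) * fpsX K) (tr i).

Let Xe0 i : fcoef (fpsX K ^+ e i) 0 = 0. Proof. by rewrite fcoefXn ltn_eqF. Qed.
Let rot0 (c : K) : fcoef (fpsC c * fpsX K) 0 = 0.
Proof. by rewrite fcoefCM fcoefX mulr0. Qed.

(** Conjugates of the truncated series in the variable t^(e_i); only [M i] of them are distinct. *)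
Let rho (i k : nat) : fps K := fcomp (fpsC (w ^+ (e i * k)) * fpsX K) (ytrunc a beta i (beta i.+1)).

Let dil_rho i k : (i < g)%N -> fcomp (fpsX K ^+ e i) (rho i k) = conj_tr i k.
Proof.
move=> ig; rewrite /rho /conj_tr /tr.
rewrite -(dil_ytrunc H (i := i) (D := beta i.+1)); last by move=> l; apply: (pb_supp H).
rewrite [LHS](fcomp_fcomp _ _ (rot0 (w ^+ (e i * k)))) [RHS](fcomp_fcomp _ _ (Xe0 i)).
have -> : fcomp (fpsX K ^+ e i) (fpsC (w ^+ (e i * k)) * fpsX K) =
    fcomp (fpsC (w ^+ k) * fpsX K) (fpsX K ^+ e i).
  rewrite rmorphM /= fcompC fcompX (ftailE (Xe0 i)) [RHS]rmorphXn /= fcompX (ftailE (rot0 _)).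
  by rewrite exprMn fpsC_exp -exprM mulnC.
reflexivity.
Qed.

Let rho_per i k : rho i (k + M i)%N = rho i k.
Proof.
rewrite /rho; have -> : w ^+ (e i * (k + M i)) = w ^+ (e i * k).
  by rewrite mulnDr [(e i * M i)%N]mulnC coindexE exprD (prim_expr_order (pb_prim H)) mulr1.
reflexivity.
Qed.

Let conj_tr_per i k : (i < g)%N -> conj_tr i (k + M i)%N = conj_tr i k.
Proof.
by move=> ig; rewrite -(dil_rho (k + M i) ig) -(dil_rho k ig) rho_per.
Qed.

Let tail_ord i k : (i < g)%N ->
  ordeq (fcomp (fpsC (w ^+ k) * fpsX K) (y - tr i)) (beta i.+1).
Proof.
move=> ig; rewrite -[beta i.+1]mul1n; apply: ordeq_fcomp => //.
  split; first by move=> [|l].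
  rewrite fcoefCM fcoefX mulr1 expf_neq0 //; apply/eqP => w00.
  have := prim_expr_order (pb_prim H).
  by rewrite w00 expr0n eqn0Ngt b0 => /esym/eqP; rewrite oner_eq0.
split; first exact: vge_ftrunc.
by rewrite fcoefB fcoef_trunc ltnn subr0 fcoefF (pb_lead H).
Qed.

(** Truncation caps the order at beta_(i+1). If [M i] divides k, the truncated conjugate is the
    truncation of y itself and the cap is attained. *)
Let conj_tr_ord i k : (i < g)%N -> (0 < k < b)%N ->
  ordeq (y - conj_tr i k) (minn (beta i.+1) (beta (level beta g k))).
Proof.
move=> ig kb; have [lg l1 l2] := levelP b0 (pb_last H) kb.
have [Mk|Mk] := boolP (M i %| k)%N.
  rewrite (minn_idPl _); last first.
    apply: (beta_mono b0 (pb_last H) (pb_inc H)) => //.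
    have : (i < level beta g k)%N.
      rewrite ltnNge; apply/negP => le; case/negP: l2.
      by apply: dvdn_trans Mk; apply: coindex_dvd.
    lia.
  have -> : conj_tr i k = conj_tr i 0.
    case/dvdnP: Mk => q ->; elim: q => [//|q IH].
    by rewrite mulSn addnC (conj_tr_per _ ig) IH.
  have := tail_ord 0 ig; rewrite rmorphB /= -/(conj_tr i 0).
  by rewrite expr0 (_ : fpsC 1 = 1) ?mul1r ?fcomp_X.
have li : (level beta g k <= i)%N.
  rewrite leqNgt; apply/negP => le; case/negP: Mk.
  by apply: dvdn_trans l1; apply: coindex_dvd; lia.
have lt : (beta (level beta g k) < beta i.+1)%N.
  apply: leq_trans (pb_inc H (_ : 1 <= level beta g k < g)%N) _; first lia.
  by apply: (beta_mono b0 (pb_last H) (pb_inc H)) => //; lia.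
rewrite (minn_idPr (ltnW lt)).
have -> : y - conj_tr i k = (y - pconj w y k) + fcomp (fpsC (w ^+ k) * fpsX K) (y - tr i).
  by rewrite rmorphB /= addrA subrK.
apply: ordeqDl; first exact: (conj_ordeq H).
by apply: vgeW lt _; case: (tail_ord k ig).
Qed.

(** Over all b indices the order is the contact sum at beta_(i+1) with kappa = 1, that is e_i
    betab_(i+1); by periodicity that product is the e_i-th power of the present one. *)
Let prod_ord i : (i < g)%N ->
  ordeq (\prod_(k < M i) (y - conj_tr i k)) (semigen beta i.+1).
Proof.
move=> ig; have per k : y - conj_tr i (k + M i)%N = y - conj_tr i k by rewrite (conj_tr_per _ ig).
have h : ordeq (\prod_(k < b) (y - conj_tr i k)) (e i * semigen beta i.+1).
  rewrite -[semigen _ _]mul1n -(contact_semigen H 1 ig) mul1n /contact /contact_sum.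
  have := conj_tr_ord ig; have := tail_ord 0 ig.
  case: b b0 => // b' _; rewrite expr0 (_ : fpsC 1 = 1) // mul1r fcomp_X => t0 tk.
  rewrite big_ord_recl /= big_add1 big_mkord; apply: ordeqM.
    by rewrite /conj_tr expr0 (_ : fpsC 1 = 1) // mul1r fcomp_X.
  apply: ordeq_prod => k _; rewrite mul1n; apply: tk.
  by rewrite /bump leq0n add1n ltnS; have := ltn_ord k; lia.
have [z0|/eqP/ordeq_ex[o ho]] := eqVneq (\prod_(k < M i) (y - conj_tr i k)) 0.
  case: (ordeq_neq0 h); rewrite -(coindexE beta i) mulnC (prod_periodic _ per) z0.
  by rewrite expr0n eqn0Ngt e0.
have := ordeqX (e i) ho; rewrite -(prod_periodic (e i) per) mulnC coindexE => h'.
have := ordeq_uniq h h'; rewrite [(o * _)%N]mulnC => /eqP.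
by rewrite eqn_pmul2l // => /eqP ->.
Qed.

Let rot_undil (N : nat) (z : K) (c : fps K) : (0 < N)%N -> N.-primitive_root z ->
  fcomp (fpsC z * fpsX K) c = c -> c = fcomp (fpsX K ^+ N) (undil N c).
Proof.
move=> N0 zP hc; apply: fpsP => k; rewrite fcoef_dil // fcoefF.
case: ifP => [/dvdnP[q ->]|nd]; first by rewrite mulnK // mulnC.
apply/eqP; have /(congr1 (fun u => fcoef u k)) := hc; rewrite fcoef_rot => /eqP.
rewrite -subr_eq0 -{2}[fcoef c k]mulr1 -mulrBr mulf_eq0 subr_eq0.
by rewrite -(prim_order_dvd zP) nd orbF.
Qed.

(* The minimal polynomial of y truncated at its (i+1)-st exponent. *)
Lemma key_poly i : (i < g)%N -> exists h : {poly fps K},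
  [/\ h \is monic, size h = (M i).+1 & ordeq (psub h) (semigen beta i.+1)].
Proof.
move=> ig; have Mi := coindex_gt0 b0 i.
pose z := w ^+ e i.
have zP : (M i).-primitive_root z.
  by have := exp_prim_root (pb_prim H) (e i); rewrite (gcdn_idPl (gcd_seq_dvd0 beta i)).
pose P : {poly fps K} := \prod_(k < M i) ('X - (rho i k)%:P).
(* The rotation t -> z t permutes the roots cyclically, so the coefficients of P are series in t^(M
   i) and can be read as series in x0. *)
have Pinv : map_poly (fcomp (fpsC z * fpsX K)) P = P.
  rewrite /P rmorph_prod /=.
  rewrite (eq_bigr (fun k : 'I_(M i) => 'X - (rho i (1 + k))%:P)) => [|k _]; last first.
    rewrite rmorphB /= map_polyX map_polyC /= /rho (fcomp_fcomp _ _ (rot0 _)).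
    rewrite rmorphM /= fcompC fcompX (ftailE (rot0 _)) mulrA -rmorphM /= /z -exprD.
    by rewrite mulnDr muln1 addnC.
  have per k : 'X - (rho i (k + M i))%:P = 'X - (rho i k)%:P by rewrite rho_per.
  exact: esym (prod_cycle 1 per).
have Pm : P \is monic by apply: monic_prod_XsubC.
have Ps : size P = (M i).+1 by rewrite size_prod_XsubC /index_enum unlock -enumT size_enum_ord.
have Pc j : P`_j = fcomp (fpsX K ^+ M i) (undil (M i) P`_j).
  by apply: (rot_undil Mi zP); rewrite -[in RHS]Pinv coef_map.
have u1 : undil (M i) 1 = 1 :> fps K.
  by apply: fpsP => k; rewrite fcoefF !fcoef1 muln_eq0 eqn0Ngt Mi.
pose h := \poly_(j < (M i).+1) undil (M i) P`_j.
have hM : h`_(M i) = 1.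
  by rewrite coef_poly ltnSn -[RHS]u1; congr (undil _ _); have /monicP := Pm; rewrite lead_coefE Ps.
have hs : size h = (M i).+1.
  by apply: size_poly_eq; move: hM; rewrite coef_poly ltnSn => ->; apply: oner_neq0.
exists h; split=> //; first by rewrite monicE lead_coefE hs hM.
have -> : psub h = \prod_(k < M i) (y - conj_tr i k).
  have -> : \prod_(k < M i) (y - conj_tr i k) = (map_poly (fcomp (fpsX K ^+ e i)) P).[y].
    rewrite rmorph_prod horner_prod; apply: eq_bigr => k _.
    by rewrite rmorphB /= map_polyX map_polyC /= hornerXsubC dil_rho.
  congr (_.[y]); apply/polyP => j; rewrite !coef_map /=.
  rewrite coef_poly; case: ltnP => [jM|Mj].
    rewrite [in RHS]Pc (fcomp_fcomp _ _ _); last by rewrite fcoefXn ltn_eqF.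
    by rewrite rmorphXn /= fcompX (ftailE (Xe0 i)) -exprM mulnC coindexE.
  by rewrite nth_default ?rmorph0 // Ps.
exact: prod_ord.
Qed.

End Values.

Local Notation generated := Defs.generated.

Lemma generatedS (B : nat -> nat) k v : generated B k.+1 v <->
  exists v' c, generated B k v' /\ v = (v' + c * B k)%N.
Proof.
split=> [[c ->]|[v' [c [[c' ->] ->]]]].
  by rewrite big_ord_recr /=; exists (\sum_(i < k) c i * B i)%N, (c k); split=> //; exists c.
exists (fun i => if i == k then c else c' i); rewrite big_ord_recr /= eqxx.
by congr (_ + _)%N; apply: eq_bigr => i _; rewrite ltn_eqF.
Qed.

Lemma eq_generated (B B' : nat -> nat) k : (forall i, (i < k)%N -> B i = B' i) ->
  generated B k = generated B' k.
Proof.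
move=> h; apply/seteqP; split=> v [c ->]; exists c; apply: eq_bigr => i _; by rewrite h.
Qed.

(** Successive elimination of leading terms by a family with one member in each order from c on. *)
Lemma fps_expand (K : fieldType) (G : nat -> fps K) c :
  (forall n, vge (c + n) (G n)) -> (forall n, fcoef (G n) (c + n) = 1) ->
  forall W, vge c W -> exists z : nat -> K,
    forall N, vge (c + N) (W - \sum_(n < N) fpsC (z n) * G n).
Proof.
move=> Gv G1 W hW.
pose fix Wr n := if n is n'.+1 then Wr n' - fpsC (fcoef (Wr n') (c + n')) * G n' else W.
have WrS n : Wr n.+1 = Wr n - fpsC (fcoef (Wr n) (c + n)) * G n by [].
exists (fun n => fcoef (Wr n) (c + n)) => N.
have -> : W - \sum_(n < N) fpsC (fcoef (Wr n) (c + n)) * G n = Wr N.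
  elim: N => [|N IH]; first by rewrite big_ord0 subr0.
  by rewrite big_ord_recr WrS -IH /= opprD addrA.
elim: N => [|N IH]; first by rewrite addn0.
rewrite WrS addnS => k; rewrite ltnS leq_eqVlt => /orP[/eqP ->|kN].
  by rewrite fcoefB fcoefCM G1 mulr1 subrr.
by rewrite fcoefB fcoefCM IH // Gv // mulr0 subr0.
Qed.

Lemma sum_blocks (V : zmodType) (b L : nat) (F : nat -> V) :
  \sum_(n < L * b) F n = \sum_(l < L) \sum_(r < b) F (l * b + r)%N.
Proof.
elim: L => [|L IH]; first by rewrite mul0n !big_ord0.
rewrite big_ord_recr /= -IH mulSn addnC -!(big_mkord xpredT) (@big_cat_nat _ _ _ (L * b)) //= ?leq_addr //.
by congr (_ + _); rewrite -{1}[(L * b)%N]add0n big_addn addKn big_mkord; apply: eq_bigr => r _; rewrite addnC.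
Qed.

Section ValueSemigroup.
Variables (K : numClosedFieldType) (f : bps K) (a : nat -> K) (g : nat).
Variables (beta : nat -> nat) (w : K).
Hypothesis H : puiseux_branch f a g beta w.
Local Notation b := (beta 0).
Local Notation e := (gcd_seq beta).
Local Notation n := (ratio_n beta).
Local Notation M := (coindex beta).
Local Notation y := (FPS a).
Local Notation psub := (psub a beta).
Local Notation S := (bsub (fpsX K ^+ b) y).
Let b0 : (0 < b)%N. Proof. exact: ltnW (pb_b H). Qed.
Let e0 i : (0 < e i)%N. Proof. exact: gcd_seq_gt0. Qed.
Let y0 : fcoef y 0 = 0.
Proof. by apply: (pb_low H); have := pb_b1 H; lia. Qed.

Lemma generated_dvd i v : (i <= g)%N -> generated (semigen beta) i.+1 v -> (e i %| v)%N.
Proof.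
move=> ig [c ->]; apply: (big_ind (fun x => e i %| x)%N) => [|x z|j _]; [exact: dvdn0 | exact: dvdn_add |].
apply: dvdn_mull; apply: (semigen_dvd b0 (pb_last H) (pb_ndvd H) (pb_inc H)).
by rewrite -ltnS ltn_ord.
Qed.

(** Expand in powers of the key polynomial of degree [M i], with exponents k < n_(i+1). The values o
    + k betab_(i+1) are pairwise distinct, since e_i divides each o while e_i | d betab_(i+1) forces
    n_(i+1) | d. *)
Lemma poly_value i (p : {poly fps K}) v : (i <= g)%N -> (size p <= M i)%N -> ordeq (psub p) v ->
  generated (semigen beta) i.+1 v.
Proof.
elim: i p v => [|i IH] p v ig.
  rewrite [M 0]/coindex divnn b0 => /size1_polyC ->; rewrite psubC => hv.
  have [c0|/eqP/ordeq_ex[o ho]] := eqVneq p`_0 0.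
    by case: (ordeq_neq0 hv); rewrite c0 rmorph0.
  have hb := ordeq_fcomp b0 (ordeq_fpsX K b) ho.
  exists (fun=> o); rewrite big_ord1 mulnC; exact: ordeq_uniq hv hb.
have [h [hm hs ho]] := key_poly H ig.
rewrite (coindexS b0) => sp; have [|r [hr pE]] := @monic_expansion _ h p (n i.+1) hm.
  by rewrite hs.
rewrite hs /= in hr; rewrite pE.
have -> : psub (\sum_(k < n i.+1) r k * h ^+ k) = \sum_(k < n i.+1) psub (r k * h ^+ k).
  exact: (@psub_sum K a beta (n i.+1) (fun k => r k * h ^+ k)).
have F k o : ordeq (psub (r k * h ^+ k)) o -> exists2 o1,
    generated (semigen beta) i.+1 o1 & o = (o1 + k * semigen beta i.+1)%N.
  rewrite psubM psubX => hk.
  have [c0|/eqP/ordeq_ex[o1 ho1]] := eqVneq (psub (r k)) 0.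
    by case: (ordeq_neq0 hk); rewrite c0 mul0r.
  exists o1; first exact: IH (ltnW ig) (hr k) ho1.
  by rewrite (ordeq_uniq hk (ordeqM ho1 (ordeqX k ho))) mulnC.
move=> /(@ordeq_sum _ _ (fun k => psub (r k * h ^+ k)))[].
  have key k l o : (k <= l < n i.+1)%N -> ordeq (psub (r k * h ^+ k)) o ->
      ordeq (psub (r l * h ^+ l)) o -> k = l.
    move=> /andP[kl ln] /F[o1 g1 E1] /F[o2 g2 E2].
    have d1 := generated_dvd (ltnW ig) g1; have d2 := generated_dvd (ltnW ig) g2.
    have E : (o1 = o2 + (l - k) * semigen beta i.+1)%N.
      apply/eqP; rewrite -(eqn_add2r (k * semigen beta i.+1)) -E1 E2 -addnA -mulnDl.
      by rewrite subnK.
    have : (n i.+1 %| l - k)%N.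
      apply: (semigen_ndvd b0 (pb_last H) (pb_ndvd H) (pb_inc H) (j := i.+1)) => //.
      by rewrite E dvdn_addr // in d1.
    have [lk|lk] := posnP (l - k); first by move=> _; lia.
    by move=> /(dvdn_leq lk); lia.
  move=> k l o kn ln h1 h2; have [kl|lk] := leqP k l; first by apply: key h1 h2; rewrite kl.
  by apply/esym; apply: key h2 h1; rewrite ltnW.
by move=> k kn /F[o1 g1 ->]; apply/generatedS; exists o1, k.
Qed.

Lemma psub_trunc N h : psub (\poly_(j < N) fcoef h j) = S (ftrunc N h).
Proof.
rewrite ftruncE rmorph_sum /psub (@horner_coef_wide _ N); last first.
  by apply: leq_trans (size_poly _ _) (size_poly _ _).
apply: eq_bigr => i _; rewrite coef_map coef_poly ltn_ord rmorphM rmorphXn /=.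
by rewrite bsubC bsubX (ftailE y0).
Qed.

(** Truncating h and reducing modulo the key polynomial change h(t^b, y) only above the order v, so
    v is the value of a polynomial of degree below [M i]. *)
Lemma low_value i h v : (i < g)%N -> ordeq (S h) v -> (v < semigen beta i.+1)%N ->
  generated (semigen beta) i.+1 v.
Proof.
move=> ig hv lt; have [k [km ks ko]] := key_poly H ig.
pose p := \poly_(j < v.+1) fcoef h j.
have hp : ordeq (psub p) v.
  rewrite /p psub_trunc -(subrK (S h) (S (ftrunc v.+1 h))) addrC.
  apply: ordeqDl => //; rewrite -rmorphB (fshiftK (vgeBC (@vge_ftrunc _ v.+1 h))).
  rewrite rmorphM rmorphXn /= bsubX (ftailE y0); apply: vgeMl.
  by rewrite -[X in vge X _]mul1n; apply: vgeX => -[|//].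
have sr : (size (Pdiv.Ring.rmodp p k) < size k)%N.
  by rewrite Pdiv.CommonRing.ltn_rmodp monic_neq0.
apply: (@poly_value i (Pdiv.Ring.rmodp p k)); first exact: ltnW.
  by rewrite -ltnS -ks.
have pE := Pdiv.RingMonic.rdivp_eq km p.
have -> : psub (Pdiv.Ring.rmodp p k) = psub p - psub (Pdiv.Ring.rdivp p k) * psub k.
  by rewrite [in psub p]pE psubD psubM addrC addKr.
apply: ordeqDl => //; apply: vgeN; apply: vgeMr; apply: vgeW lt _; exact: ko.1.
Qed.

Definition is_value (v : nat) := exists h : bps K, ordeq (S h) v.

Lemma is_value0 : is_value 0.
Proof. by exists 1; rewrite rmorph1; apply: ordeq1. Qed.

Lemma is_valueD u v : is_value u -> is_value v -> is_value (u + v).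
Proof. by move=> [h hh] [k hk]; exists (h * k); rewrite rmorphM; apply: ordeqM. Qed.

Lemma is_valueMn v k : is_value v -> is_value (k * v).
Proof.
by move=> hv; elim: k => [|k IH]; [apply: is_value0 | rewrite mulSn; apply: is_valueD].
Qed.

Lemma is_value_semigen i : (i <= g)%N -> is_value (semigen beta i).
Proof.
case: i => [_|i ig].
  exists (bps_x0 K); rewrite bsubC fcompX ftailE; last by rewrite fcoefXn ltn_eqF.
  exact: ordeq_fpsX.
have [k [km ks ko]] := key_poly H ig.
exists (FPS (fun j => k`_j)).
have -> : FPS (fun j => k`_j) = ftrunc (size k) (FPS (fun j => k`_j)).
  by apply: fpsP => j; rewrite fcoef_trunc fcoefF; case: ltnP => // /(nth_default 0).
rewrite -psub_trunc (_ : \poly_(j < _) _ = k) //.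
by apply/polyP => j; rewrite coef_poly fcoefF; case: ltnP => // /(nth_default 0).
Qed.

(** By induction on i, all large multiples of e_i are values; at i = g these are all large
    integers. *)
Lemma is_value_conductor : exists c, forall v, (c <= v)%N -> is_value v.
Proof.
suff h i : (i <= g)%N -> exists c, forall v, (c <= v)%N -> (e i %| v)%N -> is_value v.
  by have [c hc] := h g (leqnn g); exists c => v cv; apply: hc => //; rewrite (pb_last H).
elim: i => [_|i IH ig].
  exists 0%N => v _ /dvdnP[k ->]; apply: is_valueMn; exact: (is_value_semigen (leq0n g)).
have [c hc] := IH (ltnW ig); exists (c + e i * semigen beta i.+1)%N => v cv ev.
have gE := gcd_semigen b0 (pb_last H) (pb_ndvd H) (pb_inc H) (_ : 1 <= i.+1 <= g)%N.
have {}gE : gcdn (e i) (semigen beta i.+1) = e i.+1 by apply: gE.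
set B := semigen beta i.+1 in gE cv *.
(* Bezout provides a multiple of B in the class of v modulo e_i; k < e_i keeps the remainder v - k B
   above the previous bound. *)
have [k kE dk] : exists2 k, (k < e i)%N & (v = k * B %[mod e i])%N.
  case/dvdnP: ev => q ->; have [u uE hu] := Bezoutl B (e0 i); rewrite gE in hu.
  exists ((q * (e i - u)) %% e i)%N; first by rewrite ltn_mod.
  apply/eqP; rewrite modnMml -(eqn_modDr (q * u * B)).
  have -> : (q * e i.+1 + q * u * B = q * (e i.+1 + u * B))%N by ring.
  have -> : (q * (e i - u) * B + q * u * B = e i * (q * B))%N.
    by rewrite -mulnDl -mulnDr subnK 1?ltnW // -mulnA mulnCA.
  by rewrite modnMr; apply: dvdn_mull.
have kv : (k * B <= v)%N.
  by apply: leq_trans cv; apply: leq_trans (leq_addl _ _); rewrite leq_mul2r ltnW ?orbT.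
have dvk : (e i %| v - k * B)%N by rewrite -eqn_mod_dvd //; apply/eqP.
rewrite -(subnK kv); apply: is_valueD; last first.
  by apply: is_valueMn; apply: is_value_semigen.
apply: hc => //; rewrite leq_subRL // addnC; apply: leq_trans cv.
by rewrite leq_add2l leq_mul2r ltnW ?orbT.
Qed.

End ValueSemigroup.

Lemma ordeq_sum_neq0 (K : fieldType) (n : nat) (F : nat -> fps K) :
  (forall k l o, (k < n)%N -> (l < n)%N -> ordeq (F k) o -> ordeq (F l) o -> k = l) ->
  (exists2 k, (k < n)%N & F k <> 0) -> \sum_(k < n) F k <> 0.
Proof.
elim: n => [|n IH] dis; first by case.
have dis' : forall k l o, (k < n)%N -> (l < n)%N -> ordeq (F k) o -> ordeq (F l) o -> k = l.
  by move=> k l o kn ln; apply: dis; apply: ltnW.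
have {}IH := IH dis'; rewrite big_ord_recr /= => -[k kn Fk].
have [Fn|/eqP/ordeq_ex[o ho]] := eqVneq (F n) 0.
  rewrite Fn addr0; apply: IH; exists k => //.
  by move: kn; rewrite ltnS leq_eqVlt => /orP[/eqP E|//]; rewrite E Fn in Fk.
have [->|/eqP/ordeq_ex[o' ho']] := eqVneq (\sum_(i < n) F i) 0.
  by rewrite add0r; apply: ordeq_neq0 ho.
have [l ln hl] := ordeq_sum dis' ho'.
have [lt|lt|E] := ltngtP o o'; last first.
- by have := dis l n o (ltnW ln) (ltnSn n); rewrite {1}E => /(_ hl ho) lE; rewrite lE ltnn in ln.
- by apply: (@ordeq_neq0 _ _ o'); apply: ordeqDl => //; apply: vgeW ho.1.
by rewrite addrC; apply: (@ordeq_neq0 _ _ o); apply: ordeqDl => //; apply: vgeW ho'.1.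
Qed.

(** * The dimension of the quotient by (f, h) equals the order of h on the branch *)

Section QuotientDim.
Variables (K : fieldType).
Implicit Types (f h u v : bps K).

Lemma ideal2D f h u v : ideal2 f h u -> ideal2 f h v -> ideal2 f h (u + v).
Proof.
by move=> [k [l ->]] [k' [l' ->]]; exists (k + k'), (l + l'); rewrite !mulrDr addrACA.
Qed.

Lemma ideal2M f h u v : ideal2 f h u -> ideal2 f h (v * u).
Proof.
by move=> [k [l ->]]; exists (v * k), (v * l); rewrite mulrDr !(mulrCA v).
Qed.

Lemma ideal2N f h u : ideal2 f h u -> ideal2 f h (- u).
Proof. by rewrite -mulN1r; apply: ideal2M. Qed.

Lemma bpsC_sum d (F : 'I_d -> K) : bpsC (\sum_i F i) = \sum_i bpsC (F i).
Proof. by rewrite /bpsC !rmorph_sum. Qed.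

Lemma bpsCD (x z : K) : bpsC (x + z) = bpsC x + bpsC z.
Proof. by rewrite /bpsC !rmorphD. Qed.

Lemma bpsCM (x z : K) : bpsC (x * z) = bpsC x * bpsC z.
Proof. by rewrite /bpsC !rmorphM. Qed.

(** Change of basis in both directions gives matrices with product the identity, which bounds the
    sizes. *)
Lemma quotient_dim_leq f h d d' : quotient_dim f h d -> quotient_dim f h d' -> (d <= d')%N.
Proof.
move=> [b hb] [b' hb'].
have /choice[A hA] : forall i, exists c : {ffun 'I_d' -> K},
    ideal2 f h (b i - \sum_(j < d') bpsC (c j) * b' j).
  by move=> i; have [c [hc _]] := hb' (b i); exists c.
have /choice[B hB] : forall j, exists c : {ffun 'I_d -> K},
    ideal2 f h (b' j - \sum_(i < d) bpsC (c i) * b i).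
  by move=> j; have [c [hc _]] := hb (b' j); exists c.
pose MA := \matrix_(i < d, j < d') A i j; pose MB := \matrix_(j < d', i < d) B j i.
apply: (@mulmx1_min _ _ _ MA MB); apply/matrixP => i k; rewrite mxE.
have [c [_ uc]] := hb (b i).
have cE : c = [ffun k => (k == i)%:R].
  apply: uc; rewrite (bigD1 i) //= ffunE eqxx big1 ?addr0 => [|j /negbTE ji].
    by rewrite (_ : bpsC 1 = 1) ?mul1r ?subrr; first by exists 0, 0; rewrite !mulr0 addr0.
  by rewrite ffunE ji (_ : bpsC 0 = 0) ?mul0r // /bpsC !rmorph0.
have cE' : c = [ffun k => \sum_j A i j * B j k].
  apply: uc; rewrite (eq_bigr (fun k => \sum_j bpsC (A i j) * (bpsC (B j k) * b k))); last first.
    move=> k' _; rewrite ffunE bpsC_sum mulr_suml; apply: eq_bigr => j _.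
    by rewrite bpsCM mulrA.
  rewrite exchange_big /=; under eq_bigr do rewrite -mulr_sumr.
  rewrite -(subrKA (\sum_(j < d') bpsC (A i j) * b' j)); apply: ideal2D; first exact: hA.
  rewrite -sumrB; elim/big_rec: _ => [|j x _ hx]; first by exists 0, 0; rewrite !mulr0 addr0.
  by apply: ideal2D hx; rewrite -mulrBr; apply: ideal2M; apply: hB.
have /ffunP/(_ k) := etrans (esym cE) cE'; rewrite !ffunE mxE eq_sym => ->.
by apply: eq_bigr => j _; rewrite !mxE.
Qed.

End QuotientDim.

Section ValueCount.
Variables (V : pred nat) (s c : nat).
Hypothesis Vc : forall v, (c <= v)%N -> V v.
Hypothesis Vs : forall v, V v -> V (s + v)%N.

(** Below s + c there are s more elements of V than of its translate s + V, because V contains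
    everything from c on. *)
Lemma count_gaps :
  count (fun v => V v && ~~ ((s <= v)%N && V (v - s)%N)) (iota 0 (s + c)%N) = s.
Proof.
have h1 : count V (iota 0 (s + c)%N) = (count V (iota 0 c) + s)%N.
  rewrite [(s + c)%N]addnC iotaD count_cat add0n; congr (_ + _)%N.
  rewrite -[RHS](size_iota c); apply/eqP; rewrite -all_count.
  by apply/allP => v; rewrite mem_iota => /andP[cv _]; apply: Vc.
pose W v := (s <= v)%N && V (v - s)%N.
have h2 : count W (iota 0 (s + c)%N) = count V (iota 0 c).
  rewrite iotaD count_cat add0n (_ : count W (iota 0 s) = 0%N) ?add0n.
    rewrite -[X in iota X c]addn0 iotaDl count_map; apply: eq_count => v /=.
    by rewrite /W leq_addr addKn.
  apply/eqP; rewrite -leqn0 leqNgt -has_count; apply/hasPn => v.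
  by rewrite mem_iota /W add0n /= ltnNge => /negbTE ->.
apply/eqP; rewrite -(eqn_add2l (count V (iota 0 c))) -h1 -{1}h2.
rewrite -(size_filter V) -(count_predC W (filter V _)) !count_filter; apply/eqP; congr (_ + _)%N.
  apply: eq_count => v /=; rewrite /W; case: leqP => //= sv.
  by case E: (V (v - s)%N) => //=; rewrite -(subnKC sv) Vs.
by apply: eq_count => v /=; rewrite andbC.
Qed.

End ValueCount.

Section ValueQuotient.
Variables (K : numClosedFieldType) (f : bps K) (a : nat -> K) (g : nat).
Variables (beta : nat -> nat) (w : K).
Hypothesis H : puiseux_branch f a g beta w.
Local Notation b := (beta 0).
Local Notation y := (FPS a).
Local Notation S := (bsub (fpsX K ^+ b) y).
Local Notation is_value := (is_value a beta).
Let b0 : (0 < b)%N. Proof. exact: ltnW (pb_b H). Qed.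
Let y0 : fcoef y 0 = 0.
Proof. by apply: (pb_low H); have := pb_b1 H; lia. Qed.

Lemma S_ker h : S h = 0 -> ring_dvd f h.
Proof.
exact: (bsub_ker b0 (pb_prim H) y0 (pb_root H) (conj_neq_root H) (pb_reg H)).
Qed.

Lemma S_dvd h : ring_dvd f h -> S h = 0.
Proof. by move=> [k ->]; rewrite rmorphM /= (pb_root H) mul0r. Qed.

Lemma S_bpsC (c : K) : S (bpsC c) = fpsC c.
Proof. by rewrite /bpsC bsubC fcompC. Qed.

Lemma ideal2_S h u : ideal2 f h u <-> exists l, S u = S h * S l.
Proof.
split=> [[k [l ->]]|[l E]].
  by exists l; rewrite rmorphD !rmorphM /= (pb_root H) mul0r add0r.
have [|k kE] := @S_ker (u - h * l); first by rewrite rmorphB rmorphM /= E subrr.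
by exists k, l; rewrite -kE subrK.
Qed.

Lemma value_lead v : is_value v -> exists2 h, vge v (S h) & fcoef (S h) v = 1.
Proof.
move=> [h [h1 h2]]; exists (bpsC (fcoef (S h) v)^-1 * h); rewrite rmorphM /= S_bpsC.
  exact: vgeMr.
by rewrite fcoefCM mulVf.
Qed.

(** Beyond the conductor every order is attained, already by b fixed elements times powers of x0 =
    t^b; regrouping by residues modulo b turns the expansion into a combination with coefficients in
    K[[x0]]. *)
Lemma high_image c : (forall v, (c <= v)%N -> is_value v) ->
  forall W, vge c W -> exists h, S h = W.
Proof.
move=> hc W hW.
have /choice[hh hhP] : forall r, exists h, vge (c + r) (S h) /\ fcoef (S h) (c + r) = 1.
  by move=> r; have [|h h1 h2] := @value_lead (c + r); [apply: hc; apply: leq_addr | exists h].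
pose G (n : nat) : fps K := fpsX K ^+ (b * (n %/ b)) * S (hh (n %% b)%N).
have nE n : (c + n = b * (n %/ b) + (c + n %% b))%N.
  by rewrite {1}(divn_eq n b) mulnC addnCA.
have [n|n|z hz] := @fps_expand K G c _ _ W hW.
- by rewrite nE; apply: vgeM; [apply: vge_fpsX | case: (hhP (n %% b)%N)].
- rewrite nE fcoefM_lead; [|exact: vge_fpsX | by case: (hhP (n %% b)%N)].
  by rewrite fcoefXn eqxx mul1r; case: (hhP (n %% b)%N).
pose gg (r : nat) : fps K := FPS (fun l => z (l * b + r)%N).
exists (\sum_(r < b) fpsC (gg r) * hh r).
apply/esym/eqP; rewrite -subr_eq0; apply/eqP; apply: vge_eq0 => L.
apply: (@vgeW _ _ (c + L * b)); first by apply: leq_trans (leq_addl _ _); apply: leq_pmulr.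
apply: vgeB_trans (hz (L * b)%N) _.
rewrite (sum_blocks b L (fun n => fpsC (z n) * G n)) exchange_big rmorph_sum /= -sumrB; apply: vge_sum => r _.
rewrite rmorphM /= bsubC.
have -> : \sum_(l < L) fpsC (z (l * b + r)%N) * G (l * b + r)%N =
    fcomp (fpsX K ^+ b) (ftrunc L (gg r)) * S (hh r).
  rewrite ftruncE rmorph_sum mulr_suml; apply: eq_bigr => l _.
  rewrite /G divnMDl // modnMDl (divn_small (ltn_ord r)) (modn_small (ltn_ord r)) addn0.
  rewrite mulrA; congr (_ * _); rewrite rmorphM rmorphXn /= fcompC fcompX.
  by rewrite ftailE ?exprM // fcoefXn ltn_eqF.
rewrite -mulrBl -rmorphB addnC mulnC; apply: vgeM.
  by apply: (vge_dil _ _ b0).1; apply: vgeBC; apply: vge_ftrunc.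
by apply: vgeW (hhP r).1; apply: leq_addr.
Qed.

Section Quotient.
Variables (h : bps K) (s : nat).
Hypothesis hs : ordeq (S h) s.

Let V : pred nat := fun v => `[< is_value v >].
Let gap v := V v && ~~ ((s <= v)%N && V (v - s)%N).

(** Remove the leading term of [S u]: by a basis element if its order is a gap, by a multiple of h
    if the order minus s is a value. From order s + c on, S u / S h lies beyond the conductor, so u
    is in the ideal. *)
Lemma low_quotient c hh : (forall v, (c <= v)%N -> is_value v) ->
  (forall v, is_value v -> vge v (S (hh v)) /\ fcoef (S (hh v)) v = 1) ->
  forall k u, (k <= s + c)%N -> vge (s + c - k) (S u) ->
  exists z : nat -> K,
    ideal2 f h (u - \sum_(v <- filter gap (iota 0 (s + c)%N)) bpsC (z v) * hh v).
Proof.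
move=> hc hhP; elim=> [|k IH] u.
  rewrite subn0 => _ hu; exists (fun=> 0).
  rewrite big1 ?subr0 => [|v _]; last by rewrite /bpsC !rmorph0 mul0r.
  have [x xE] : exists x, fshift s (S h) * x = 1.
    by apply: (@fps_inv _ _ (fcoef (S h) s)^-1); rewrite fcoef_shift ?add0n ?addn0 mulfV ?hs.2.
  have hu' := fshiftK (vgeW (leq_addr c s) hu).
  have [|l lE] := @high_image c hc (x * fshift s (S u)).
    by apply: vgeMr => i ic; rewrite fcoef_shift; apply: hu; rewrite ?[(i + s)%N]addnC ltn_add2l.
  apply/ideal2_S; exists l; rewrite lE [in RHS](fshiftK hs.1) mulrA.
  by rewrite -[_ * _ * x]mulrA xE mulr1.
move=> ks; set v := (s + c - k.+1)%N => hu.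
have vS : (s + c - k = v.+1)%N by rewrite /v; lia.
have {}IH u' : vge v (S u') -> fcoef (S u') v = 0 -> exists z : nat -> K,
    ideal2 f h (u' - \sum_(v <- filter gap (iota 0 (s + c)%N)) bpsC (z v) * hh v).
  move=> hv hv'; apply: IH; first exact: ltnW.
  by rewrite vS => i; rewrite ltnS leq_eqVlt => /orP[/eqP->//|]; apply: hv.
have [uv|uv] := eqVneq (fcoef (S u) v) 0; first exact: IH.
have Vv : is_value v by exists u.
have [gv|] := boolP (gap v).
  have [hv1 hv2] := hhP _ Vv.
  have [||z hz] := IH (u - bpsC (fcoef (S u) v) * hh v).
  - by rewrite rmorphB rmorphM /= S_bpsC; apply: vgeB => //; apply: vgeMr.
  - by rewrite rmorphB rmorphM /= S_bpsC fcoefB fcoefCM hv2 mulr1 subrr.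
  have vin : v \in filter gap (iota 0 (s + c)%N) by rewrite mem_filter gv mem_iota /v; lia.
  have vu : uniq (filter gap (iota 0 (s + c)%N)) by rewrite filter_uniq ?iota_uniq.
  exists (fun i => if i == v then z v + fcoef (S u) v else z i).
  move: hz; rewrite !(bigD1_seq v vin vu) /= eqxx (bpsCD (z v)) mulrDl.
  rewrite [X in _ -> ideal2 _ _ (_ - (_ + X))](eq_bigr (fun i => bpsC (z i) * hh i)); last first.
    by move=> i /negbTE->.
  move: (bpsC (fcoef (S u) v) * hh v) (bpsC (z v) * hh v) (\sum_(i <- _ | _) _) => C A B.
  by rewrite !opprD !addrA (addrAC u).
rewrite /gap /V asboolT // negbK => /andP[sv /asboolP Vs].
have [hv1 hv2] := hhP _ Vs.
pose cc := fcoef (S u) v / fcoef (S h) s.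
have E : fcoef (S h * S (hh (v - s)%N)) v = fcoef (S h) s.
  by rewrite -{2}(subnKC sv) (fcoefM_lead hs.1 hv1) hv2 mulr1.
have hv : vge v (S h * S (hh (v - s)%N)).
  by rewrite -{1}(subnKC sv); apply: vgeM; first exact: hs.1.
have [||z hz] := IH (u - bpsC cc * (h * hh (v - s)%N)).
- by rewrite rmorphB !rmorphM /= S_bpsC; apply: vgeB => //; apply: vgeMr.
- by rewrite rmorphB !rmorphM /= S_bpsC fcoefB fcoefCM E divfK ?subrr ?hs.2.
exists z; rewrite -(subrK (bpsC cc * (h * hh (v - s)%N)) u) addrAC; apply: ideal2D => //.
by exists 0, (bpsC cc * hh (v - s)%N); rewrite mulr0 add0r mulrCA.
Qed.

(** The basis consists of elements of value v for the s values v such that v - s is not a value. *)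
Lemma quotient_dim_value : quotient_dim f h s.
Proof.
have [c hc] := is_value_conductor H.
have /choice[hh hhP] : forall v, exists h, is_value v -> vge v (S h) /\ fcoef (S h) v = 1.
  move=> v; have [/value_lead[h' h1 h2]|nv] := pselect (is_value v); first by exists h'.
  by exists 0.
pose vs := filter gap (iota 0 (s + c)%N).
have vs_size : size vs = s.
  rewrite size_filter; apply: count_gaps => v; rewrite /V => hv; apply/asboolP; first exact: hc.
  by apply: is_valueD; [exists h | apply/asboolP].
have vs_gap i : (i < s)%N -> gap (nth 0%N vs i).
  by rewrite -vs_size => /(mem_nth 0%N); rewrite mem_filter => /andP[].
have vs_val i : (i < s)%N -> is_value (nth 0%N vs i).
  by move=> /vs_gap /andP[/asboolP].
have vs_uniq : uniq vs by rewrite filter_uniq ?iota_uniq.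
exists (fun i : 'I_s => hh (nth 0%N vs i)) => u.
have [||z hz] := low_quotient hc hhP (k := (s + c)%N) (u := u) => //.
  by rewrite subnn.
exists [ffun i : 'I_s => z (nth 0%N vs i)]; split.
  under eq_bigr do rewrite ffunE.
  by move: hz; rewrite -/vs (big_nth 0%N) vs_size big_mkord.
move=> z' hz'.
pose d (k : nat) : K := oapp (fun i : 'I_s => z (nth 0%N vs i) - z' i) 0 (insub k).
have dE (i : 'I_s) : d i = z (nth 0%N vs i) - z' i by rewrite /d valK.
pose F k := fpsC (d k) * S (hh (nth 0%N vs k)).
have Ford k o : (k < s)%N -> ordeq (F k) o -> o = nth 0%N vs k.
  move=> ks [h1 h2]; have [k1 k2] := hhP _ (vs_val _ ks).
  have dk : d k != 0 by apply: contraNneq h2 => d0; rewrite /F d0 rmorph0 mul0r.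
  apply: (@ordeq_uniq _ (F k)) => //; split; first exact: vgeMr.
  by rewrite fcoefCM k2 mulr1.
have dis k l o : (k < s)%N -> (l < s)%N -> ordeq (F k) o -> ordeq (F l) o -> k = l.
  move=> ks ls /(Ford _ _ ks) -> /(Ford _ _ ls)/eqP.
  by rewrite nth_uniq ?vs_size // => /eqP.
apply/ffunP => i; rewrite ffunE; apply/eqP; rewrite -subr_eq0 -dE; apply/eqP.
apply: contrapT => di.
have F0 : \sum_(k < s) F k <> 0.
  apply: ordeq_sum_neq0 dis _; exists (nat_of_ord i); first exact: ltn_ord.
  have [h1 h2] := hhP _ (vs_val _ (ltn_ord i)).
  move=> /fps_mulf_eq0[/(congr1 (fun x => fcoef x 0))//|].
  by move=> /(congr1 (fun x => fcoef x (nth 0%N vs i))); rewrite h2 => /eqP; rewrite oner_eq0.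
have [o ho] := ordeq_ex F0.
have [k ks hk] := ordeq_sum dis ho.
(* The difference of two expansions of u lies in the ideal, so its order is s plus a value; but this
   order is one of the gaps. *)
have [l lE] : exists l, \sum_(k < s) F k = S h * S l.
  have [l lE] := (ideal2_S _ _).1 (ideal2D hz' (ideal2N hz)).
  exists l; rewrite -lE -/vs (big_nth 0%N) vs_size big_mkord opprB addrC subrKA -sumrB rmorph_sum.
  apply: eq_bigr => i' _; rewrite -mulrBl rmorphM rmorphB /= !S_bpsC -rmorphB /= /F dE.
  reflexivity.
have [l0|/eqP/ordeq_ex[o' ho']] := eqVneq (S l) 0; first by case: F0; rewrite lE l0 mulr0.
have oE : o = (s + o')%N by apply: (ordeq_uniq ho); rewrite lE; apply: ordeqM.
have /andP[_ /negP[]] := vs_gap _ ks.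
rewrite -(Ford _ _ ks hk) oE leq_addr addKn; apply/asboolP; by exists l.
Qed.

End Quotient.

Lemma quotient_dim_uniq h d : ~ ring_dvd f h -> quotient_dim f h d -> ordeq (S h) d.
Proof.
move=> fh hd; have /ordeq_ex[s hs] : S h <> 0 by move/S_ker.
have hs' := quotient_dim_value hs.
suff -> : d = s by [].
by apply/eqP; rewrite eqn_leq (quotient_dim_leq hd hs') (quotient_dim_leq hs' hd).
Qed.

Lemma semigroupE : semigroup f = [set v | is_value v].
Proof.
apply/seteqP; split=> [v [h [fh hd]]|v [h hv]]; first by exists h; apply: quotient_dim_uniq.
exists h; split; last exact: quotient_dim_value.
by move=> /S_dvd; apply: ordeq_neq0 hv.
Qed.

(** The computed generator is a value not generated by the earlier ones, which are all multiples of
    e_i; by [low_value] every smaller value is generated by them. *)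
Lemma semigroup_generatorsE betab i : semigroup_generators (semigroup f) b g betab ->
  (i <= g)%N -> betab i = semigen beta i.
Proof.
rewrite semigroupE => -[B0 Bmin _]; elim/ltn_ind: i => -[_ _|i IH ig]; first by rewrite B0.
have [|[Bv Bg] Bm] := Bmin i.+1; first by rewrite ig.
have gE : generated betab i.+1 = generated (semigen beta) i.+1.
  by apply: eq_generated => k ki; apply: IH => //; apply: leq_trans (ltnW _) ig.
rewrite gE in Bg Bm; apply/eqP; rewrite eqn_leq; apply/andP; split.
  apply: Bm; split; first exact: (is_value_semigen H ig).
  move=> /(generated_dvd H (ltnW ig)) /= ei.
  have /= := @semigen_ndvd beta g (ltnW (pb_b H)) (pb_last H) (pb_ndvd H) (pb_inc H) 1 i.+1.
  rewrite ig mul1n => /(_ isT ei); rewrite dvdn1 => n1.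
  have := @ratio_n_gt1 beta g b0 (pb_ndvd H) i.+1; rewrite ig (eqP n1) => /(_ isT).
  by rewrite ltnn.
rewrite leqNgt; apply/negP => lt; apply: Bg; case: Bv => k hk.
exact: (low_value H ig hk lt).
Qed.

End ValueQuotient.

(** * The irreducible components *)

Lemma sub_zclosure_in (K : fieldType) (r s : nat) (X A : set 'M[K]_(r, s)) :
  A `<=` X -> A `<=` zclosure_in X A.
Proof. by move=> AX x Ax; split=> [|Y _]; [apply: AX | apply]. Qed.

Lemma zclosure_in_closed (K : numFieldType) (r s : nat) (X A : set 'M[K]_(r, s)) :
  exists2 Y, zclosed Y & zclosure_in X A = X `&` Y.
Proof.
pose I := {Y : set 'M[K]_(r, s) | zclosed Y /\ A `<=` Y}.
exists [set x | forall i : I, proj1_sig i x].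
  by apply: zclosedI_fam => -[Y [cY AY]].
apply/seteqP; split=> x [Xx h]; split=> //.
  by move=> [Y [cY AY]]; apply: h.
by move=> Y cY AY; apply: (h (exist _ Y (conj cY AY))).
Qed.

Lemma cont_gt_closed (K : numFieldType) (m : nat) (f : bps K) (d : nat) :
  exists2 Y, zclosed Y & cont_gt m f d = jets0 m f `&` Y.
Proof.
pose I := {j : 'I_m.+1 | (j <= d)%N}.
exists [set x | forall i : I, x ord0 (sval i) = 0].
  by apply: zclosedI_fam => i; apply: zclosed_regular; apply: regular_coord.
apply/seteqP; split=> x [Xx h]; split=> //.
  by move=> [j jd] /=; have := h j jd; rewrite fcoefF -ltnS ltn_ord inord_val.
move=> k kd; rewrite fcoefF; case: leqP => // km.
by have := h (exist _ (inord k) (_ : (@inord m k <= d)%N)); apply; rewrite inordK.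
Qed.

Lemma cont_closure_sub_gt (K : numFieldType) (m : nat) (f : bps K) (d d' : nat) :
  (d < d')%N -> cont_closure m f d' `<=` cont_gt m f d.
Proof.
move=> dd'; have [Y cY YE] := cont_gt_closed m f d; rewrite YE => x [Xx h]; split=> //.
apply: h => // z hz; suff: cont_gt m f d z by rewrite YE => -[].
have /cont_eqP[Xz [oz _]] := hz; apply/cont_gtP; split=> //.
exact: vgeW oz.
Qed.

Section Components.
Variables (K : numClosedFieldType) (f : bps K) (a : nat -> K) (g : nat).
Variables (beta : nat -> nat) (w : K) (m : nat).
Hypothesis H : puiseux_branch f a g beta w.
Local Notation b := (beta 0).
Local Notation e := (gcd_seq beta).
Local Notation n := (ratio_n beta).
Local Notation M := (coindex beta).
Let b0 : (0 < b)%N. Proof. exact: ltnW (pb_b H). Qed.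
Let b10 : (0 < beta 1)%N. Proof. exact: leq_ltn_trans (leq0n _) (pb_b1 H). Qed.
Let n10 : (0 < n 1)%N. Proof. exact: ltnW (n1_gt1 H). Qed.
Lemma jets0_cont_gt : jets0 m f = cont_gt m f 0.
Proof.
apply/seteqP; split=> [x Xx|x []//]; apply/cont_gtP; split=> // k.
rewrite ltnS leqn0 => /eqP->; have [x0 _] := Xx; rewrite fcoefF leq0n.
by rewrite (_ : inord 0 = ord0) //; apply/val_inj; rewrite /= inordK.
Qed.

(** The case q = 0 of the irreducibility of the residual set. *)
Lemma jets0_irr : (m < n 1 * beta 1 + e 1)%N -> zirreducible (jets0 m f).
Proof.
rewrite jets0_cont_gt => mq; have := @cont_gt_irr _ _ _ _ _ _ _ H 0%N; rewrite muln0 muln1.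
by apply.
Qed.

Section Large.
Variable q : nat.
Hypothesis qm : (n 1 * q * beta 1 + e 1 <= m)%N.
Hypothesis mq : (m < n 1 * q.+1 * beta 1 + e 1)%N.

Lemma kappa_leq k : (n 1 * k * beta 1 + e 1 <= m)%N = (k <= q)%N.
Proof.
apply/idP/idP => [km|kq]; last first.
  by apply: leq_trans qm; rewrite leq_add2r leq_mul2r leq_mul2l kq !orbT.
rewrite leqNgt; apply/negP => qk; move: (leq_ltn_trans km mq).
by rewrite ltn_add2r ltnNge leq_mul2r leq_mul2l qk !orbT.
Qed.

Lemma jets0_components Z : irreducible_component (jets0 m f) Z <->
  Z = cont_gt m f (n 1 * q) \/
  exists k x, [/\ (0 < k <= q)%N, cont_eq m f (n 1 * k) x & Z = cont_closure m f (n 1 * k)].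
Proof.
have small k : (k <= q)%N -> (n 1 * k * beta 1 <= m)%N.
  by rewrite -kappa_leq; apply: leq_trans; apply: leq_addr.
(* Index 0 stands for B_m, and [P] discards the indices of empty strata. *)
pose F k := if k == 0%N then cont_gt m f (n 1 * q) else cont_closure m f (n 1 * k).
pose P k := (0 < k)%N -> exists x, cont_eq m f (n 1 * k) x.
have Fsub k : (0 < k)%N -> cont_eq m f (n 1 * k) `<=` F k.
  by case: k => // k _; apply: sub_zclosure_in => x [].
rewrite (@irreducible_componentE _ _ _ _ q.+1 P F); first last.
(* A smaller order of x0 is excluded from larger strata by the closed condition on x0; the opposite
   inclusions are excluded by counting parameters. *)
- move=> k l; rewrite !ltnS => kq lq; rewrite /P.
  have [->|k0] := posnP k; have [->|l0] := posnP l => //.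
  + move=> _ /(_ isT)[x hx] hs; case: (@cont_gt_not_sub _ _ _ _ _ _ _ H l q x) => //.
    by move: hs; rewrite /F -[l == _]negbK -lt0n l0.
  + move=> /(_ isT)[x hx] _ /(_ x (Fsub _ k0 _ hx))[_ /(_ (n 1 * k)%N)].
    by case: hx => _ [h _] h'; case: h; apply: h'; rewrite leq_mul2l kq orbT.
  move=> /(_ isT)[x hx] /(_ isT)[x' hx'] hs.
  have [lt|lt|//] := ltngtP k l.
    have := hs x (Fsub _ k0 _ hx); rewrite /F -[l == _]negbK -lt0n l0 /=.
    have lt' : (n 1 * k < n 1 * l)%N by rewrite ltn_mul2l n10.
    move=> /(cont_closure_sub_gt lt')[_ /(_ _ (leqnn _))].
    by case: hx => _ [h _] h'; case: h.
  case: (cont_eq_not_sub H l0 lt (small _ kq) hx' hx) => z /(Fsub _ k0)/hs.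
  by rewrite /F -[l == _]negbK -lt0n l0.
- move=> x Xx; have [u0|/ordeq_ex[N hN]] := pselect (Defs.arc x ord0 = 0).
    by exists 0%N; split=> //; apply/cont_gtP; rewrite u0.
  have hx : cont_eq m f N x by apply/cont_eqP.
  have [Nq|qN] := leqP N (n 1 * q).
    have /dvdnP[k NE] : (n 1 %| N)%N.
      apply: (cont_eq_dvd H hx); apply: leq_trans (small _ (leqnn q)).
      by rewrite leq_mul2r Nq orbT.
    rewrite mulnC in NE; rewrite NE leq_pmul2l // in Nq.
    have k0 : (0 < k)%N by have := cont_eq_gt0 hx; rewrite NE muln_gt0 => /andP[].
    by rewrite NE in hx; exists k; split=> //; [exists x | apply: Fsub].
  by exists 0%N; split=> //; apply/cont_gtP; split=> //; apply: vgeW hN.1.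
- move=> k _ _; rewrite /F; case: eqP => _; first exact: cont_gt_closed.
  exact: zclosure_in_closed.
- move=> k; rewrite ltnS /F /P => kq; case: posnP => [_ _|k0 /(_ isT)[x hx]].
    by apply: (cont_gt_irr H) => //; apply: small.
  apply: zirreducible_closure => [z []//|].
  have N0 : (0 < n 1 * k)%N by rewrite muln_gt0 n10.
  have [i [ka [lv NE _]]] := level_ex H N0.
  rewrite NE; apply: (cont_eq_irr H lv).
    by apply: contrapT => nf; apply: (cont_eq_empty H lv nf (x := x)); rewrite -NE.
  by rewrite -NE; apply: leq_trans (small _ kq); apply: leq_pmulr.
split=> [[k [kq Pk ->]]|[->|[k [x [/andP[k0 kq] hx ->]]]]].
- rewrite /F; case: posnP => k0; [by left | right].
  by have [x hx] := Pk k0; exists k, x; rewrite k0.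
- by exists 0%N.
by exists k; rewrite ltnS /F -[k == _]negbK -lt0n k0; split=> // _; exists x.
Qed.

(** Passage from the order n_1 k of x0 to its level: [feasible] expresses that the stratum is not
    empty, and i > 0 that n_1 divides the order. *)
Lemma level_component Z :
  (exists k x, [/\ (0 < k <= q)%N, cont_eq m f (n 1 * k) x & Z = cont_closure m f (n 1 * k)])
  <-> exists i kappa, [/\ (0 < i)%N, level_of g beta i kappa, feasible g beta m i kappa,
    (kappa * M i * beta 1 + e 1 <= m)%N & Z = cont_closure m f (kappa * M i)].
Proof.
split=> [[k [x [/andP[k0 kq] hx ->]]]|[i [ka [i0 lv fs le ->]]]].
  have N0 : (0 < n 1 * k)%N by rewrite muln_gt0 n10.
  have [i [ka [lv NE /(_ (dvdn_mulr _ (dvdnn _))) i0]]] := level_ex H N0.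
  exists i, ka; rewrite -NE kappa_leq; split=> //.
  by apply: contrapT => nf; apply: (cont_eq_empty H lv nf (x := x)); rewrite -NE.
have /dvdnP[k kE] : (n 1 %| ka * M i)%N.
  apply: dvdn_mull; apply: dvdn_trans (coindex_dvd b0 i0).
  by rewrite (coindexS b0) dvdn_mulr.
rewrite [(k * _)%N]mulnC in kE.
have ka0 : (0 < ka * M i)%N by case: lv => _ ka0 _; rewrite muln_gt0 ka0 (coindex_gt0 b0).
have [|[x hx] _] := cont_eq_irr H lv fs.
  by apply: leq_trans le; apply: leq_trans (leq_addr _ _); apply: leq_pmulr.
rewrite kE in ka0 hx le *; exists k, x; split=> //.
by move: ka0 le; rewrite muln_gt0 kappa_leq => /andP[_ ->].
Qed.

End Large.
End Components.

Theorem theorem4p9 (R : realType) (f : bps R[i]) (a : nat -> R[i])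
    (g : nat) (beta betab : nat -> nat) (m : nat) :
  let e := gcd_seq beta in
  let n := ratio_n beta in
  ring_irreducible f ->
  is_multiplicity f (beta 0%N) ->
  (1 < beta 0)%N ->
  is_parametrization f (beta 0%N) a ->
  puiseux_exponents a g beta ->
  semigroup_generators (semigroup f) (beta 0%N) g betab ->
  adapted_coordinates f beta ->
  (2 <= g)%N ->
  ((1 <= m < n 1 * beta 1 + e 1)%N ->
     jets0 m f = cont_gt m f 0 /\ zirreducible (jets0 m f)) /\
  (forall q : nat, (1 <= q)%N ->
     (q * n 1 * beta 1 + e 1 <= m < q.+1 * n 1 * beta 1 + e 1)%N ->
     forall Z : set (jet_space R[i] m),
       irreducible_component (jets0 m f) Z <->
       [\/ (exists kappa : nat,
              [/\ (1 <= kappa)%N,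
                  (kappa * betab 0 * betab 1 + e 1 <= m)%N
                & Z = cont_closure m f (kappa * betab 0)%N]),
           (exists j kappa : nat,
              [/\ (2 <= j <= g)%N, (1 <= kappa)%N, ~~ (n j %| kappa)%N,
                  (kappa * (\prod_(1 <= l < j) n l) * betab 1 + e 1 <= m
                     < kappa * betab j)%N
                & Z = cont_closure m f
                        ((kappa * betab 0) %/ \prod_(j <= l < g.+1) n l)%N])
         | Z = cont_gt m f (n 1 * q)%N]).
Proof.
move=> e n _ _ b1 fpar fexp fgen fcoord g2.
have [w H] := puiseux_branch_ex b1 fpar fexp fcoord g2.
have b0 : (0 < beta 0)%N by apply: ltnW.
split=> [/andP[_ mq]|q q1 /andP[]].
  by split; [exact: jets0_cont_gt | exact: (jets0_irr H)].
rewrite ![(_ * n 1)%N]mulnC => qm mq Z.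
have bE i : (i <= g)%N -> betab i = semigen beta i by apply: (semigroup_generatorsE H fgen).
have bE0 : betab 0 = beta 0 by rewrite bE.
have bE1 : betab 1 = beta 1 by rewrite bE // ltnW.
have NE j kappa : (j <= g)%N ->
    ((kappa * beta 0) %/ \prod_(j.+1 <= l < g.+1) n l = kappa * coindex beta j)%N.
  move=> jg; rewrite (coindex_last_prod b0 (pb_last H) jg) /coindex muln_divA //.
  by rewrite -(coindexE beta j) dvdn_mull.
rewrite (jets0_components H qm mq) (level_component H qm mq) bE0 bE1.
split=> [[->|[i [ka [i0 [ig ka0 nd] fs le ->]]]]|]; first exact: Or33.
  (* Level g is family (a), as n_1 ... n_g = b; a level i < g is family (b) with j = i + 1, where
     feasibility is the bound m < kappa betab_j. *)
  move: ig; rewrite leq_eqVlt => /orP[/eqP ig|ig].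
    by apply: Or31; exists ka; rewrite ig (coindex_last (pb_last H)) in le *.
  apply: Or32; exists i.+1, ka; rewrite (NE _ _ (ltnW ig)) bE // -(coindex_prod b0) le fs // nd //.
  by split=> //; rewrite ig andbT ltnS.
case=> [[ka [ka0 le ->]]|[j [ka [/andP[j2 jg] ka0 nd /andP[le lt] ->]]]|->]; [right|right|by left].
  exists g, ka; rewrite (coindex_last (pb_last H)); split=> //; first exact: ltnW.
    by split=> //; rewrite ltnn.
  by rewrite /feasible ltnn.
case: j j2 jg nd le lt => // j j1 jg nd le lt.
exists j, ka; rewrite (NE _ _ (ltnW jg)) (coindex_prod b0); split=> //.
  by split=> //; apply: ltnW.
by move=> _; rewrite -bE.
Qed.
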